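(* Let $X$ be a locally Noetherian scheme over a field $k$ of characteristic zero and let $\mathscr{F}$ be a locally free foliation on $X$ over $k$. Let $Z$ be an $\mathscr{F}$-invariant closed subscheme of $X$ and let $\pi : \tilde{X} \to X$ be the normalisation of the blowing up of $X$ along $Z$ (the normalisation being assumed finite). Then $\pi^* \mathscr{F}$ is a locally free (perhaps unsaturated) foliation on $\tilde{X}$.
   Context: A foliation $\mathscr{F}$ on $X$ over $k$ is a coherent subsheaf $\mathscr{F} \subseteq \mathscr{T}_{X/k}$ of the tangent sheaf closed under the Lie bracket (not necessarily saturated); it is locally free if it is a locally free $\mathscr{O}_X$-module of finite rank. A closed subscheme $Z\subseteq X$ with ideal sheaf $\mathscr{I}_Z$ is $\mathscr{F}$-invariant if $\partial(\mathscr{I}_Z)\subseteq\mathscr{I}_Z$ for all local derivations $\partial\in\mathscr{F}$. The conclusion means that the derivations in $\mathscr{F}$ lift to $\tilde X$, inducing a morphism $\pi^*\mathscr{F}\to\mathscr{T}_{\tilde X/k}$ which makes $\pi^*\mathscr{F}$ a locally free foliation on $\tilde X$. *)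

(* Defs.v *)
From HB Require Import structures.
From mathcomp Require Import all_boot all_order all_algebra.
From mathcomp Require Import mathcomp_extra boolp classical_sets functions.
From mathcomp Require Import filter topology_structure.
From mathcomp Require Import ring.

Set Implicit Arguments.
Unset Strict Implicit.
Unset Printing Implicit Defensive.

Import GRing.Theory.
Local Open Scope classical_set_scope.
Local Open Scope ring_scope.

Record opens (X : topologicalType) := Opens {
  oset : set X;
  open_oset : open oset }.

Notation "V <=o U" := (oset V `<=` oset U) (at level 70, no associativity).

Definition otop (X : topologicalType) : opens X := Opens openT.

Definition omeet (X : topologicalType) (U V : opens X) : opens X :=
  Opens (openI (open_oset U) (open_oset V)).

Lemma sub_otop (X : topologicalType) (U : opens X) : U <=o otop X.
Proof. by []. Qed.

Definition is_presheaf (X : topologicalType) (F : opens X -> Type)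
    (res : forall U V, V <=o U -> F U -> F V) : Prop :=
  (forall U (h : U <=o U) (s : F U), res U U h s = s) /\
  (forall U V W (hVU : V <=o U) (hWV : W <=o V) (hWU : W <=o U) (s : F U),
     res V W hWV (res U V hVU s) = res U W hWU s).

Definition is_sheaf (X : topologicalType) (F : opens X -> Type)
    (res : forall U V, V <=o U -> F U -> F V) : Prop :=
  is_presheaf res /\
  forall (I : Type) (U : opens X) (V : I -> opens X) (hV : forall i, V i <=o U),
    oset U `<=` \bigcup_i oset (V i) ->
    forall s : (forall i, F (V i)),
      (forall i j W (hi : W <=o V i) (hj : W <=o V j),
         res (V i) W hi (s i) = res (V j) W hj (s j)) ->
      exists! t : F U, forall i, res U (V i) (hV i) t = s i.

(** Rings of sections are [comPzRingType]s because the zero ring must be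
    allowed (for instance as the ring of sections over the empty set). *)
Record ringedSpace := RingedSpace {
  rs_top :> topologicalType;
  sect : opens rs_top -> comPzRingType;
  res : forall U V : opens rs_top, V <=o U -> {rmorphism sect U -> sect V};
  res_sheaf : is_sheaf (fun U V h => res h : sect U -> sect V) }.

Section RingedSpaceNotions.
Variable X : ringedSpace.

Lemma res_res (U V W : opens X) (h : V <=o U) (h' : W <=o V) (h'' : W <=o U)
  (s : sect U) : res h' (res h s) = res h'' s.
Proof. exact: (res_sheaf X).1.2. Qed.

(** The germ of [s] at [x] is defined and invertible in the stalk at [x]. *)
Definition unit_at (U : opens X) (s : sect U) (x : X) : Prop :=
  exists (V : opens X) (h : V <=o U),
    oset V x /\ exists t : sect V, res h s * t = 1.

(** The stalk at every point is a local ring: it is nonzero and its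
    non-units are stable under addition. *)
Definition locally_ringed : Prop :=
  (forall (U : opens X) (x : X), ~ unit_at (0 : sect U) x) /\
  (forall (U : opens X) (s t : sect U) (x : X),
     unit_at (s + t) x -> unit_at s x \/ unit_at t x).

Lemma open_basic (U : opens X) (f : sect U) : open [set x | unit_at f x].
Proof.
rewrite openE => x [V [h [Vx [t st]]]].
rewrite /= /interior nbhsE; exists (oset V).
  by split=> //; exact: open_oset.
by move=> y Vy; exists V, h; split=> //; exists t.
Qed.

(** The locus D(f) in U where f is invertible. *)
Definition basic (U : opens X) (f : sect U) : opens X := Opens (open_basic f).

Lemma basic_sub (U : opens X) (f : sect U) : basic f <=o U.
Proof. by move=> x [V [h [Vx _]]]; exact: h. Qed.

End RingedSpaceNotions.

Definition prime_ideal (A : comPzRingType) (P : set A) : Prop :=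
  [/\ P 0, (forall a b, P a -> P b -> P (a + b)), (forall a b, P b -> P (a * b)),
      ~ P 1 & (forall a b, P (a * b) -> P a \/ P b)].

(** The canonical map from U to Spec (sect U), sending x to the prime ideal of
    the sections vanishing at x, is an isomorphism: it is bijective (1), a
    homeomorphism (2), and identifies the sections over D(f) with the
    localisation of [sect U] at f, as for the structure sheaf of a spectrum
    (3, 4). *)
Definition affine (X : ringedSpace) (U : opens X) : Prop :=
  [/\ (forall P : set (sect U), prime_ideal P ->
         exists! x : X, oset U x /\ forall f, P f <-> ~ unit_at f x),
      (forall V : opens X, V <=o U -> forall x, oset V x ->
         exists f : sect U, unit_at f x /\ basic f <=o V),
      (forall (f : sect U) (t : sect (basic f)), exists (n : nat) (s : sect U),
         res (@basic_sub X U f) f ^+ n * t = res (@basic_sub X U f) s) &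
      (forall f s : sect U, res (@basic_sub X U f) s = 0 ->
         exists n : nat, f ^+ n * s = 0)].

Record scheme := Scheme {
  sch_rs :> ringedSpace;
  sch_local : locally_ringed sch_rs;
  sch_affine : forall x : sch_rs, exists U : opens sch_rs, oset U x /\ affine U }.

Definition noetherian (A : comPzRingType) : Prop :=
  forall I : set A,
    I 0 -> (forall a b, I a -> I b -> I (a + b)) -> (forall a b, I b -> I (a * b)) ->
    exists (n : nat) (g : 'I_n -> A), (forall i, I (g i)) /\
      forall a, I a -> exists c : 'I_n -> A, a = \sum_(i < n) c i * g i.

Definition locally_noetherian (X : scheme) : Prop :=
  forall x : X, exists U : opens X, [/\ oset U x, affine U & noetherian (sect U)].

(** [pull] is given on all pairs (V, W) with f(W) contained in V rather than
    only for W = f^-1(V); by [pull_res] this amounts to a morphism of sheaves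
    from the structure sheaf of Y to the direct image of that of X, and it lets
    sections be compared without transport along equalities of open sets. *)
Record morphism (X Y : scheme) := Morphism {
  mor_fun :> X -> Y;
  mor_continuous : continuous mor_fun;
  pull : forall (V : opens Y) (W : opens X),
    oset W `<=` mor_fun @^-1` oset V -> {rmorphism sect V -> sect W};
  pull_res : forall (V V' : opens Y) (W W' : opens X)
    (h : oset W `<=` mor_fun @^-1` oset V)
    (h' : oset W' `<=` mor_fun @^-1` oset V')
    (hV : V' <=o V) (hW : W' <=o W) (s : sect V),
    res hW (pull h s) = pull h' (res hV s);
  pull_local : forall (V : opens Y) (W : opens X)
    (h : oset W `<=` mor_fun @^-1` oset V) (s : sect V) (x : X),
    oset W x -> unit_at (pull h s) x -> unit_at s (mor_fun x) }.

Arguments pull {X Y} m {V W} h.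

Definition eq_mor (X Y : scheme) (f g : morphism X Y) : Prop :=
  f =1 g /\
  forall (V : opens Y) (W : opens X) (hf : oset W `<=` f @^-1` oset V)
    (hg : oset W `<=` g @^-1` oset V) (s : sect V), pull f hf s = pull g hg s.

Lemma open_preim (X Y : scheme) (f : morphism X Y) (V : opens Y) :
  open (f @^-1` oset V).
Proof. by move/continuousP: (@mor_continuous _ _ f); apply; exact: open_oset. Qed.

Definition preim (X Y : scheme) (f : morphism X Y) (V : opens Y) : opens X :=
  Opens (open_preim f V).

Lemma preim_sub (X Y : scheme) (f : morphism X Y) (V : opens Y) :
  oset (preim f V) `<=` f @^-1` oset V.
Proof. by []. Qed.

Section Composition.
Variables (X Y Z : scheme) (g : morphism Y Z) (f : morphism X Y).

Definition comp_pull (V : opens Z) (W : opens X)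
    (h : oset W `<=` (g \o f) @^-1` oset V) : {rmorphism sect V -> sect W} :=
  pull f (V := preim g V) h \o pull g (@preim_sub _ _ g V).

Lemma comp_continuous : continuous (g \o f).
Proof.
apply/continuousP => A oA; rewrite comp_preimage.
exact: (open_preim f (preim g (Opens oA))).
Qed.

Lemma comp_pull_res (V V' : opens Z) (W W' : opens X)
    (h : oset W `<=` (g \o f) @^-1` oset V)
    (h' : oset W' `<=` (g \o f) @^-1` oset V')
    (hV : V' <=o V) (hW : W' <=o W) (s : sect V) :
  res hW (comp_pull h s) = comp_pull h' (res hV s).
Proof.
have hp : preim g V' <=o preim g V by move=> y; exact: hV.
by rewrite /comp_pull /= (pull_res _ (h' : oset W' `<=` f @^-1` oset (preim g V')) hp)
  (pull_res _ (@preim_sub _ _ g V') hV).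
Qed.

Lemma comp_pull_local (V : opens Z) (W : opens X)
    (h : oset W `<=` (g \o f) @^-1` oset V) (s : sect V) (x : X) :
  oset W x -> unit_at (comp_pull h s) x -> unit_at s ((g \o f) x).
Proof.
move=> Wx /(pull_local Wx) /pull_local; apply; exact: (h x Wx).
Qed.

Definition comp_mor : morphism X Z :=
  Morphism comp_continuous comp_pull_res comp_pull_local.

End Composition.

Definition finite_morphism (X Y : scheme) (f : morphism X Y) : Prop :=
  forall U : opens Y, affine U ->
    affine (preim f U) /\
    exists (n : nat) (g : 'I_n -> sect (preim f U)), forall t,
      exists c : 'I_n -> sect U, t = \sum_(i < n) pull f (@preim_sub _ _ f U) (c i) * g i.

Definition closed_immersion (Z X : scheme) (i : morphism Z X) : Prop :=
  [/\ injective i,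
      (forall A : set Z, closed A -> closed (i @` A)) &
      (* surjectivity of the map of sheaves from O_X to i_* O_Z *)
      (forall (V : opens X) (t : sect (preim i V)) (x : X), oset V x ->
         exists (V' : opens X) (h : V' <=o V) (hp : preim i V' <=o preim i V)
           (s : sect V'), oset V' x /\ pull i (@preim_sub _ _ i V') s = res hp t)].

Definition ideal_sheaf (Z X : scheme) (i : morphism Z X) (U : opens X) : set (sect U) :=
  [set s | pull i (@preim_sub _ _ i U) s = 0].

(** Sections over [W] of the inverse image ideal sheaf of Z along g : T -> X,
    that is, of the ideal of O_T generated by the pullbacks of the sections of
    the ideal sheaf of Z. *)
Definition inverse_image_ideal (Z X : scheme) (i : morphism Z X)
    (T : scheme) (g : morphism T X) (W : opens T) : set (sect W) :=
  [set s | forall t, oset W t ->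
     exists (W' : opens T) (hW : W' <=o W) (V : opens X)
       (h : oset W' `<=` g @^-1` oset V) (n : nat)
       (x : 'I_n -> sect V) (a : 'I_n -> sect W'),
       [/\ oset W' t, forall j, ideal_sheaf i (x j) &
           res hW s = \sum_(j < n) a j * pull g h (x j)]].

(** The scheme-theoretic inverse image of Z in T is an effective Cartier
    divisor: its ideal is locally generated by one nonzerodivisor. *)
Definition cartier_preimage (Z X : scheme) (i : morphism Z X)
    (T : scheme) (g : morphism T X) : Prop :=
  forall t : T, exists (W : opens T) (h : sect W),
    [/\ oset W t,
        (forall (W' : opens T) (hW : W' <=o W) (u : sect W'),
           res hW h * u = 0 -> u = 0) &
        (forall (W' : opens T) (hW : W' <=o W) (s : sect W'),
           inverse_image_ideal i g s <-> exists u, s = u * res hW h)].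

(** The blowing up of X along Z is the terminal X-scheme in which the inverse
    image of Z is an effective Cartier divisor. *)
Definition is_blowup (Z X : scheme) (i : morphism Z X)
    (B : scheme) (b : morphism B X) : Prop :=
  cartier_preimage i b /\
  forall (T : scheme) (g : morphism T X), cartier_preimage i g ->
    exists g' : morphism T B, eq_mor (comp_mor b g') g /\
      forall g'' : morphism T B, eq_mor (comp_mor b g'') g -> eq_mor g'' g'.

Definition nilpotent (A : comPzRingType) (a : A) : Prop := exists n : nat, a ^+ n = 0.

(** [a] maps to a nonzerodivisor of the reduced ring of [A]. *)
Definition nonzerodivisor_red (A : comPzRingType) (a : A) : Prop :=
  forall b, nilpotent (a * b) -> nilpotent b.

(** [q : A -> Q] presents [Q] as the total ring of fractions of the reduced
    ring of [A]. *)
Definition is_total_fractions_red (A Q : comPzRingType) (q : {rmorphism A -> Q}) : Prop :=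
  [/\ (forall a, q a = 0 <-> nilpotent a),
      (forall s, nonzerodivisor_red s -> exists u, q s * u = 1) &
      (forall y, exists a s, nonzerodivisor_red s /\ y * q s = q a)].

Definition integral_over (A Q : comPzRingType) (q : {rmorphism A -> Q}) (y : Q) : Prop :=
  exists (n : nat) (c : 'I_n -> A), y ^+ n + \sum_(j < n) q (c j) * y ^+ j = 0.

(** [f : A -> B] presents [B] as the integral closure of the reduced ring of
    [A] in its total ring of fractions. *)
Definition is_normalisation_ring (A B : comPzRingType) (f : {rmorphism A -> B}) : Prop :=
  exists (Q : comPzRingType) (q : {rmorphism A -> Q}) (j : {rmorphism B -> Q}),
    [/\ is_total_fractions_red q, injective j, (forall a, j (f a) = q a) &
        (forall y, integral_over q y <-> exists b, j b = y)].

(** The morphism is affine, given over each affine open U = Spec A by the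
    integral closure of the reduced ring of A in its total ring of fractions.
    This is the normalisation for schemes whose affine opens have finitely many
    irreducible components, such as locally Noetherian ones. *)
Definition is_normalisation (X N : scheme) (nu : morphism N X) : Prop :=
  forall U : opens X, affine U ->
    affine (preim nu U) /\ is_normalisation_ring (pull nu (@preim_sub _ _ nu U)).

Record omodule (X : ringedSpace) := OModule {
  msect : forall U : opens X, lmodType (sect U);
  mres : forall U V : opens X, V <=o U -> msect U -> msect V;
  mresD : forall U V (h : V <=o U), {morph mres h : m m' / m + m'};
  mresZ : forall U V (h : V <=o U) (a : sect U) (m : msect U),
    mres h (a *: m) = res h a *: mres h m;
  mres_sheaf : is_sheaf (fun U V h => mres h : msect U -> msect V) }.

Record omod_mor (X : ringedSpace) (E F : omodule X) := OmodMor {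
  omod_fun :> forall U : opens X, msect E U -> msect F U;
  omod_mor_linear : forall U, linear (@omod_fun U);
  omod_mor_res : forall U V (h : V <=o U) (m : msect E U),
    mres h (omod_fun m) = omod_fun (mres h m) }.

Definition locally_free (X : ringedSpace) (E : omodule X) : Prop :=
  forall x : X, exists (U : opens X) (n : nat) (b : 'I_n -> msect E U),
    oset U x /\
    forall (V : opens X) (h : V <=o U) (m : msect E V),
      exists! c : 'I_n -> sect V, m = \sum_(j < n) c j *: mres h (b j).

(** Locally on affine opens U = Spec A, [E] is the sheaf associated with a
    finitely generated A-module: the sections over D(f) are the localisation at
    f of the sections over U. *)
Definition coherent (X : ringedSpace) (E : omodule X) : Prop :=
  forall x : X, exists U : opens X,
    [/\ oset U x, affine U,
        (exists (n : nat) (g : 'I_n -> msect E U), forall m,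
           exists c : 'I_n -> sect U, m = \sum_(j < n) c j *: g j),
        (forall (f : sect U) (m : msect E (basic f)),
           exists (n : nat) (m' : msect E U),
             res (@basic_sub X U f) f ^+ n *: m = mres (@basic_sub X U f) m') &
        (forall (f : sect U) (m : msect E U), mres (@basic_sub X U f) m = 0 ->
           exists n : nat, f ^+ n *: m = 0)].

(** Morphisms of O_Y-modules from [E] to the direct image of [G], described on
    pairs (V, W) with f(W) contained in V as for [pull]. *)
Record mod_over (X Y : scheme) (f : morphism X Y) (E : omodule Y) (G : omodule X) :=
  ModOver {
  mo_fun : forall (V : opens Y) (W : opens X), oset W `<=` f @^-1` oset V ->
    msect E V -> msect G W;
  mo_add : forall V W (h : oset W `<=` f @^-1` oset V),
    {morph mo_fun h : m m' / m + m'};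
  mo_scale : forall V W (h : oset W `<=` f @^-1` oset V) (a : sect V) (m : msect E V),
    mo_fun h (a *: m) = pull f h a *: mo_fun h m;
  mo_res : forall (V V' : opens Y) (W W' : opens X)
    (h : oset W `<=` f @^-1` oset V) (h' : oset W' `<=` f @^-1` oset V')
    (hV : V' <=o V) (hW : W' <=o W) (m : msect E V),
    mres hW (mo_fun h m) = mo_fun h' (mres hV m) }.

(** [eta] exhibits [M] as the pullback f^* E, through the adjunction
    Hom(f^* E, G) = Hom(E, f_* G). *)
Definition is_pullback (X Y : scheme) (f : morphism X Y) (E : omodule Y)
    (M : omodule X) (eta : mod_over f E M) : Prop :=
  forall (G : omodule X) (gamma : mod_over f E G),
    exists phi : omod_mor M G,
      (forall V W (h : oset W `<=` f @^-1` oset V) (m : msect E V),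
         phi W (mo_fun eta h m) = mo_fun gamma h m) /\
      forall phi' : omod_mor M G,
        (forall V W (h : oset W `<=` f @^-1` oset V) (m : msect E V),
           phi' W (mo_fun eta h m) = mo_fun gamma h m) ->
        forall W (m : msect M W), phi' W m = phi W m.

(** A scheme over a field k is a scheme X with a ring morphism from k to its
    global sections. The sections of the tangent sheaf, the dual of the sheaf of
    Kähler differentials of X over k, are the k-derivations of the structure
    sheaf. *)
#[local] Obligation Tactic := idtac.

Section TangentSheaf.
Variables (k : fieldType) (X : ringedSpace) (c : {rmorphism k -> sect (otop X)}).

Record derivation (U : opens X) := Derivation {
  der : forall V : opens X, V <=o U -> sect V -> sect V;
  derD : forall V (h : V <=o U), {morph der h : s t / s + t};
  derM : forall V (h : V <=o U) (s t : sect V),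
    der h (s * t) = s * der h t + t * der h s;
  derC : forall V (h : V <=o U) (a : k), der h (res (@sub_otop _ V) (c a)) = 0;
  der_res : forall V W (hV : V <=o U) (hW : W <=o U) (h : W <=o V) (s : sect V),
    res h (der hV s) = der hW (res h s) }.

Lemma derivation_eq (U : opens X) (D E : derivation U) :
  (forall V (h : V <=o U) s, der D h s = der E h s) -> D = E.
Proof.
case: D E => [d d1 d2 d3 d4] [e e1 e2 e3 e4] /= de.
have {de} de : d = e by do 3![apply: functional_extensionality_dep => ?]; exact: de.
subst e; congr Derivation; exact: Prop_irrelevance.
Qed.

HB.instance Definition _ (U : opens X) := gen_eqMixin (derivation U).
HB.instance Definition _ (U : opens X) := gen_choiceMixin (derivation U).

Lemma der0 (U V : opens X) (D : derivation U) (h : V <=o U) : der D h 0 = 0.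
Proof. by apply: (addrI (der D h 0)); rewrite -derD !addr0. Qed.

Section Operations.
Variable U : opens X.

Program Definition der_zero : derivation U := @Derivation U (fun V h s => 0) _ _ _ _.
Next Obligation. by move=> V h s t; rewrite /= addr0. Qed.
Next Obligation. by move=> V h s t; rewrite /= !mulr0 addr0. Qed.
Next Obligation. by []. Qed.
Next Obligation. by move=> V W hV hW h s; rewrite /= rmorph0. Qed.

Program Definition der_opp (D : derivation U) : derivation U :=
  @Derivation U (fun V h s => - der D h s) _ _ _ _.
Next Obligation. by move=> D V h s t; rewrite /= derD opprD. Qed.
Next Obligation. by move=> D V h s t; rewrite /= derM opprD !mulrN. Qed.
Next Obligation. by move=> D V h a; rewrite /= derC oppr0. Qed.
Next Obligation. by move=> D V W hV hW h s; rewrite /= rmorphN /= (der_res D hV hW). Qed.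

Program Definition der_add (D E : derivation U) : derivation U :=
  @Derivation U (fun V h s => der D h s + der E h s) _ _ _ _.
Next Obligation. by move=> D E V h s t; rewrite /= !derD addrACA. Qed.
Next Obligation. by move=> D E V h s t; rewrite /= !derM !mulrDr addrACA. Qed.
Next Obligation. by move=> D E V h a; rewrite /= !derC addr0. Qed.
Next Obligation.
by move=> D E V W hV hW h s; rewrite /= rmorphD /= (der_res D hV hW) (der_res E hV hW).
Qed.

Program Definition der_scale (a : sect U) (D : derivation U) : derivation U :=
  @Derivation U (fun V h s => res h a * der D h s) _ _ _ _.
Next Obligation. by move=> a D V h s t; rewrite /= derD mulrDr. Qed.
Next Obligation.
by move=> a D V h s t; rewrite /= derM mulrDr !(mulrCA (res h a)).
Qed.
Next Obligation. by move=> a D V h b; rewrite /= derC mulr0. Qed.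
Next Obligation.
move=> a D V W hV hW h s; rewrite /= rmorphM /= (der_res D hV hW).
by rewrite (res_res _ _ hW).
Qed.

Program Definition bracket (D E : derivation U) : derivation U :=
  @Derivation U (fun V h s => der D h (der E h s) - der E h (der D h s)) _ _ _ _.
Next Obligation. by move=> D E V h s t; rewrite /= !derD opprD addrACA. Qed.
Next Obligation.
by move=> D E V h s t; rewrite /= !derM !derD !derM; ring.
Qed.
Next Obligation. by move=> D E V h a; rewrite /= !derC !der0 subr0. Qed.
Next Obligation.
move=> D E V W hV hW h s.
by rewrite /= rmorphB /= (der_res D hV hW) (der_res E hV hW) (der_res E hV hW)
  (der_res D hV hW).
Qed.

Lemma der_addA : associative der_add.
Proof. by move=> D E G; apply: derivation_eq => V h s; exact: addrA. Qed.
Lemma der_addC : commutative der_add.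
Proof. by move=> D E; apply: derivation_eq => V h s; exact: addrC. Qed.
Lemma der_add0 : left_id der_zero der_add.
Proof. by move=> D; apply: derivation_eq => V h s; exact: add0r. Qed.
Lemma der_addN : left_inverse der_zero der_opp der_add.
Proof. by move=> D; apply: derivation_eq => V h s; exact: addNr. Qed.

HB.instance Definition _ :=
  GRing.isZmodule.Build (derivation U) der_addA der_addC der_add0 der_addN.

Lemma der_scaleA a b D : der_scale a (der_scale b D) = der_scale (a * b) D.
Proof. by apply: derivation_eq => V h s /=; rewrite rmorphM mulrA. Qed.
Lemma der_scale1 : left_id 1 der_scale.
Proof. by move=> D; apply: derivation_eq => V h s /=; rewrite rmorph1 mul1r. Qed.
Lemma der_scaleDr : right_distributive der_scale +%R.
Proof. by move=> a D E; apply: derivation_eq => V h s /=; rewrite mulrDr. Qed.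
Lemma der_scaleDl D : {morph der_scale^~ D : a b / a + b}.
Proof. by move=> a b; apply: derivation_eq => V h s /=; rewrite rmorphD mulrDl. Qed.

HB.instance Definition _ :=
  GRing.Zmodule_isLmodule.Build (sect U) (derivation U)
    der_scaleA der_scale1 der_scaleDr der_scaleDl.

End Operations.

Program Definition der_restrict (U V : opens X) (hVU : V <=o U) (D : derivation U) :
  derivation V :=
  @Derivation V (fun W h s => der D (subset_trans h hVU) s) _ _ _ _.
Next Obligation. by move=> U V hVU D W h s t; rewrite /= derD. Qed.
Next Obligation. by move=> U V hVU D W h s t; rewrite /= derM. Qed.
Next Obligation. by move=> U V hVU D W h a; rewrite /= derC. Qed.
Next Obligation. by move=> U V hVU D W W' h h' i s; exact: der_res. Qed.

Lemma der_restrictD (U V : opens X) (h : V <=o U) :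
  {morph der_restrict h : D E / D + E}.
Proof. by move=> D E; exact: derivation_eq. Qed.

Lemma der_restrictZ (U V : opens X) (h : V <=o U) (a : sect U) (D : derivation U) :
  der_restrict h (a *: D) = res h a *: der_restrict h D.
Proof.
apply: derivation_eq => W hW s /=; congr (_ * _).
by rewrite (res_res _ _ (subset_trans hW h)).
Qed.

Lemma der_restrict_sheaf :
  is_sheaf (fun U V h => der_restrict h : derivation U -> derivation V).
Proof.
split.
  split=> [U h D|U V W h h' h'' D]; apply: derivation_eq => W' i s /=;
  by congr (der D _ s); exact: Prop_irrelevance.
move=> I U V hV cov d comp.
have compE i j W (hi : W <=o V i) (hj : W <=o V j) s : der (d i) hi s = der (d j) hj s.
  have /(congr1 (fun D => der D (@subset_refl _ (oset W)) s)) /= := comp i j W hi hj.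
  have -> : subset_trans (@subset_refl _ (oset W)) hi = hi by exact: Prop_irrelevance.
  by have -> : subset_trans (@subset_refl _ (oset W)) hj = hj by exact: Prop_irrelevance.
pose m W i := omeet W (V i).
have mW W i : m W i <=o W by exact: subIsetl.
have mV W i : m W i <=o V i by exact: subIsetr.
have mcov W : W <=o U -> oset W `<=` \bigcup_i oset (m W i).
  by move=> h x Wx; have [i _ Vx] := cov x (h x Wx); exists i.
have sep W (h : W <=o U) (s t : sect W) :
    (forall i, res (mW W i) s = res (mW W i) t) -> s = t.
  move=> st.
  have [|u [_ uu]] := (res_sheaf X).2 I W (m W) (mW W) (mcov W h)
      (fun i => res (mW W i) s).
    by move=> i j W' hi hj; rewrite (res_res _ _ (subset_trans hi (mW W i)))
       (res_res _ _ (subset_trans hi (mW W i))).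
  by rewrite -(uu s (fun=> erefl)) -(uu t (fun i => esym (st i))).
have ex W (h : W <=o U) (s : sect W) :
    exists t, forall i, res (mW W i) t = der (d i) (mV W i) (res (mW W i) s).
  have [|t [tP _]] := (res_sheaf X).2 I W (m W) (mW W) (mcov W h)
      (fun i => der (d i) (mV W i) (res (mW W i) s)); last by exists t.
  move=> i j W' hi hj.
  rewrite (der_res (d i) _ (subset_trans hi (mV W i))).
  rewrite (der_res (d j) _ (subset_trans hj (mV W j))).
  rewrite !(res_res _ _ (subset_trans hi (mW W i))).
  exact: compE.
pose g W h s := projT1 (cid (ex W h s)).
have gP W h s i : res (mW W i) (g W h s) = der (d i) (mV W i) (res (mW W i) s).
  exact: (projT2 (cid (ex W h s))).
have gD W h : {morph g W h : s t / s + t}.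
  by move=> s t; apply: (sep W h) => i; rewrite gP !rmorphD /= derD !gP.
have gM W h s t : g W h (s * t) = s * g W h t + t * g W h s.
  apply: (sep W h) => i; rewrite gP rmorphM /= derM rmorphD !rmorphM /=.
  by rewrite !gP.
have gC W h a : g W h (res (@sub_otop _ W) (c a)) = 0.
  apply: (sep W h) => i; rewrite gP (res_res _ _ (@sub_otop _ (m W i))) derC.
  by rewrite rmorph0.
have gr W W' (h : W <=o U) (h' : W' <=o U) (h'' : W' <=o W) s :
    res h'' (g W h s) = g W' h' (res h'' s).
  apply: (sep W' h') => i; rewrite gP.
  have hm : m W' i <=o m W i by move=> x [W'x Vx]; split=> //; exact: h''.
  rewrite !(res_res _ _ (subset_trans hm (mW W i))).
  rewrite -(res_res (mW W i) hm) gP (der_res (d i) _ (mV W' i)).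
  by rewrite (res_res _ _ (subset_trans hm (mW W i))).
exists (Derivation gD gM gC gr); split.
  move=> i; apply: derivation_eq => W h s /=.
  apply: (sep W (subset_trans h (hV i))) => j.
  by rewrite gP (der_res (d i) h (subset_trans (mW W j) h)); exact: compE.
move=> D DP; apply: derivation_eq => W h s /=.
apply: (sep W h) => i; rewrite gP -(DP i) /=.
rewrite (der_res D h (subset_trans (mW W i) h)).
by congr (der D _ _); exact: Prop_irrelevance.
Qed.

Definition tangent_sheaf : omodule X :=
  @OModule X (fun U => derivation U : lmodType (sect U)) der_restrict
    der_restrictD der_restrictZ der_restrict_sheaf.

End TangentSheaf.

Section Foliations.
Variables (k : fieldType) (X : ringedSpace) (c : {rmorphism k -> sect (otop X)}).

(** The morphism [a] exhibits [F] as a coherent subsheaf of the tangent sheaf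
    that is closed under the Lie bracket. *)
Definition foliation (F : omodule X) (a : omod_mor F (tangent_sheaf c)) : Prop :=
  [/\ coherent F,
      (forall U, injective (@omod_fun _ _ _ a U)) &
      (forall (U : opens X) (u v : msect F U),
         exists w : msect F U, a U w = bracket (a U u) (a U v))].

End Foliations.

Definition foliation_invariant (k : fieldType) (X : scheme) (c : {rmorphism k -> sect (otop X)})
    (F : omodule X) (a : omod_mor F (tangent_sheaf c))
    (Z : scheme) (i : morphism Z X) : Prop :=
  forall (U V : opens X) (h : V <=o U) (u : msect F U) (s : sect V),
    ideal_sheaf i s -> ideal_sheaf i (der (a U u) h s).

(** The structure of scheme over k induced on the source of f. *)
Definition induced_base (k : fieldType) (X Y : scheme) (f : morphism X Y)
    (c : {rmorphism k -> sect (otop Y)}) : {rmorphism k -> sect (otop X)} :=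
  pull f (V := otop Y) (W := otop X) (fun x _ => I) \o c.

(** The derivation D' on W lifts the derivation D on V along f. *)
Definition lifts (k : fieldType) (X Y : scheme) (f : morphism X Y)
    (cX : {rmorphism k -> sect (otop X)}) (cY : {rmorphism k -> sect (otop Y)})
    (V : opens Y) (W : opens X) (D : derivation cY V) (D' : derivation cX W) : Prop :=
  forall (V' : opens Y) (W' : opens X) (hV : V' <=o V) (hW : W' <=o W)
    (h : oset W' `<=` f @^-1` oset V') (s : sect V'),
    der D' hW (pull f h s) = pull f h (der D hV s).

(* Main.v *)
From HB Require Import structures.
From mathcomp Require Import all_boot all_order all_algebra.
From mathcomp Require Import boolp classical_sets.
From mathcomp Require Import filter topology_structure.
From mathcomp Require Import ring.
Import GRing.Theory.
Require Import Defs.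
Set Implicit Arguments.
Unset Strict Implicit.
Unset Printing Implicit Defensive.
Local Open Scope classical_set_scope.
Local Open Scope ring_scope.

(** A derivation [D] in the foliation, defined near a point of [X], is a morphism to [X]
    from the first-order thickening of an affine open [W] of the blowing up [B]. As [Z] is
    invariant, its preimage in the thickening is still an effective Cartier divisor, so
    the universal property of [B] lifts this morphism, that is, lifts [D] to [W].
    Testing the same property against the spectrum of the ring generated over [X] by the
    quotients [f_j / f_l] of equations of [Z] shows that [B] is locally Noetherian.
    Derivations then extend to the normalisation by Seidenberg's theorem, and lifts are
    unique because a derivation that kills the functions on [X] kills the quotients
    [f_j / f_l], hence everything. Since the exceptional divisor is given by a
    nonzerodivisor and [B] agrees with [X] off it, a linear relation between lifted
    derivations descends to a relation modulo nilpotents on [X], where only nilpotent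
    coefficients are possible; these vanish on the reduced normalisation. *)

(** * Sheaves and prime ideals *)

(** Both the blowing up and the pullback module are given by universal properties only, so every
    local statement about them has to come from a test object. Spectra, morphisms into an affine
    open set and modules extended from an open set are built for this purpose. Two obstacles shape
    the rest. Seidenberg's argument first yields almost integrality only, and passing to integrality
    takes Noetherian rings of sections on the blowing up; characteristic zero enters through the
    factor n! in that argument and through the fact that derivations then preserve nilpotents.
    Moreover [X] may be non-reduced while the normalisation sees reduced rings only: injectivity of
    [a] excludes exact relations between derivations, whereas what comes down from the normalisation
    is a relation up to nilpotents. [independent_mod_nilpotents] closes this gap by multiplying with
    a suitable annihilator of the nilradical. *)

Lemma sheaf_sep (X : topologicalType) (F : opens X -> Type)
    (r : forall U V, V <=o U -> F U -> F V) (HF : is_sheaf r) (U : opens X) (s t : F U) :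
  (forall x, oset U x -> exists (V : opens X) (h : V <=o U),
     oset V x /\ r U V h s = r U V h t) -> s = t.
Proof.
move=> loc; have [[rid rr] HF2] := HF.
pose I := {V : opens X & {h : V <=o U | r U V h s = r U V h t}}.
have [||u [_ uu]] := HF2 I U (fun i => projT1 i) (fun i => sval (projT2 i)) _
    (fun i => r U (projT1 i) (sval (projT2 i)) s).
- by move=> x /loc [V [h [Vx e]]]; exists (existT _ V (exist _ h e)).
- by move=> i j W hi hj; rewrite !(rr _ _ _ _ _ (subset_trans hi (sval (projT2 i)))).
by rewrite -(uu s (fun=> erefl)) -(uu t (fun i => esym (svalP (projT2 i)))).
Qed.

(** The index set is the set of all local sections satisfying [P], so neither a covering nor a
    family of sections has to be chosen, and the glued section restricts to every section satisfying
    [P]. *)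
Lemma sheaf_glue (X : topologicalType) (F : opens X -> Type)
    (r : forall U V, V <=o U -> F U -> F V) (HF : is_sheaf r) (U : opens X)
    (P : forall V, V <=o U -> F V -> Prop) :
  (forall V V' h h' s s' W (k : W <=o V) (k' : W <=o V'),
      P V h s -> P V' h' s' -> r V W k s = r V' W k' s') ->
  (forall x, oset U x -> exists (V : opens X) (h : V <=o U) (s : F V), oset V x /\ P V h s) ->
  exists t : F U, forall V h s, P V h s -> r U V h t = s.
Proof.
move=> compat ex; have [_ HF2] := HF.
pose I := {V : opens X & {h : V <=o U & {s : F V | P V h s}}}.
have [||u [uP _]] := HF2 I U (fun i => projT1 i) (fun i => projT1 (projT2 i)) _
    (fun i => sval (projT2 (projT2 i))).
- by move=> x /ex [V [h [s [Vx Ps]]]]; exists (existT _ V (existT _ h (exist _ s Ps))).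
- move=> i j W hi hj; exact: (compat _ _ _ _ _ _ _ hi hj (svalP (projT2 (projT2 i)))
    (svalP (projT2 (projT2 j)))).
exists u => V h s Ps; exact: (uP (existT _ V (existT _ h (exist _ s Ps)))).
Qed.

Lemma additive_zmod_morphism (A B : zmodType) (f : A -> B) :
  {morph f : x y / x + y} -> zmod_morphism f.
Proof. by move=> fD x y; apply: (addIr (f y)); rewrite -fD !subrK. Qed.

Lemma exists_rmorphism (A B : pzRingType) (f : A -> B) :
  {morph f : x y / x + y} -> {morph f : x y / x * y} -> f 1 = 1 ->
  exists g : {rmorphism A -> B}, g =1 f.
Proof.
move=> fD fM f1.
pose m1 := GRing.isZmodMorphism.Build _ _ f (additive_zmod_morphism fD).
pose m2 := GRing.isMonoidMorphism.Build _ _ f (f1, fM).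
pose g : {rmorphism A -> B} := HB.pack f m1 m2.
by exists g.
Qed.

Section Ideals.
Variable A : comPzRingType.

Definition is_ideal (I : set A) :=
  [/\ I 0, (forall a b, I a -> I b -> I (a + b)) & (forall a b, I b -> I (a * b))].

(** An ideal that is maximal among those containing [I] and missing all powers of [f] is prime. *)
Lemma prime_avoiding_powers (I : set A) (f : A) : is_ideal I ->
  (forall n, ~ I (f ^+ n)) -> exists P, [/\ prime_ideal P, I `<=` P & ~ P f].
Proof.
move=> idI If.
pose good (J : set A) := [/\ is_ideal J, I `<=` J & forall n, ~ J (f ^+ n)].
have [|M [goodM maxM]] := @Zorn_bigcup A [set J | J = set0 \/ good J].
  move=> F FP tot.
  have [[J FJ J0]|none] := pselect (exists2 J, F J & J <> set0); last first.
    left; apply/seteqP; split=> // x [J FJ Jx]; case: none; exists J => //.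
    by move=> e; rewrite e in Jx.
  have goodF K x : F K -> K x -> good K.
    by move=> FK Kx; case: (FP K FK) => // e; rewrite e in Kx.
  have gJ : good J by case: (FP J FJ).
  right; split.
  - split.
    + by exists J => //; case: gJ => -[].
    + move=> a b [K FK Ka] [L FL Lb]; have [KL|LK] := tot K L FK FL.
        exists L => //; have [[_ addL _] _ _] := goodF L b FL Lb.
        by apply: addL => //; exact: KL.
      exists K => //; have [[_ addK _] _ _] := goodF K a FK Ka.
      by apply: addK => //; exact: LK.
    + move=> a b [K FK Kb]; exists K => //.
      by have [[_ _ mulK] _ _] := goodF K b FK Kb; exact: mulK.
  - by move=> x Ix; exists J => //; case: gJ => _ IJ _; exact: IJ.
  - by move=> n [K FK Kn]; have [_ _] := goodF K _ FK Kn; apply; exact: Kn.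
have {}goodM : good M.
  case: goodM => // M0; exfalso; apply: (maxM I); last by right; split.
  rewrite M0; split=> // sub; case: idI => I0 _ _; exact: (sub 0 I0).
have [[M0 MD MM] IM Mf] := goodM.
(* By maximality, adjoining to [M] an element outside it produces a power of [f]. Multiplying two
   such expressions shows that [M] is prime. *)
have ext a : ~ M a -> exists n m r, M m /\ f ^+ n = m + r * a.
  move=> Ma; apply/not_existsP => none.
  pose N := [set x | exists m r, M m /\ x = m + r * a].
  apply: (maxM N).
    split; first by move=> m Mm; exists m, 0; split=> //; rewrite mul0r addr0.
    move=> sub; apply: Ma; apply: sub; exists 0, 1; split=> //.
    by rewrite add0r mul1r.
  right; split.
  - split.
    + by exists 0, 0; split=> //; rewrite mul0r addr0.
    + move=> _ _ [m [r [Mm ->]]] [m' [r' [Mm' ->]]]; exists (m + m'), (r + r').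
      by split; [exact: MD | rewrite mulrDl addrACA].
    + move=> c _ [m [r [Mm ->]]]; exists (c * m), (c * r).
      by split; [exact: MM | rewrite mulrDr mulrA].
  - by move=> x Ix; exists x, 0; split; [exact: IM | rewrite mul0r addr0].
  - by move=> n [m [r e]]; apply: (none n); exists m, r.
exists M; split=> //; last by move=> Mf1; apply: (Mf 1%N); rewrite expr1.
split=> //; first by move=> M1; apply: (Mf 0%N); rewrite expr0.
move=> a b Mab; apply: contrapT => /not_orP [Ma Mb].
have [n [m [r [Mm e]]]] := ext a Ma; have [n' [m' [r' [Mm' e']]]] := ext b Mb.
apply: (Mf (n + n')%N); rewrite exprD e e' mulrDr; apply: (MD); first exact: MM.
rewrite mulrDl; apply: MD; first by rewrite mulrC; exact: MM.
by rewrite mulrACA; exact: MM.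
Qed.

End Ideals.

(** * Ringed spaces and affine open sets *)

Section RingedSpaces.
Variable X : ringedSpace.
Implicit Types U V W : opens X.

Lemma omeetl U V : omeet U V <=o U.
Proof. exact: subIsetl. Qed.

Lemma omeetr U V : omeet U V <=o V.
Proof. exact: subIsetr. Qed.

Arguments omeetl U V _ _ : clear implicits.
Arguments omeetr U V _ _ : clear implicits.

Lemma res_irr U V (h h' : V <=o U) (s : sect U) : res h s = res h' s.
Proof. by congr (res _ _); exact: Prop_irrelevance. Qed.

Lemma res_id U (h : U <=o U) (s : sect U) : res h s = s.
Proof. exact: (res_sheaf X).1.1. Qed.

Lemma resE U V W (h : V <=o U) (h' : W <=o V) (s : sect U) :
  res h' (res h s) = res (subset_trans h' h) s.
Proof. exact: res_res. Qed.

Lemma sect_sep U (s t : sect U) :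
  (forall x, oset U x -> exists V (h : V <=o U), oset V x /\ res h s = res h t) -> s = t.
Proof. exact: (sheaf_sep (res_sheaf X)). Qed.

Lemma res_inj U V (h : V <=o U) (s t : sect U) : U <=o V -> res h s = res h t -> s = t.
Proof.
move=> h' e; rewrite -[s](res_id (subset_trans h' h)) -[t](res_id (subset_trans h' h)).
by rewrite -!resE e.
Qed.

Lemma sect_empty U (s t : sect U) : (forall x, ~ oset U x) -> s = t.
Proof. by move=> U0; apply: sect_sep => x /U0. Qed.

Lemma mulr_can (A : comPzRingType) (u v a b : A) : u * v = 1 -> u * a = u * b -> a = b.
Proof.
move=> uv e; have uvK c : v * (u * c) = c by rewrite mulrA [v * u]mulrC uv mul1r.
by rewrite -[a]uvK e uvK.
Qed.

Lemma unit_at_mem U (s : sect U) x : unit_at s x -> oset U x.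
Proof. by case=> V [h [Vx _]]; exact: h. Qed.

Lemma unit_at_res U V (h : V <=o U) (s : sect U) x :
  oset V x -> unit_at (res h s) x <-> unit_at s x.
Proof.
move=> Vx; split=> -[W [k [Wx [t st]]]].
  exists W, (subset_trans k h); split=> //; exists t.
  by rewrite -st resE.
exists (omeet W V), (omeetr W V); split=> //.
exists (res (omeetl W V) t).
rewrite resE (res_irr _ (subset_trans (omeetl W V) k)).
by rewrite -resE -rmorphM st rmorph1.
Qed.

Lemma unit_at_inv_mem U (s t : sect U) x : s * t = 1 -> oset U x -> unit_at s x.
Proof. by move=> st Ux; exists U, (@subset_refl _ _); split=> //; exists t; rewrite res_id. Qed.

Lemma unit_at1 U x : oset U x -> unit_at (1 : sect U) x.
Proof. by apply: (unit_at_inv_mem (t := 1)); rewrite mulr1. Qed.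

Lemma unit_atM U (s t : sect U) x : unit_at (s * t) x <-> unit_at s x /\ unit_at t x.
Proof.
split=> [[V [h [Vx [u e]]]]|[[V [h [Vx [u e]]]] [W [k [Wx [v e']]]]]].
  by split; exists V, h; split=> //; [exists (res h t * u) | exists (res h s * u)];
    rewrite -e rmorphM; ring.
exists (omeet V W), (subset_trans (omeetl V W) h); split=> //.
exists (res (omeetl V W) u *
        res (omeetr V W) v).
rewrite rmorphM mulrACA [res _ t](res_irr _ (subset_trans (omeetr V W) k)).
by rewrite -!resE -!rmorphM e e' !rmorph1 mulr1.
Qed.

Lemma unit_atX U (s : sect U) x n : unit_at s x -> unit_at (s ^+ n) x.
Proof.
move=> sx; elim: n => [|n IH]; first by rewrite expr0; exact: unit_at1 (unit_at_mem sx).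
by rewrite exprS; apply/unit_atM.
Qed.

(** Inverses are unique, so local inverses agree on overlaps and glue. *)
Lemma unit_glue U (s : sect U) : (forall x, oset U x -> unit_at s x) -> exists t, s * t = 1.
Proof.
move=> su.
have [|x Ux|t tP] := sheaf_glue (res_sheaf X) (U := U)
    (P := fun V h t => res h s * t = 1).
- move=> V V' h h' t t' W k k' e e'.
  apply: (@mulr_can _ (res (subset_trans k h) s) (res k t)); first by
    rewrite -resE -rmorphM e rmorph1.
  rewrite -{1}resE -rmorphM e rmorph1 (res_irr _ (subset_trans k' h')) -resE.
  by rewrite -rmorphM e' rmorph1.
- by have [V [h [Vx [t e]]]] := su x Ux; exists V, h, t.
exists t; apply: sect_sep => x Ux; have [V [h [Vx [u e]]]] := su x Ux.
by exists V, h; split=> //; rewrite rmorphM rmorph1 (tP V h u e).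
Qed.

Lemma basic_inv U (f : sect U) : exists t, res (basic_sub (f := f)) f * t = 1.
Proof. by apply: unit_glue => x fx; apply/unit_at_res. Qed.

Lemma invX (A : comPzRingType) (a b : A) n : a * b = 1 -> a ^+ n * b ^+ n = 1.
Proof. by move=> ab; rewrite -exprMn ab expr1n. Qed.

End RingedSpaces.

Arguments omeetl {X} U V _ _.
Arguments omeetr {X} U V _ _.

Section Affine.
Variable X : ringedSpace.
Variable U : opens X.
Hypothesis affU : affine U.

Lemma aff_basis V x : oset U x -> oset V x ->
  exists f : sect U, unit_at f x /\ basic f <=o V.
Proof.
move=> Ux Vx; have [_ + _ _] := affU.
move/(_ (omeet U V) (omeetl U V) x (conj Ux Vx)) => [f [fx fV]].
by exists f; split=> // y /fV [].
Qed.

(** Quasi-compactness of D(f) in terms of ideals, with no finite subcovering to extract: a prime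
    containing [I] but not [f] would be the vanishing ideal of a point at which [f] is invertible
    and no element of [I] is. *)
Lemma aff_qc (I : set (sect U)) (f : sect U) : is_ideal I ->
  (forall x, unit_at f x -> exists e, I e /\ unit_at e x) -> exists n, I (f ^+ n).
Proof.
move=> idI cov; apply/not_existsP => If.
have [P [primeP IP Pf]] := prime_avoiding_powers idI If.
have [+ _ _ _] := affU; move/(_ P primeP) => [x [[Ux xP] _]].
have [e [/IP/xP]] := cov x (contrapT (fun nf => Pf (iffRL (xP f) nf))).
by [].
Qed.

Lemma aff_qc1 (I : set (sect U)) : is_ideal I ->
  (forall x, oset U x -> exists e, I e /\ unit_at e x) -> I 1.
Proof.
move=> idI cov; have [|n] := aff_qc (f := 1) idI.
  by move=> x /unit_at_mem; exact: cov.
by rewrite expr1n.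
Qed.

Lemma aff_zero V (h : V <=o U) (f s : sect U) : basic f <=o V -> res h s = 0 ->
  exists n, f ^+ n * s = 0.
Proof.
move=> fV e; have [_ _ _] := affU; apply.
by rewrite (res_irr _ (subset_trans fV h)) -resE e rmorph0.
Qed.

(** [V] is any open set with the same points as [basic f]: equal open sets are not convertible, and
    the inclusions spare a transport. *)
Lemma aff_frac V (h : V <=o U) (f : sect U) (t : sect V) :
  basic f <=o V -> V <=o basic f ->
  exists n s, res h f ^+ n * t = res h s.
Proof.
move=> fV Vf; have [_ _ + _] := affU; move/(_ f (res fV t)) => [n [s e]].
exists n, s; apply: (res_inj (h := fV)) => //.
by rewrite rmorphM rmorphXn !resE !(res_irr _ (basic_sub (f := f))).
Qed.

(** D(s) is empty, so 1 vanishes on it and is therefore killed by a power of [s]. *)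
Lemma aff_nilp (s : sect U) : (forall x, ~ unit_at s x) -> nilpotent s.
Proof.
move=> s0; have [n] := aff_zero (f := s) (s := 1) (h := basic_sub (f := s))
  (@subset_refl _ _) (sect_empty (U := basic s) _ _ s0).
by rewrite mulr1 => e; exists n.
Qed.

Lemma aff_local_frac V (h : V <=o U) (s : sect V) x : oset V x ->
  exists (f : sect U) (hf : basic f <=o V) (n : nat) (s' : sect U),
    unit_at f x /\ res (basic_sub (f := f)) f ^+ n * res hf s = res (basic_sub (f := f)) s'.
Proof.
move=> Vx; have [f [fx fV]] := aff_basis (h _ Vx) Vx.
have [n [s' e]] := aff_frac (basic_sub (f := f)) (res fV s) (@subset_refl _ _)
  (@subset_refl _ _).
by exists f, fV, n, s'.
Qed.

End Affine.

Lemma unit_at_sum (X : scheme) (U : opens X) n (s : 'I_n -> sect U) x :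
  unit_at (\sum_(i < n) s i) x -> exists i, unit_at (s i) x.
Proof.
elim: n s => [|n IH] s; first by rewrite big_ord0 => /(sch_local X).1.
rewrite big_ord_recr /= => /(sch_local X).2 [/IH [i]|sx]; last by exists ord_max.
by exists (widen_ord (leqnSn n) i).
Qed.

Lemma vanishing_prime (X : scheme) (U : opens X) x : oset U x ->
  prime_ideal [set f : sect U | ~ unit_at f x].
Proof.
move=> Ux; split=> /=.
- exact: (sch_local X).1.
- by move=> a b na nb /(sch_local X).2 [].
- by move=> a b nb /unit_atM [].
- by move=> n1; apply: n1; exact: unit_at1.
- by move=> a b nab; apply/not_andP => ab; apply: nab; apply/unit_atM.
Qed.

Lemma aff_inj (X : scheme) (U : opens X) (affU : affine U) x y : oset U x -> oset U y ->
  (forall f : sect U, unit_at f x <-> unit_at f y) -> x = y.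
Proof.
move=> Ux Uy xy; have [+ _ _ _] := affU.
move/(_ _ (vanishing_prime Ux)) => [z [_ zP]].
by rewrite -(zP x) ?(zP y) //; split=> // f; split=> /= nf; move=> /xy.
Qed.

(** A section [g] over D(f) is a fraction with numerator [g'] over [U] and denominator a power of
    [f], and the locus of [g] is D(f g') in [U]. Each clause for D(f) then reduces to the same
    clause for [U]. *)
Lemma affine_basic (X : scheme) (U : opens X) (f : sect U) : affine U -> affine (basic f).
Proof.
move=> affU; set V := basic f; have hV : V <=o U by exact: basic_sub.
have [v fv] : exists v, res hV f * v = 1.
  by have [v e] := basic_inv f; exists v; rewrite -e (res_irr hV (basic_sub (f := f))).
have frac (g : sect V) : exists n g', res hV f ^+ n * g = res hV g' by exact: aff_frac.
have [aff1 _ _ aff4] := affU.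
have cancel (g : sect V) n : res hV f ^+ n * g = 0 -> g = 0.
  by move=> e; apply: (mulr_can (invX n fv)); rewrite e mulr0.
have basicE (g : sect V) n g' : res hV f ^+ n * g = res hV g' ->
    basic (f * g') <=o basic g /\ basic g <=o basic (f * g').
  move=> e; split=> x.
    move=> /unit_atM [fx gx]; have Vx : oset V x by [].
    by move: gx => /(unit_at_res hV _ Vx); rewrite -e => /unit_atM [].
  move=> gx; have Vx : oset V x := unit_at_mem gx.
  apply/unit_atM; split=> //; apply/(unit_at_res hV _ Vx); rewrite -e.
  by apply/unit_atM; split=> //; apply: unit_atX; apply/unit_at_res.
split.
- move=> P primeP; have [P0 PD PM P1 PP] := primeP.
  have fP n g : P (res hV f ^+ n * g) <-> P g.
    split; last exact: PM.
    by move=> /(PM (v ^+ n)); rewrite mulrA [v ^+ n * _]mulrC (invX n fv) mul1r.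
  have [|x [[Ux xP] xu]] := aff1 [set s | P (res hV s)].
    split=> /=; first by rewrite rmorph0.
    + by move=> a b; rewrite rmorphD; exact: PD.
    + by move=> a b; rewrite rmorphM; exact: PM.
    + by rewrite rmorph1.
    + by move=> a b; rewrite rmorphM; exact: PP.
  have Vx : oset V x.
    apply: contrapT => /xP /= /(PM v); rewrite mulrC fv; exact: P1.
  exists x; split.
    split=> // g; have [n [g' e]] := frac g.
    rewrite -(fP n) e; have /= -> := xP g'.
    rewrite -(unit_at_res hV _ Vx) -e unit_atM.
    split; first by move=> nu ux; apply: nu; split=> //; apply: unit_atX; apply/unit_at_res.
    by move=> nu [].
  move=> y [Vy yP]; apply: xu; split; first exact: (hV _ Vy).
  by move=> g /=; rewrite yP (unit_at_res hV _ Vy).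
- move=> V' h x V'x; have [f' [f'x f'V]] := aff_basis affU (hV _ (h _ V'x)) V'x.
  exists (res hV f'); split; first by apply/unit_at_res => //; exact: h.
  by move=> y fy; apply: f'V; move: (fy) => /unit_at_res; apply; exact: unit_at_mem fy.
- move=> g t; have [n [g' e]] := frac g; have [h1 h2] := basicE g n g' e.
  have h3 : basic g <=o V by exact: basic_sub.
  have [m [s e2]] := aff_frac affU (subset_trans h3 hV) t h1 h2.
  (* Over [U] the m-th power of [f * g'] clears the denominator of [t]. Since [g'] is [f ^+ n * g]
     on D(f), that power is [f ^+ (m + n * m) * g ^+ m], and [v] inverts [f]. *)
  exists m, (v ^+ (m + n * m)%N * res hV s).
  rewrite (rmorphM _ (v ^+ _)) resE (res_irr _ (subset_trans h3 hV)) -e2 mulrA; congr (_ * _).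
  rewrite rmorphM -[res (subset_trans h3 hV) g']resE -e -resE !(res_irr _ h3).
  rewrite -rmorphM -!rmorphXn -rmorphM; congr (res h3 _).
  rewrite [res hV (f ^+ n)]rmorphXn /= !exprMn -exprM.
  transitivity (res hV f ^+ (m + n * m) * v ^+ (m + n * m) * g ^+ m).
    by rewrite invX // mul1r.
  rewrite [res hV f ^+ _]exprD; ring.
- move=> g s e; have [n [g' e1]] := frac g; have [h1 h2] := basicE g n g' e1.
  have [n2 [s' e2]] := frac s.
  have [|m e3] := aff_zero affU (h := subset_trans (basic_sub (f := g)) hV) (s := s') h1.
    by rewrite -resE -e2 rmorphM e mulr0.
  exists m; have := congr1 (res hV) e3.
  rewrite rmorph0 rmorphM -e2 rmorphXn rmorphM -e1 => e4.
  apply: (cancel _ (m + n * m + n2)%N); rewrite -{}e4 !exprMn -exprM !exprD; ring.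
Qed.

Lemma affine_nbhd (X : scheme) (V : opens X) x : oset V x ->
  exists W, [/\ oset W x, affine W & W <=o V].
Proof.
move=> Vx; have [U [Ux affU]] := sch_affine x.
have [f [fx fV]] := aff_basis affU Ux Vx.
by exists (basic f); split=> //; exact: affine_basic.
Qed.

(** * The spectrum of a ring *)

Section Spectrum.
Variable R : comPzRingType.

Definition spec := {P : set R | prime_ideal P}.
HB.instance Definition _ := gen_eqMixin spec.
HB.instance Definition _ := gen_choiceMixin spec.

Lemma spec_eq (p q : spec) : sval p = sval q -> p = q.
Proof.
by case: p q => [P hP] [Q hQ] /= e; subst Q; congr exist; exact: Prop_irrelevance.
Qed.

Definition avoids (p : spec) (f : R) := ~ sval p f.

Lemma avoidsM p a b : avoids p (a * b) <-> avoids p a /\ avoids p b.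
Proof.
rewrite /avoids; case: p => P /= [_ _ PM _ PP]; split.
  by move=> nab; split=> ?; apply: nab; [rewrite mulrC|]; exact: PM.
by move=> [na nb] /PP [].
Qed.

Lemma avoids1 p : avoids p 1.
Proof. by case: p => P []. Qed.
Arguments avoids1 p _ : clear implicits.

Lemma avoidsX p a n : avoids p a -> avoids p (a ^+ n).
Proof.
by move=> pa; elim: n => [|n IH]; [rewrite expr0; exact: avoids1 | rewrite exprS avoidsM].
Qed.

Lemma avoidsD p a b : avoids p (a + b) -> avoids p a \/ avoids p b.
Proof.
rewrite /avoids; case: p => P /= [_ PD _ _ _] nab.
by apply/not_andP => -[Pa Pb]; apply: nab; exact: PD.
Qed.

Lemma avoids0 p : ~ avoids p 0.
Proof. by rewrite /avoids; case: p => P [P0] /= *; apply. Qed.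

Definition spec_open (A : set spec) :=
  forall p, A p -> exists f, avoids p f /\ forall q, avoids q f -> A q.

Lemma spec_openT : spec_open setT.
Proof. by move=> p _; exists 1; split=> //; exact: avoids1. Qed.

Lemma spec_openI : setI_closed spec_open.
Proof.
move=> A B oA oB p [/oA [f [pf fA]] /oB [g [pg gB]]]; exists (f * g).
by split=> [|q]; rewrite avoidsM // => -[/fA Aq /gB Bq].
Qed.

Lemma spec_open_bigU (I : Type) (f : I -> set spec) :
  (forall i, spec_open (f i)) -> spec_open (\bigcup_i f i).
Proof.
by move=> of_ p [i _ /of_ [g [pg gi]]]; exists g; split=> // q /gi fq; exists i.
Qed.

HB.instance Definition _ := isOpenTopological.Build spec spec_openT spec_openI spec_open_bigU.

Lemma spec_openE (A : set spec) : open A = spec_open A.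
Proof. by []. Qed.

Lemma spec_basic_open (f : R) : open [set p : spec | avoids p f].
Proof. by rewrite spec_openE => p pf; exists f. Qed.

Definition spec_basic (f : R) : opens spec := Opens (@spec_basic_open f).

(** A fraction is a pair (numerator, denominator); [frac_eq p] is equality in the
    localisation at [p]. *)
Definition frac_eq (p : spec) (x y : R * R) :=
  exists u, avoids p u /\ u * (x.1 * y.2) = u * (y.1 * x.2).
Definition frac_add (x y : R * R) := (x.1 * y.2 + y.1 * x.2, x.2 * y.2).
Definition frac_mul (x y : R * R) := (x.1 * y.1, x.2 * y.2).

Lemma frac_eq_of p x y : x.1 * y.2 = y.1 * x.2 -> frac_eq p x y.
Proof. by move=> e; exists 1; split; [exact: avoids1 | rewrite e]. Qed.

Lemma frac_eq_refl p x : frac_eq p x x.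
Proof. exact: frac_eq_of. Qed.

Lemma frac_eq_sym p x y : frac_eq p x y -> frac_eq p y x.
Proof. by move=> [u [pu e]]; exists u. Qed.

Lemma frac_eq_trans p x y z : avoids p y.2 ->
  frac_eq p x y -> frac_eq p y z -> frac_eq p x z.
Proof.
move=> py [u [pu e]] [v [pv e']]; exists (u * v * y.2); split; first by rewrite !avoidsM.
have -> : u * v * y.2 * (x.1 * z.2) = v * z.2 * (u * (x.1 * y.2)) by ring.
have -> : u * v * y.2 * (z.1 * x.2) = u * x.2 * (v * (z.1 * y.2)) by ring.
by rewrite e -e'; ring.
Qed.

Lemma frac_eq_add p x y x' y' :
  frac_eq p x x' -> frac_eq p y y' -> frac_eq p (frac_add x y) (frac_add x' y').
Proof.
move=> [u [pu e]] [v [pv e']]; exists (u * v); split; first by rewrite avoidsM.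
rewrite /frac_add /=.
have -> : u * v * ((x.1 * y.2 + y.1 * x.2) * (x'.2 * y'.2)) =
  v * (y.2 * y'.2) * (u * (x.1 * x'.2)) + u * (x.2 * x'.2) * (v * (y.1 * y'.2)) by ring.
by rewrite e e'; ring.
Qed.

Lemma frac_eq_mul p x y x' y' :
  frac_eq p x x' -> frac_eq p y y' -> frac_eq p (frac_mul x y) (frac_mul x' y').
Proof.
move=> [u [pu e]] [v [pv e']]; exists (u * v); split; first by rewrite avoidsM.
rewrite /frac_mul /= mulrACA [RHS](_ : _ = (u * (x'.1 * x.2)) * (v * (y'.1 * y.2))); last by ring.
by rewrite -e -e'; ring.
Qed.

(** A section over [U] is represented by a total function on the spectrum, with admissible
    denominators even outside [U]. This avoids types depending on the points of [U]; the values
    outside [U] are forgotten by [ff_eq]. *)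
Record fraction_family (U : opens spec) := FractionFamily {
  ff_val :> spec -> R * R;
  ff_den : forall p, avoids p (ff_val p).2;
  ff_loc : forall p, oset U p -> exists x : R * R, avoids p x.2 /\
    forall q, oset U q -> avoids q x.2 -> frac_eq q (ff_val q) x }.

Arguments ff_den {U} f p _.

HB.instance Definition _ U := gen_eqMixin (fraction_family U).
HB.instance Definition _ U := gen_choiceMixin (fraction_family U).

Section StructureSheaf.
Variable U : opens spec.
Implicit Types x y z : fraction_family U.

Definition ff_eq x y : bool := `[< forall p, oset U p -> frac_eq p (x p) (y p) >].

Lemma ff_eq_refl : reflexive ff_eq.
Proof. by move=> x; apply/asboolP => p _; exact: frac_eq_refl. Qed.

Lemma ff_eq_sym : symmetric ff_eq.
Proof. by move=> x y; apply/asboolP/asboolP => e p /e; exact: frac_eq_sym. Qed.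

Lemma ff_eq_trans : transitive ff_eq.
Proof.
move=> y x z /asboolP e /asboolP e'; apply/asboolP => p Up.
exact: (frac_eq_trans (ff_den y p) (e p Up) (e' p Up)).
Qed.

Canonical ff_equiv := EquivRel ff_eq ff_eq_refl ff_eq_sym ff_eq_trans.

Definition spec_sect := {eq_quot ff_equiv}%qT.

HB.instance Definition _ := Choice.on spec_sect.

(** A relation, so that any fraction may stand for the germ and not only the chosen representative.
    It does not by itself require the denominator of [v] to avoid [p], which explains the side
    conditions below. *)
Definition val_at (s : spec_sect) p v := frac_eq p (repr s p) v.

Lemma val_at_pi x p : oset U p -> val_at (\pi_spec_sect x)%qT p (x p).
Proof.
move=> Up; rewrite /val_at; have /eqmodP/asboolP := reprK (\pi_spec_sect x)%qT.
exact.
Qed.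

Lemma val_at_repr (s : spec_sect) p : val_at s p (repr s p).
Proof. exact: frac_eq_refl. Qed.

Lemma val_at_eq (s : spec_sect) p v w : avoids p v.2 ->
  val_at s p v -> frac_eq p v w -> val_at s p w.
Proof. by move=> pv; exact: frac_eq_trans. Qed.

Lemma val_at_fun (s : spec_sect) p v w : val_at s p v -> val_at s p w -> frac_eq p v w.
Proof. by move=> /frac_eq_sym; apply: frac_eq_trans; exact: ff_den. Qed.

Lemma spec_sect_ext (s t : spec_sect) :
  (forall p, oset U p -> exists v, [/\ avoids p v.2, val_at s p v & val_at t p v]) -> s = t.
Proof.
move=> st; rewrite -[s]reprK -[t]reprK; apply/eqmodP/asboolP => p /st [v [pv sv tv]].
exact: (frac_eq_trans pv sv (frac_eq_sym tv)).
Qed.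

Lemma val_at_loc (s : spec_sect) p : oset U p -> exists v, avoids p v.2 /\
  forall q, oset U q -> avoids q v.2 -> val_at s q v.
Proof. exact: ff_loc. Qed.

(** Sums and products are built at once; the two hypotheses are what makes an operation on fractions
    act on locally constant families of them. *)
Lemma ff_op2 (op : R * R -> R * R -> R * R) (x y : fraction_family U) :
  (forall p a b, avoids p (op a b).2 <-> avoids p a.2 /\ avoids p b.2) ->
  (forall p a b a' b', frac_eq p a a' -> frac_eq p b b' -> frac_eq p (op a b) (op a' b')) ->
  {z : fraction_family U | forall p, z p = op (x p) (y p)}.
Proof.
move=> opn ope.
have den p : avoids p (op (x p) (y p)).2 by apply/opn; split; exact: ff_den.
have loc p : oset U p -> exists v : R * R, avoids p v.2 /\
    forall q, oset U q -> avoids q v.2 -> frac_eq q (op (x q) (y q)) v.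
  move=> Up; have [v [pv xv]] := ff_loc x Up; have [w [pw yw]] := ff_loc y Up.
  exists (op v w); split; first exact/opn.
  by move=> q Uq /opn [qv qw]; apply: ope; [exact: xv | exact: yw].
by exists (FractionFamily den loc).
Qed.

Lemma ff_constP (v : R * R) : (forall p, oset U p -> avoids p v.2) ->
  {z : fraction_family U | forall p, oset U p -> z p = v}.
Proof.
(* Outside [U] the denominator of [v] may lie in the prime; 0/1 is an admissible value
   everywhere. *)
move=> Uv; pose f p := if `[< avoids p v.2 >] then v else (0, 1).
have fE p : oset U p -> f p = v by move=> /Uv /asboolP e; rewrite /f e.
have den p : avoids p (f p).2.
  by rewrite /f; case: ifP => [/asboolP //|_]; exact: avoids1.
have loc p : oset U p -> exists v : R * R, avoids p v.2 /\
    forall q, oset U q -> avoids q v.2 -> frac_eq q (f q) v.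
  move=> Up; exists v; split; first exact: Uv.
  by move=> q Uq _; rewrite fE //; exact: frac_eq_refl.
by exists (FractionFamily den loc).
Qed.

Definition const_sect v (h : forall p, oset U p -> avoids p v.2) : spec_sect :=
  (\pi_spec_sect (sval (ff_constP h)))%qT.

Lemma val_at_const v (h : forall p, oset U p -> avoids p v.2) p : oset U p ->
  val_at (const_sect h) p v.
Proof.
by move=> Up; rewrite -[v in val_at _ _ v](svalP (ff_constP h) p Up); exact: val_at_pi.
Qed.

Lemma frac_add_den p a b : avoids p (frac_add a b).2 <-> avoids p a.2 /\ avoids p b.2.
Proof. exact: avoidsM. Qed.

Lemma frac_mul_den p a b : avoids p (frac_mul a b).2 <-> avoids p a.2 /\ avoids p b.2.
Proof. exact: avoidsM. Qed.

Definition sadd (s t : spec_sect) : spec_sect :=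
  (\pi_spec_sect (sval (ff_op2 (repr s) (repr t) frac_add_den frac_eq_add)))%qT.
Definition smul (s t : spec_sect) : spec_sect :=
  (\pi_spec_sect (sval (ff_op2 (repr s) (repr t) frac_mul_den frac_eq_mul)))%qT.
Definition sconst (a : R) : spec_sect := const_sect (v := (a, 1)) (fun p _ => avoids1 p).
Definition sopp (s : spec_sect) := smul (sconst (- 1)) s.

Lemma val_at_add s t p v w : oset U p -> val_at s p v -> val_at t p w ->
  val_at (sadd s t) p (frac_add v w).
Proof.
move=> Up sv tw; apply: val_at_eq (val_at_pi _ Up) _; first exact: ff_den.
by rewrite (svalP (ff_op2 _ _ _ _)); exact: frac_eq_add.
Qed.

Lemma val_at_mul s t p v w : oset U p -> val_at s p v -> val_at t p w ->
  val_at (smul s t) p (frac_mul v w).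
Proof.
move=> Up sv tw; apply: val_at_eq (val_at_pi _ Up) _; first exact: ff_den.
by rewrite (svalP (ff_op2 _ _ _ _)); exact: frac_eq_mul.
Qed.

Lemma val_at_sconst a p : oset U p -> val_at (sconst a) p (a, 1).
Proof. exact: val_at_const. Qed.

(** Reduces the ring axioms for sections to polynomial identities between numerators and
    denominators in [R]. *)
Lemma spec_sect_eqv (s t : spec_sect) :
  (forall p, oset U p -> exists v w,
     [/\ avoids p v.2, val_at s p v, val_at t p w, avoids p w.2 & v.1 * w.2 = w.1 * v.2]) ->
  s = t.
Proof.
move=> st; apply: spec_sect_ext => p /st [v [w [pv sv tw pw e]]]; exists v; split=> //.
by apply: (val_at_eq pw tw); exact: frac_eq_of.
Qed.

Lemma val_at_ex (s : spec_sect) p : exists v, avoids p v.2 /\ val_at s p v.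
Proof. by exists (repr s p); split; [exact: ff_den | exact: val_at_repr]. Qed.

Lemma saddA : associative sadd.
Proof.
move=> s t u; apply: spec_sect_eqv => p Up.
have [a [pa sa]] := val_at_ex s p; have [b [pb tb]] := val_at_ex t p.
have [c [pc uc]] := val_at_ex u p.
exists (frac_add a (frac_add b c)), (frac_add (frac_add a b) c); split; rewrite /= ?avoidsM //.
- by do 2?apply: val_at_add.
- by do 2?apply: val_at_add.
- by rewrite /=; ring.
Qed.

Lemma saddC : commutative sadd.
Proof.
move=> s t; apply: spec_sect_eqv => p Up.
have [a [pa sa]] := val_at_ex s p; have [b [pb tb]] := val_at_ex t p.
exists (frac_add a b), (frac_add b a); split; rewrite /= ?avoidsM //.
- exact: val_at_add.
- exact: val_at_add.
- by rewrite /=; ring.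
Qed.

Lemma sadd0 : left_id (sconst 0) sadd.
Proof.
move=> s; apply: spec_sect_eqv => p Up; have [a [pa sa]] := val_at_ex s p.
exists (frac_add (0, 1) a), a; split; rewrite /= ?mul1r //.
- by apply: val_at_add => //; exact: val_at_sconst.
- by rewrite /=; ring.
Qed.

Lemma saddN : left_inverse (sconst 0) sopp sadd.
Proof.
move=> s; apply: spec_sect_eqv => p Up; have [a [pa sa]] := val_at_ex s p.
exists (frac_add (frac_mul (- 1, 1) a) a), (0, 1); split; rewrite /= ?mul1r ?avoidsM //.
- by apply: val_at_add => //; apply: val_at_mul => //; exact: val_at_sconst.
- exact: val_at_sconst.
- exact: avoids1.
- by rewrite /=; ring.
Qed.

HB.instance Definition _ := GRing.isZmodule.Build spec_sect saddA saddC sadd0 saddN.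

Lemma smulA : associative smul.
Proof.
move=> s t u; apply: spec_sect_eqv => p Up.
have [a [pa sa]] := val_at_ex s p; have [b [pb tb]] := val_at_ex t p.
have [c [pc uc]] := val_at_ex u p.
exists (frac_mul a (frac_mul b c)), (frac_mul (frac_mul a b) c); split; rewrite /= ?avoidsM //.
- by do 2?apply: val_at_mul.
- by do 2?apply: val_at_mul.
- by rewrite /=; ring.
Qed.

Lemma smulC : commutative smul.
Proof.
move=> s t; apply: spec_sect_eqv => p Up.
have [a [pa sa]] := val_at_ex s p; have [b [pb tb]] := val_at_ex t p.
exists (frac_mul a b), (frac_mul b a); split; rewrite /= ?avoidsM //.
- exact: val_at_mul.
- exact: val_at_mul.
- by rewrite /=; ring.
Qed.

Lemma smul1 : left_id (sconst 1) smul.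
Proof.
move=> s; apply: spec_sect_eqv => p Up; have [a [pa sa]] := val_at_ex s p.
exists (frac_mul (1, 1) a), a; split; rewrite /= ?mul1r //.
by apply: val_at_mul => //; exact: val_at_sconst.
Qed.

Lemma smulDl : left_distributive smul sadd.
Proof.
move=> s t u; apply: spec_sect_eqv => p Up.
have [a [pa sa]] := val_at_ex s p; have [b [pb tb]] := val_at_ex t p.
have [c [pc uc]] := val_at_ex u p.
exists (frac_mul (frac_add a b) c), (frac_add (frac_mul a c) (frac_mul b c)).
split; rewrite /= ?avoidsM //.
- by apply: val_at_mul => //; exact: val_at_add.
- by apply: val_at_add => //; exact: val_at_mul.
- by rewrite /=; ring.
Qed.

HB.instance Definition _ :=
  GRing.Zmodule_isComPzRing.Build spec_sect smulA smulC smul1 smulDl.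

End StructureSheaf.

End Spectrum.

Arguments ff_den {R U} f p _.
Arguments avoids1 {R} p _.

Section SpecSheaf.
Variable R : comPzRingType.
Local Notation X := (spec R).
Implicit Types U V W : opens X.

Lemma ff_res U V (h : V <=o U) (x : fraction_family U) :
  {z : fraction_family V | forall p, z p = x p}.
Proof.
have loc p : oset V p -> exists v : R * R, avoids p v.2 /\
    forall q, oset V q -> avoids q v.2 -> frac_eq q (x q) v.
  move=> /h /(ff_loc x) [v [pv xv]]; exists v; split=> // q /h; exact: xv.
by exists (FractionFamily (ff_den x) loc).
Qed.

Definition sres U V (h : V <=o U) (s : spec_sect U) : spec_sect V :=
  (\pi_(spec_sect V) (sval (ff_res h (repr s))))%qT.

Lemma val_at_res U V (h : V <=o U) (s : spec_sect U) p v : oset V p ->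
  val_at s p v -> val_at (sres h s) p v.
Proof.
move=> Vp sv; apply: val_at_eq (val_at_pi _ Vp) _; first exact: ff_den.
by rewrite (svalP (ff_res _ _)).
Qed.

Section ResMorphism.
Variables (U V : opens X) (h : V <=o U).

Lemma sresD : {morph sres h : s t / s + t}.
Proof.
move=> s t; apply: spec_sect_ext => p Vp; have Up := @h p Vp.
have [a [pa sa]] := val_at_ex s p; have [b [pb tb]] := val_at_ex t p.
exists (frac_add a b); split; first by rewrite frac_add_den.
  by apply: val_at_res => //; exact: val_at_add.
by apply: val_at_add => //; exact: val_at_res.
Qed.

Lemma sresM : monoid_morphism (sres h).
Proof.
split.
  apply: spec_sect_ext => p Vp; exists (1, 1); split; first exact: avoids1.
    by apply: val_at_res => //; apply: val_at_sconst; exact: h.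
  exact: val_at_sconst.
move=> s t; apply: spec_sect_ext => p Vp; have Up := @h p Vp.
have [a [pa sa]] := val_at_ex s p; have [b [pb tb]] := val_at_ex t p.
exists (frac_mul a b); split; first by rewrite frac_mul_den.
  by apply: val_at_res => //; exact: val_at_mul.
by apply: val_at_mul => //; exact: val_at_res.
Qed.

HB.instance Definition _ := GRing.isZmodMorphism.Build _ _ (sres h) (additive_zmod_morphism sresD).
HB.instance Definition _ := GRing.isMonoidMorphism.Build _ _ (sres h) sresM.

End ResMorphism.

Lemma spec_sheaf : is_sheaf (fun U V h => @sres U V h).
Proof.
split.
  split=> [U h s|U V W h h' h'' s]; apply: spec_sect_ext => p Up;
    have [a [pa sa]] := val_at_ex s p; exists a; split=> //.
  - exact: val_at_res.
  - by do 2?[apply: val_at_res => //]; exact: h'.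
  - exact: val_at_res.
move=> I U V hV cov s compat.
have compatP i j p : oset (V i) p -> oset (V j) p ->
    frac_eq p (repr (s i) p) (repr (s j) p).
  move=> ip jp; have := compat i j (omeet (V i) (V j)) (@subIsetl _ _ _) (@subIsetr _ _ _).
  have pm : oset (omeet (V i) (V j)) p by split.
  move=> e; have := val_at_res (@subIsetl _ _ _ : omeet (V i) (V j) <=o V i) pm
    (val_at_repr (s i) p).
  rewrite e => /val_at_fun; apply; exact: (val_at_res _ pm (val_at_repr _ _)).
(* The glued section takes at [p] the value of any of the given sections defined there, and 0/1
   where there is none. *)
have /choice [f fP] p : exists v, avoids p v.2 /\
    forall i, oset (V i) p -> frac_eq p v (repr (s i) p).
  have [[i Vp]|none] := pselect (exists i, oset (V i) p).
    exists (repr (s i) p); split; first exact: ff_den.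
    by move=> j; exact: compatP.
  by exists (0, 1); split; [exact: avoids1 | move=> i Vp; case: none; exists i].
have loc p : oset U p -> exists v : R * R, avoids p v.2 /\
    forall q, oset U q -> avoids q v.2 -> frac_eq q (f q) v.
  move=> Up; have [i _ Vp] := cov p Up; have [v [pv sv]] := val_at_loc (s i) Vp.
  have oVi : spec_open (oset (V i)) by rewrite -spec_openE; exact: open_oset.
  have [g [pg gV]] := oVi p Vp.
  (* The fraction is expanded by [g], so that a prime avoiding the new denominator lies in [V i],
     where the fraction is known to represent the section. *)
  exists (v.1 * g, v.2 * g); split; first exact/avoidsM.
  move=> q Uq /avoidsM [qv qg]; have Vq := gV q qg.
  apply: (@frac_eq_trans _ _ _ v) => //; last by apply: frac_eq_of; rewrite /=; ring.
  apply: (frac_eq_trans (ff_den (repr (s i)) q)); first exact: (fP q).2.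
  exact: sv.
pose t : spec_sect U := (\pi_(spec_sect U) (FractionFamily (fun p => (fP p).1) loc))%qT.
have tP p : oset U p -> val_at t p (f p) by move=> Up; exact: (val_at_pi _ Up).
exists t; split=> [i|t' t'P].
  apply: spec_sect_ext => p Vp; exists (f p); split; first exact: (fP p).1.
    by apply: val_at_res => //; apply: tP; exact: (hV i p Vp).
  exact: frac_eq_sym ((fP p).2 i Vp).
apply: spec_sect_ext => p Up; have [i _ Vp] := cov p Up.
exists (f p); split; [exact: (fP p).1|exact: tP|].
apply: (val_at_eq (ff_den (repr (s i)) p)); last exact: frac_eq_sym ((fP p).2 i Vp).
have := val_at_res (hV i) Vp (val_at_repr t' p); rewrite t'P => /val_at_fun e.
exact: (e _ (val_at_repr _ _)).
Qed.

Definition spec_rs : ringedSpace :=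
  @RingedSpace X (fun U => spec_sect U : comPzRingType)
    (fun U V h => sres h : {rmorphism spec_sect U -> spec_sect V}) spec_sheaf.

Lemma spec_unit_at U (s : @sect spec_rs U) (p : X) v : oset U p -> avoids p v.2 -> val_at s p v ->
  unit_at (X := spec_rs) s p <-> avoids p v.1.
Proof.
move=> Up pv sv; split.
  move=> [V [h [Vp [t st]]]]; have [w [pw tw]] := val_at_ex t p.
  have := val_at_mul Vp (val_at_res h Vp sv) tw.
  have -> : smul (sres h s) t = 1 by exact: st.
  move=> /val_at_fun /(_ (val_at_sconst 1 Vp)) [u [pu /= e]].
  move: e; rewrite mulr1 mul1r => e.
  have : avoids p (u * (v.1 * w.1)) by rewrite e !avoidsM.
  by rewrite !avoidsM => -[_ []].
move=> pv1; have [w [pw sw]] := val_at_loc s Up.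
have pw1 : avoids p w.1.
  have [u [pu e]] := val_at_fun sv (sw p Up pw).
  have : avoids p (u * (v.1 * w.2)) by rewrite !avoidsM.
  by rewrite e !avoidsM => -[_ []].
pose V := omeet U (spec_basic (w.1 * w.2)).
have VP q : oset V q -> [/\ oset U q, avoids q w.1 & avoids q w.2].
  by move=> [Uq] /avoidsM [].
have hV : V <=o U by move=> q /VP [].
have h q : oset V q -> avoids q (w.2, w.1).2 by move=> /VP [].
exists V, hV; split; first by split=> //; exact/avoidsM.
exists (const_sect h); apply: (@spec_sect_eqv _ V) => q Vq.
have [Uq qw1 qw2] := VP q Vq.
exists (frac_mul w (w.2, w.1)), (1, 1); split=> /=.
- exact/avoidsM.
- by apply: val_at_mul => //; [apply: val_at_res => //; exact: sw | exact: val_at_const].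
- exact: val_at_sconst.
- exact: avoids1.
- by ring.
Qed.

Lemma spec_local : locally_ringed spec_rs.
Proof.
split=> [U p u0|U s t p].
  have Up := unit_at_mem u0.
  have /spec_unit_at : val_at (0 : @sect spec_rs U) p (0, 1) by exact: val_at_sconst.
  by move=> /(_ Up (avoids1 p)) [/(_ u0) /= /avoids0].
move=> ust; have Up := unit_at_mem ust.
have [a [pa sa]] := val_at_ex s p; have [b [pb tb]] := val_at_ex t p.
have pab : avoids p (frac_add a b).2 by apply/frac_add_den.
move: ust => /(spec_unit_at Up pab (val_at_add Up sa tb)) /= /avoidsD [] /avoidsM [h _].
  by left; apply/(spec_unit_at Up pa sa).
by right; apply/(spec_unit_at Up pb tb).
Qed.

Lemma sconstD U : {morph @sconst R U : a b / a + b}.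
Proof.
move=> a b; apply: spec_sect_eqv => p Up; exists (a + b, 1), (frac_add (a, 1) (b, 1)).
split=> /=; rewrite ?mulr1; try exact: avoids1; try exact: val_at_sconst; last by [].
by apply: val_at_add => //; exact: val_at_sconst.
Qed.

Lemma sconstM U : monoid_morphism (@sconst R U).
Proof.
split=> // a b; apply: spec_sect_eqv => p Up; exists (a * b, 1), (frac_mul (a, 1) (b, 1)).
split=> /=; rewrite ?mulr1; try exact: avoids1; try exact: val_at_sconst; last by [].
by apply: val_at_mul => //; exact: val_at_sconst.
Qed.

HB.instance Definition _ U :=
  GRing.isZmodMorphism.Build _ _ (@sconst R U) (additive_zmod_morphism (@sconstD U)).
HB.instance Definition _ U := GRing.isMonoidMorphism.Build _ _ (@sconst R U) (@sconstM U).

Definition spec_const U : {rmorphism R -> @sect spec_rs U} := @sconst R U.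

Lemma res_const U V (h : V <=o U) (a : R) :
  res (r := spec_rs) h (spec_const U a) = spec_const V a.
Proof.
apply: (@spec_sect_ext _ V) => p Vp; exists (a, 1); split; first exact: avoids1.
  by apply: val_at_res => //; apply: val_at_sconst; exact: h.
exact: val_at_sconst.
Qed.

Lemma spec_const_unit U a (p : X) : oset U p ->
  unit_at (X := spec_rs) (spec_const U a) p <-> avoids p a.
Proof.
by move=> Up; apply: (spec_unit_at (v := (a, 1))) => //; [exact: avoids1 | exact: val_at_sconst].
Qed.

Lemma spec_prime_qc (I : set R) (f : R) : is_ideal I ->
  (forall p : X, avoids p f -> exists e, I e /\ avoids p e) -> exists n, I (f ^+ n).
Proof.
move=> idI cov; apply/not_existsP => If.
have [P [primeP IP Pf]] := prime_avoiding_powers idI If.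
by have [e [/IP Pe]] := cov (exist _ P primeP) Pf.
Qed.

Lemma annihilator_ideal (A : comPzRingType) (a : A) : is_ideal [set e | e * a = 0].
Proof.
split=> /= [|b c e e'|b c e]; first by rewrite mul0r.
  by rewrite mulrDl e e' addr0.
by rewrite -mulrA e mulr0.
Qed.

Lemma spec_eq_zero (f a : R) : (forall p : X, avoids p f -> exists u, avoids p u /\ u * a = 0) ->
  exists n, f ^+ n * a = 0.
Proof.
move=> loc; have [|n e] := spec_prime_qc (annihilator_ideal a) (f := f); last by exists n.
by move=> p /loc [u [pu e]]; exists u.
Qed.

Lemma spec_zero U (f a : R) : (forall p, avoids p f -> oset U p) ->
  spec_const U a = 0 -> exists n, f ^+ n * a = 0.
Proof.
move=> fU e; apply: spec_eq_zero => p /fU Up.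
have := val_at_sconst a Up; have -> : sconst U a = 0 by exact: e.
move=> /val_at_fun /(_ (val_at_sconst 0 Up)) [u [pu /=]]; rewrite mul0r mulr1 mulr0.
by move=> e'; exists u.
Qed.

Lemma pow_add_ideal (A : comPzRingType) (u v : A) n m :
  exists c c', (u + v) ^+ (n + m) = c * u ^+ n + c' * v ^+ m.
Proof.
elim: n m => [|n IHn] m.
  by exists ((u + v) ^+ m), 0; rewrite mul0r expr0 mulr1 addr0.
elim: m => [|m [d [d' IHm]]].
  by exists 0, ((u + v) ^+ n.+1); rewrite mul0r addn0 expr0 mulr1 add0r.
have [c [c' e]] := IHn m.+1.
exists (c + v * d), (u * c' + d').
rewrite addSn exprS mulrDl {1}e addnS -addSn IHm !exprS; ring.
Qed.

(** The elements [e] such that [t] is one fraction with a power of [f * e] as denominator on all of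
    D(f e) form an ideal. Locally constant fractions show that no prime avoiding [f] contains it, so
    it contains a power of [f]. *)
Lemma spec_frac U (f : R) (t : @sect spec_rs U) : (forall p, oset U p <-> avoids p f) ->
  exists n a, spec_const U f ^+ n * t = spec_const U a.
Proof.
move=> Uf.
pose good e := exists a n, forall p, avoids p (f * e) -> val_at t p (a, (f * e) ^+ n).
have [|p pf|n [a [m am]]] := spec_prime_qc (I := good) (f := f).
- split.
  + by exists 0, 0 => p; rewrite mulr0 => /avoids0.
  + move=> e e' [a [n an]] [a' [n' an']].
    pose x := f * e; pose x' := f * e'.
    (* Both fractions represent [t] on D(x x'), so their cross difference is killed by a power of
       [x * x']. *)
    have [m em] : exists m, (x * x') ^+ m * (a * x' ^+ n' - a' * x ^+ n) = 0.
      apply: spec_eq_zero => p /avoidsM [px px'].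
      have [u [pu e1]] := val_at_fun (an p px) (an' p px').
      by exists u; rewrite mulrBr e1 subrr.
    have e2 : x ^+ m * a * x' ^+ (m + n') = x' ^+ m * a' * x ^+ (m + n).
      apply/eqP; rewrite -subr_eq0 -em [(x * x') ^+ m]exprMn !exprD; apply/eqP; ring.
    (* This plays the role of a partition of unity: the two fractions, expanded to the denominators
       [x ^+ (m + n)] and [x' ^+ (m + n')], are combined with the coefficients [c] and [c']. *)
    have [c [c' e3]] := pow_add_ideal x x' (m + n) (m + n').
    exists (c * (x ^+ m * a) + c' * (x' ^+ m * a')), (m + n + (m + n'))%N => p.
    have -> : f * (e + e') = x + x' by rewrite mulrDr.
    move=> pxx; have Up : oset U p by move: (pxx); rewrite -mulrDr avoidsM -Uf => -[].
    have /avoidsD [px|px'] := pxx.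
      apply: (val_at_eq (v := (a, x ^+ n))); [exact: avoidsX | exact: an |].
      exists (x ^+ m); split; first exact: avoidsX.
      rewrite /= e3.
      transitivity (x ^+ m * a * (c * x ^+ (m + n)) + c' * (x ^+ m * a * x' ^+ (m + n'))).
        by ring.
      by rewrite e2 !exprD; ring.
    apply: (val_at_eq (v := (a', x' ^+ n'))); [exact: avoidsX | exact: an' |].
    exists (x' ^+ m); split; first exact: avoidsX.
    rewrite /= e3.
    transitivity (c * (x' ^+ m * a' * x ^+ (m + n)) + x' ^+ m * a' * (c' * x' ^+ (m + n'))).
      by ring.
    by rewrite -e2 !exprD; ring.
  + move=> c e [a [n an]]; exists (a * c ^+ n), n => p.
    rewrite mulrCA avoidsM => -[pc pfe]; apply: (val_at_eq (v := (a, (f * e) ^+ n))).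
    * exact: avoidsX.
    * exact: an.
    * by apply: frac_eq_of; rewrite /= exprMn; ring.
- have Up : oset U p by apply/Uf.
  have [v [pv tv]] := val_at_loc t Up; exists v.2; split=> //.
  exists (f * v.1), 1%N => q /avoidsM [qf qv].
  apply: (val_at_eq qv); first by apply: tv => //; apply/Uf.
  by apply: frac_eq_of; rewrite /=; ring.
(* The ideal contains [f ^+ n], for which the denominator is the m-th power of [f * f ^+ n]. *)
exists (n.+1 * m)%N, a; apply: (@spec_sect_eqv _ U) => p Up.
have pf : avoids p f by apply/Uf.
exists (frac_mul (f ^+ (n.+1 * m), 1) (a, (f * f ^+ n) ^+ m)), (a, 1).
have pfm : avoids p ((f * f ^+ n) ^+ m) by rewrite -exprS; do 2!apply: avoidsX.
split=> /=.
- by rewrite mul1r.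
- rewrite -rmorphXn; apply: val_at_mul => //; first exact: val_at_sconst.
  by apply: am; rewrite -exprS; exact: avoidsX.
- exact: val_at_sconst.
- exact: avoids1.
- by rewrite mul1r mulr1 -exprS -exprM mulrC.
Qed.

Lemma spec_const_inj : injective (spec_const (otop X)).
Proof.
move=> a b /eqP; rewrite -subr_eq0 -rmorphB => /eqP /(spec_zero (f := 1)) [] // n.
by rewrite expr1n mul1r => /eqP; rewrite subr_eq0 => /eqP.
Qed.

Lemma spec_const_surj (s : @sect spec_rs (otop X)) : exists a, s = spec_const _ a.
Proof.
have [|n [a e]] := spec_frac (f := 1) s.
  by move=> p; split=> // _; exact: avoids1.
by exists a; rewrite -e rmorph1 expr1n mul1r.
Qed.

Lemma spec_affine : affine (X := spec_rs) (otop X).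
Proof.
split.
- move=> P [P0 PD PM P1 PP].
  have primeP : prime_ideal [set a | P (spec_const _ a)].
    split=> /=; rewrite ?rmorph0 ?rmorph1 // => a b; rewrite ?rmorphD ?rmorphM;
      [exact: PD | exact: PM | exact: PP].
  exists (exist _ _ primeP); split.
    split=> // f; have [a ->] := spec_const_surj f; rewrite spec_const_unit //.
    by rewrite /avoids /=; split=> [h h'|/contrapT].
  move=> q [_ qP]; apply: spec_eq; apply/seteqP; split=> a /=.
    by rewrite (qP (spec_const _ a)) spec_const_unit // => /contrapT.
  by move=> qa; apply/qP; rewrite spec_const_unit //; apply.
- move=> V hV p Vp.
  have oV : spec_open (oset V) by rewrite -spec_openE; exact: open_oset.
  have [f [pf fV]] := oV p Vp.
  exists (spec_const _ f); split; first exact/spec_const_unit.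
  by move=> q /spec_const_unit h; apply: fV; exact: h.
- move=> f; have [a ->] := spec_const_surj f => t.
  have [|n [b e]] := spec_frac (f := a) t.
    by move=> p; exact: spec_const_unit.
  by exists n, (spec_const _ b); rewrite !res_const.
- move=> f s; have [a ->] := spec_const_surj f; have [b ->] := spec_const_surj s.
  rewrite res_const => /(spec_zero (f := a)) [].
    by move=> p pa; apply/spec_const_unit.
  by move=> n e; exists n; rewrite -rmorphXn -rmorphM /= e rmorph0.
Qed.

Definition Spec : scheme :=
  Scheme spec_local (fun x => ex_intro _ (otop X) (conj I spec_affine)).

End SpecSheaf.

Lemma spec_res (R : comPzRingType) (U V : opens (Spec R)) (h : V <=o U) (a : R) :
  @res (Spec R) U V h (spec_const U a) = spec_const V a.
Proof. exact: res_const. Qed.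

(** * Morphisms to an affine open set *)

Section SheafExtension.
Variables (X T : ringedSpace) (U : opens X) (W0 : opens T) (p : T -> X).
Variable phi : {rmorphism sect U -> sect W0}.
Hypothesis affU : affine U.
Hypothesis phi_unit : forall (f : sect U) t, oset W0 t -> unit_at f (p t) -> unit_at (phi f) t.

Definition represents (V : opens X) (s : sect V) (f : sect U) n (s' : sect U) :=
  exists hf : basic f <=o V,
    res (basic_sub (f := f)) f ^+ n * res hf s = res (basic_sub (f := f)) s'.

Lemma represents_ex (V : opens X) (hV : V <=o U) (s : sect V) x : oset V x ->
  exists f n s', unit_at f x /\ represents s f n s'.
Proof.
move=> /(aff_local_frac affU hV s) [f [hf [n [s' [fx e]]]]].
by exists f, n, s'; split=> //; exists hf.
Qed.

Lemma represents_ex2 (V : opens X) (hV : V <=o U) (s t : sect V) x : oset V x ->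
  exists f n s' t', [/\ unit_at f x, represents s f n s' & represents t f n t'].
Proof.
move=> /(aff_local_frac affU hV s) [f [hf [n [s' [fx e]]]]].
have [m [t' e']] := aff_frac affU (basic_sub (f := f)) (res hf t) (@subset_refl _ _)
  (@subset_refl _ _).
exists f, (n + m)%N, (f ^+ m * s'), (f ^+ n * t'); split=> //; exists hf.
  by rewrite [RHS]rmorphM -e rmorphXn exprD; ring.
by rewrite [RHS]rmorphM -e' rmorphXn exprD; ring.
Qed.

Lemma represents_compat (V : opens X) (s : sect V) f n a g m b :
  represents s f n a -> represents s g m b ->
  exists N, (f * g) ^+ N * (f ^+ n * b - g ^+ m * a) = 0.
Proof.
move=> [hf e] [hg e'].
have kf : basic (f * g) <=o basic f by move=> x /unit_atM [].
have kg : basic (f * g) <=o basic g by move=> x /unit_atM [].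
apply: (aff_zero affU (V := basic (f * g)) (h := basic_sub (f := f * g))) => //.
have := congr1 (res kf) e; have := congr1 (res kg) e'.
rewrite !rmorphM !rmorphXn /= !resE !(res_irr _ (basic_sub (f := f * g))).
rewrite rmorphB !rmorphM !rmorphXn /= => <- <-.
by rewrite !(res_irr _ (subset_trans kf hf)); ring.
Qed.

(** [t] is the pullback of [s]: wherever [s] is a fraction with numerator [s'] and denominator
    [f ^+ n], [t] is the image fraction. Quantifying over all representations and all smaller open
    sets makes the notion stable under restriction. *)
Definition pulls_to (V : opens X) (s : sect V) (W : opens T) (t : sect W) :=
  forall f n s', represents s f n s' -> forall (W' : opens T) (k : W' <=o W) (k0 : W' <=o W0),
    (forall x, oset W' x -> unit_at (phi f) x) ->
    res k0 (phi f) ^+ n * res k t = res k0 (phi s').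

Lemma phi_inv f (W : opens T) (k : W <=o W0) : (forall x, oset W x -> unit_at (phi f) x) ->
  exists v, res k (phi f) * v = 1.
Proof. by move=> fW; apply: unit_glue => x Wx; apply/unit_at_res => //; exact: fW. Qed.

Lemma phi_can f n (W : opens T) (k : W <=o W0) (a b : sect W) :
  (forall x, oset W x -> unit_at (phi f) x) ->
  res k (phi f) ^+ n * a = res k (phi f) ^+ n * b -> a = b.
Proof. by move=> /(phi_inv k) [v e]; apply: (mulr_can (invX n e)). Qed.

Lemma phi_represents_compat (V : opens X) (s : sect V) f n a g m b (W : opens T) (k : W <=o W0) :
  represents s f n a -> represents s g m b ->
  (forall x, oset W x -> unit_at (phi f) x) -> (forall x, oset W x -> unit_at (phi g) x) ->
  res k (phi f) ^+ n * res k (phi b) = res k (phi g) ^+ m * res k (phi a).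
Proof.
move=> /represents_compat H /H [N eN] fW gW {H}.
have fgW x : oset W x -> unit_at (phi (f * g)) x.
  by move=> Wx; rewrite rmorphM; apply/unit_atM; split; [exact: fW | exact: gW].
have := congr1 (fun u => res k (phi u)) eN.
rewrite !rmorph0 [phi (_ * _)]rmorphM rmorphM [phi (_ ^+ N)]rmorphXn rmorphXn.
rewrite -[in RHS](mulr0 (res k (phi (f * g)) ^+ N)) => /(phi_can fgW) /eqP.
by rewrite !rmorphB subr_eq0 => /eqP; rewrite !rmorphM !rmorphXn.
Qed.

Lemma pulls_to_local (V : opens X) (hV : V <=o U) (W : opens T) (hW : W <=o W0)
    (t t' : sect W) :
  (forall x, oset W x -> oset V (p x)) ->
  (forall x, oset W x -> exists f n, unit_at f (p x) /\
     forall (W' : opens T) (k : W' <=o W) (k0 : W' <=o W0),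
       (forall y, oset W' y -> unit_at (phi f) y) ->
       res k0 (phi f) ^+ n * res k t = res k0 (phi f) ^+ n * res k t') -> t = t'.
Proof.
move=> h loc; apply: sect_sep => x Wx.
have [f [n [fx e]]] := loc x Wx.
have k : omeet W (basic (phi f)) <=o W by exact: subIsetl.
exists _, k; split; first by split=> //; apply: phi_unit => //; exact: hW.
have k0 := subset_trans k hW.
by apply: (phi_can (k := k0)) (e _ k k0 _) => y [].
Qed.

Lemma pulls_to_uniq (V : opens X) (hV : V <=o U) (s : sect V) (W : opens T) (hW : W <=o W0)
    (t t' : sect W) :
  (forall x, oset W x -> oset V (p x)) -> pulls_to s t -> pulls_to s t' -> t = t'.
Proof.
move=> h st st'; apply: (pulls_to_local hV hW h) => x Wx.
have [f [n [s' [fx e]]]] := represents_ex hV s (h x Wx).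
by exists f, n; split=> // W' k k0 fW; rewrite (st _ _ _ e) // (st' _ _ _ e).
Qed.

Lemma pulls_to_ex (V : opens X) (hV : V <=o U) (s : sect V) (W : opens T) (hW : W <=o W0) :
  (forall x, oset W x -> oset V (p x)) -> exists t : sect W, pulls_to s t.
Proof.
move=> h; pose P (W' : opens T) (k : W' <=o W) (t : sect W') := exists f n s',
  [/\ represents s f n s', (forall x, oset W' x -> unit_at (phi f) x) &
      res (subset_trans k hW) (phi f) ^+ n * t = res (subset_trans k hW) (phi s')].
have Pex f n s' (W' : opens T) (k : W' <=o W) : represents s f n s' ->
    (forall x, oset W' x -> unit_at (phi f) x) -> exists t, P W' k t.
  move=> e fW; have [v ve] := phi_inv (subset_trans k hW) fW.
  exists (v ^+ n * res (subset_trans k hW) (phi s')), f, n, s'; split=> //.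
  by rewrite mulrA (invX n ve) mul1r.
have [| |t tP] := sheaf_glue (res_sheaf T) (U := W) (P := P).
- move=> V1 V2 h1 h2 t1 t2 W' k1 k2 [f [n [a [e fV et]]]] [g [m [b [e' gV et']]]].
  have k := subset_trans k1 (subset_trans h1 hW).
  have fW x : oset W' x -> unit_at (phi f) x by move=> W'x; apply: fV; exact: (k1 _ W'x).
  have gW x : oset W' x -> unit_at (phi g) x by move=> W'x; apply: gV; exact: (k2 _ W'x).
  have := congr1 (res k1) et; have := congr1 (res k2) et'.
  rewrite !rmorphM !rmorphXn /= !resE !(res_irr _ k) => E2 E1.
  have := phi_represents_compat k e e' fW gW; rewrite -E1 -E2 => E3.
  apply: (phi_can (k := k) (n := n) fW); apply: (phi_can (k := k) (n := m) gW).
  by rewrite -E3; ring.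
- move=> x Wx; have [f [n [s' [fx e]]]] := represents_ex hV s (h x Wx).
  have k : omeet W (basic (phi f)) <=o W by exact: subIsetl.
  have [|t Pt] := Pex f n s' _ k e; first by move=> y [].
  exists _, k, t; split=> //; split=> //; apply: phi_unit => //; exact: (hW _ Wx).
exists t => f n s' e W' k k0 fW; have [t' Pt'] := Pex f n s' W' k e fW.
rewrite (tP _ _ _ Pt'); have [g [m [b [e' gW et']]]] := Pt'.
have E3 := phi_represents_compat k0 e e' fW gW.
apply: (phi_can (k := k0) (n := m) gW); rewrite -E3 mulrCA; congr (_ * _).
by move: et'; rewrite !(res_irr _ k0).
Qed.

Lemma pulls_to_res (V : opens X) (hV : V <=o U) (s : sect U) (W : opens T) (hW : W <=o W0) :
  pulls_to (res hV s) (res hW (phi s)).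
Proof.
move=> f n s' e W' k k0 fW; rewrite resE (res_irr _ k0).
have e1 : represents s f 0 (1 * s).
  by exists (basic_sub (f := f)); rewrite expr0 !mul1r.
have e2 : represents s f n s'.
  by have [hf e2] := e; exists (basic_sub (f := f)); rewrite -e2 resE !(res_irr _ (basic_sub (f := f))).
by have := phi_represents_compat k0 e1 e2 fW fW; rewrite expr0 !mul1r => <-.
Qed.

(** Sections over open subsets of [U] are local fractions, hence [phi] has at most one extension to
    them, and the local extensions glue. The target is only a ringed space and [p] only a map
    compatible with units: this serves morphisms of schemes and, with a thickening as target,
    derivations. *)
Theorem sheaf_extension :
  exists P : forall V (hV : V <=o U) W (hW : W <=o W0), (forall x, oset W x -> oset V (p x)) ->
      {rmorphism sect V -> sect W},
    [/\ forall V hV W hW h s, pulls_to s (P V hV W hW h s),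
        forall V hV V' hV' W hW W' hW' h h' (k : V' <=o V) (l : W' <=o W) s,
          res l (P V hV W hW h s) = P V' hV' W' hW' h' (res k s) &
        forall V hV W hW h s, P V hV W hW h (res hV s) = res hW (phi s)].
Proof.
have pull_rmorphism V (hV : V <=o U) W (hW : W <=o W0) (h : forall x, oset W x -> oset V (p x)) :
    {g : {rmorphism sect V -> sect W} | forall s, pulls_to s (g s)}.
  apply: cid.
  have [f fP] := choice (fun s => pulls_to_ex hV s hW h).
  have [|||g gf] := @exists_rmorphism _ _ f; last by exists g => s; rewrite gf.
  - move=> s t; apply: (pulls_to_local hV hW h) => x Wx.
    have [a [n [s' [t' [ax es et]]]]] := represents_ex2 hV s t (h x Wx).
    exists a, n; split=> // W' k k0 aW.
    rewrite rmorphD mulrDr (fP s _ _ _ es) // (fP t _ _ _ et) // -!rmorphD.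
    apply: (fP (s + t)) => //; have [hf e] := es; have [hf' e'] := et; exists hf.
    by rewrite !rmorphD mulrDr e (res_irr _ hf') e'.
  - move=> s t; apply: (pulls_to_local hV hW h) => x Wx.
    have [a [n [s' [t' [ax es et]]]]] := represents_ex2 hV s t (h x Wx).
    exists a, (n + n)%N; split=> // W' k k0 aW.
    rewrite rmorphM exprD mulrACA (fP s _ _ _ es) // (fP t _ _ _ et) // -!rmorphM -exprD.
    apply: (fP (s * t)) => //; have [hf e] := es; have [hf' e'] := et; exists hf.
    by rewrite !rmorphM exprD mulrACA e (res_irr _ hf') e'.
  - apply: (pulls_to_uniq (s := 1) hV hW h); first exact: fP.
    by rewrite -(rmorph1 (res hV)) -(rmorph1 (res hW)) -(rmorph1 phi); exact: pulls_to_res.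
exists (fun V hV W hW h => sval (pull_rmorphism V hV W hW h)).
have PP V hV W hW h s : pulls_to s (sval (pull_rmorphism V hV W hW h) s).
  exact: (svalP (pull_rmorphism V hV W hW h)).
split=> // [V hV V' hV' W hW W' hW' h h' k l s|V hV W hW h s].
  apply: (pulls_to_uniq hV' hW' h') (PP _ _ _ _ _ _) => f n s' [hf e] W'' m m0 fW.
  rewrite resE; apply: PP => //; exists (subset_trans hf k).
  by rewrite -e resE.
by apply: (pulls_to_uniq hV hW h) (PP _ _ _ _ _ _) _; exact: pulls_to_res.
Qed.
End SheafExtension.

Section Morphisms.
Variables (T X : scheme).
Implicit Types f g : morphism T X.

Lemma pull_irr f (V : opens X) (W : opens T) (h h' : oset W `<=` f @^-1` oset V) (s : sect V) :
  pull f h s = pull f h' s.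
Proof. by congr (pull f _ s); exact: Prop_irrelevance. Qed.

Lemma unit_at_pull f (V : opens X) (W : opens T) (h : oset W `<=` f @^-1` oset V) (s : sect V) x :
  oset W x -> unit_at (pull f h s) x <-> unit_at s (f x).
Proof.
move=> Wx; split; first exact: pull_local.
move=> [V' [k [V'x [t e]]]].
have hW : omeet W (preim f V') <=o W by exact: subIsetl.
have h' : oset (omeet W (preim f V')) `<=` f @^-1` oset V' by exact: subIsetr.
exists _, hW; split; first by split.
by exists (pull f h' t); rewrite (pull_res h h' k hW) -rmorphM e rmorph1.
Qed.

Lemma pull_resl f (V : opens X) (W W' : opens T) (h : oset W `<=` f @^-1` oset V)
    (k : W' <=o W) (s : sect V) :
  res k (pull f h s) = pull f (subset_trans k h) s.
Proof. by rewrite (pull_res h (subset_trans k h) (@subset_refl _ _) k) res_id. Qed.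

Lemma pull_resr f (V V' : opens X) (W : opens T) (h : oset W `<=` f @^-1` oset V)
    (h' : oset W `<=` f @^-1` oset V') (k : V' <=o V) (s : sect V) :
  pull f h' (res k s) = pull f h s.
Proof. by rewrite -(pull_res h h' k (@subset_refl _ _)) res_id. Qed.

Lemma open_intro (A : set T) : (forall x, A x -> exists W : opens T, oset W x /\ oset W `<=` A) ->
  open A.
Proof.
move=> loc; rewrite openE => x /loc [W [Wx WA]].
by rewrite /interior /= nbhsE; exists (oset W) => //; split=> //; exact: open_oset.
Qed.

(** The image of [t] is the point of [U] given by the prime of those functions whose image under
    [phi] is not invertible at [t]. *)
Lemma mor_to_affine (U : opens X) (phi : {rmorphism sect U -> sect (otop T)}) : affine U ->
  exists (f : morphism T X) (h : oset (otop T) `<=` f @^-1` oset U), forall s, pull f h s = phi s.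
Proof.
move=> affU.
have /choice [p pP] t : exists x, oset U x /\ forall a : sect U, unit_at a x <-> unit_at (phi a) t.
  have [+ _ _ _] := affU => /(_ [set a | ~ unit_at (phi a) t]) [].
    have [P0 PD PM P1 PP] := vanishing_prime (I : oset (otop T) t).
    split=> /=; rewrite ?rmorph0 ?rmorph1 // => a b; rewrite ?rmorphD ?rmorphM;
      [exact: PD | exact: PM | exact: PP].
  move=> x [[Ux xP] _]; exists x; split=> // a.
  by have := xP a; rewrite /= => e; split; apply: contraPP; rewrite e.
have pc : continuous p.
  apply/continuousP => A oA; apply: open_intro => t At.
  have [a [ap aA]] := aff_basis affU (V := Opens oA) (pP t).1 At.
  exists (basic (phi a)); split; first exact/(pP t).2.
  by move=> y /= /(pP y).2 /aA.
have [|P [Prel Pres Pphi]] := @sheaf_extension _ _ U (otop T) p phi affU.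
- by move=> f t _ /(pP t).2.
pose h' (V : opens X) (W : opens T) (h : oset W `<=` p @^-1` oset V) x (Wx : oset W x) :
  oset (omeet V U) (p x) := conj (h x Wx) (pP x).1.
(* [V] need not lie in [U]; since all values of [p] do, it may be replaced by its intersection with
   [U]. *)
pose Q (V : opens X) (W : opens T) (h : oset W `<=` p @^-1` oset V) : {rmorphism sect V -> sect W} :=
  P (omeet V U) (omeetr V U) W (@sub_otop _ W) (h' V W h) \o
  res (omeetl V U).
have Qres (V V' : opens X) (W W' : opens T) (h : oset W `<=` p @^-1` oset V)
    (h1 : oset W' `<=` p @^-1` oset V') (hV : V' <=o V) (hW : W' <=o W) (s : sect V) :
    res hW (Q V W h s) = Q V' W' h1 (res hV s).
  have k : omeet V' U <=o omeet V U by move=> x [/hV].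
  rewrite /Q /= (Pres _ _ (omeet V' U) (omeetr V' U) _ _ _ (@sub_otop _ W') _ (h' V' W' h1) k).
  by congr (P _ _ _ _ _ _); rewrite !resE; exact: res_irr.
(* If the image of a fraction is invertible at [x], so is the image of its numerator, and by the
   choice of [p] the numerator is invertible at [p x]. *)
have Qloc (V : opens X) (W : opens T) (h : oset W `<=` p @^-1` oset V) (s : sect V) x :
    oset W x -> unit_at (Q V W h s) x -> unit_at s (p x).
  move=> Wx; rewrite /Q /=; set s1 := res _ s => u1.
  have VUx : oset (omeet V U) (p x) by split; [exact: (h x Wx) | exact: (pP x).1].
  have [f [n [s' [fx rep]]]] := represents_ex affU (omeetr V U) s1 VUx.
  have k : omeet W (basic (phi f)) <=o W by exact: subIsetl.
  have kx : oset (omeet W (basic (phi f))) x by split=> //; exact/(pP x).2.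
  have := Prel _ (omeetr V U) _ (@sub_otop _ W) (h' V W h) s1 f n s' rep _ k (@sub_otop _ _).
  move=> /(_ (fun y => @proj2 _ _)) e.
  have : unit_at (phi s') x.
    apply/(unit_at_res (@sub_otop _ (omeet W (basic (phi f)))) _ kx); rewrite -e.
    apply/unit_atM; split; last exact/unit_at_res.
    by apply: unit_atX; apply/unit_at_res => //; exact/(pP x).2.
  move=> /(pP x).2; have [hf e'] := rep; have fpx : oset (basic f) (p x) by [].
  move=> /(unit_at_res (basic_sub (f := f)) _ fpx); rewrite -e' => /unit_atM [_].
  by move=> /(unit_at_res hf _ fpx) /unit_at_res; apply.
pose m := Morphism pc Qres Qloc.
exists m, (fun t _ => (pP t).1) => s.
rewrite /m /= /Q /=.
have := Pphi (omeet U U) (omeetr U U) (otop T) (@sub_otop _ _) (h' U (otop T) (fun t _ => (pP t).1)) s.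
by rewrite res_id => <-; congr (P _ _ _ _ _ _); exact: res_irr.
Qed.

Lemma mor_eq_affine (U : opens X) (f g : morphism T X)
    (hf : oset (otop T) `<=` f @^-1` oset U) (hg : oset (otop T) `<=` g @^-1` oset U) :
  affine U -> (forall s, pull f hf s = pull g hg s) -> eq_mor f g.
Proof.
move=> affU fg.
have pE x : f x = g x.
  apply: (aff_inj affU); [exact: (hf x I) | exact: (hg x I) | move=> a].
  by rewrite -(unit_at_pull hf) // -(unit_at_pull hg) // fg.
split=> // V W h1 h2 s; apply: sect_sep => x Wx.
have [a [ax aV]] := aff_basis affU (hf x I) (h1 x Wx).
have [n [s' e]] := aff_frac affU (basic_sub (f := a)) (res aV s) (@subset_refl _ _)
  (@subset_refl _ _).
pose W' := omeet W (preim f (basic a)).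
have k : W' <=o W by exact: subIsetl.
have k1 : oset W' `<=` f @^-1` oset (basic a) by exact: subIsetr.
have k2 : oset W' `<=` g @^-1` oset (basic a) by move=> y /= /k1; rewrite /= pE.
exists W', k; split=> //; rewrite !pull_resl.
have [v av] := basic_inv a.
have fv : pull f k1 (res (basic_sub (f := a)) a) * pull f k1 v = 1 by rewrite -rmorphM av rmorph1.
have UE b : pull f k1 (res (basic_sub (f := a)) b) = pull g k2 (res (basic_sub (f := a)) b).
  rewrite (pull_resr (subset_trans (@sub_otop _ W') hf)) -pull_resl fg pull_resl.
  by rewrite (pull_resr (subset_trans (@sub_otop _ W') hg)).
apply: (mulr_can (invX n fv)).
rewrite -(pull_resr _ k1 aV) -rmorphXn -rmorphM e UE -e rmorphM rmorphXn -UE.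
by rewrite rmorphXn (pull_resr (subset_trans k h2)).
Qed.

Lemma eq_mor_refl f : eq_mor f f.
Proof. by split=> // V W h1 h2 s; exact: pull_irr. Qed.

Lemma eq_mor_sym f g : eq_mor f g -> eq_mor g f.
Proof. by move=> [fg e]; split=> [x|V W h1 h2 s]; [rewrite fg | rewrite (e V W h2 h1)]. Qed.

Lemma eq_mor_trans f g k : eq_mor f g -> eq_mor g k -> eq_mor f k.
Proof.
move=> [fg e] [gk e']; split=> [x|V W h1 h2 s]; first by rewrite fg gk.
have h : oset W `<=` g @^-1` oset V by move=> x /h1; rewrite /= fg.
by rewrite (e _ _ _ h) (e' _ _ _ h2).
Qed.

End Morphisms.

Lemma comp_pullE (T X Y : scheme) (g : morphism X Y) (f : morphism T X) (V : opens Y) (V' : opens X)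
    (W : opens T) (h : oset W `<=` comp_mor g f @^-1` oset V) (hg : oset V' `<=` g @^-1` oset V)
    (hf : oset W `<=` f @^-1` oset V') (s : sect V) :
  pull (comp_mor g f) h s = pull f hf (pull g hg s).
Proof.
rewrite /= /comp_pull /=.
have k : V' <=o preim g V by exact: hg.
rewrite -(pull_resr _ hf k) pull_resl; congr (pull f hf _).
exact: pull_irr.
Qed.

Lemma eq_mor_comp_l (T X Y : scheme) (g g' : morphism X Y) (f : morphism T X) :
  eq_mor g g' -> eq_mor (comp_mor g f) (comp_mor g' f).
Proof.
move=> [gg' e]; split=> [x|V W h1 h2 s]; first by rewrite /= gg'.
have h : oset (preim g V) `<=` g' @^-1` oset V by move=> x; rewrite /= gg'.
rewrite (comp_pullE (V' := preim g V) h2 h h1) (comp_pullE (V' := preim g V) h1 (@preim_sub _ _ _ _) h1).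
by rewrite (e _ _ _ h).
Qed.

Lemma eq_mor_assoc (S T X Y : scheme) (g : morphism X Y) (f : morphism T X) (e : morphism S T) :
  eq_mor (comp_mor g (comp_mor f e)) (comp_mor (comp_mor g f) e).
Proof.
split=> // V W h1 h2 s.
rewrite (comp_pullE (V' := preim g V) h1 (@preim_sub _ _ _ _) h1).
have h3 : oset W `<=` e @^-1` oset (preim f (preim g V)) by exact: h1.
have h4 : oset W `<=` comp_mor f e @^-1` oset (preim g V) by exact: h1.
have h5 : oset (preim f (preim g V)) `<=` comp_mor g f @^-1` oset V by [].
rewrite (comp_pullE h2 h5 h3) (comp_pullE (g := f) (f := e) _ (@preim_sub _ _ _ _) h3).
by rewrite (comp_pullE (V' := preim g V) h5 (@preim_sub _ _ _ _) (@preim_sub _ _ _ _)).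
Qed.

(** * Noetherian rings and the basis theorem *)

Section Noetherian.

(** Generation is recast as minimality among ideals, so that later arguments need not handle linear
    combinations. *)
Lemma noetherian_seq (A : comPzRingType) : noetherian A <->
  forall I : set A, is_ideal I -> exists l : seq A, (forall x, x \in l -> I x) /\
    forall J, is_ideal J -> (forall x, x \in l -> J x) -> I `<=` J.
Proof.
split=> [noeth I [I0 ID IM]|H I I0 ID IM].
  have [n [g [Ig gen]]] := noeth I I0 ID IM.
  exists (codom g); split; first by move=> x /codomP [i ->].
  move=> J [J0 JD JM] Jg a /gen [c ->]; elim/big_ind: _ => // i _.
  by apply: (JM); apply: Jg; exact: codom_f.
have [l [Il gen]] := H I (And3 I0 ID IM).
exists (size l), (fun i => l`_i); split; first by move=> i; apply: Il; exact: mem_nth.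
apply: (gen [set a | exists c : 'I_(size l) -> A, a = \sum_(i < size l) c i * l`_i]).
  split=> /=.
  - by exists (fun=> 0); rewrite big1 // => i _; rewrite mul0r.
  - move=> _ _ [c ->] [c' ->]; exists (fun i => c i + c' i).
    by rewrite -big_split; apply: eq_bigr => i _; rewrite mulrDl.
  - move=> a _ [c ->]; exists (fun i => a * c i).
    by rewrite mulr_sumr; apply: eq_bigr => i _; rewrite mulrA.
move=> x xl; have xi : (index x l < size l)%N by rewrite index_mem.
exists (fun i => (i == Ordinal xi)%:R).
rewrite (bigD1 (Ordinal xi)) //= eqxx mul1r nth_index // big1 ?addr0 // => i /negPf ->.
by rewrite mul0r.
Qed.

Lemma ideal_preimage (A B : comPzRingType) (phi : {rmorphism A -> B}) (J : set B) :
  is_ideal J -> is_ideal [set a | J (phi a)].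
Proof.
move=> [J0 JD JM]; split=> /=; rewrite ?rmorph0 // => a b; rewrite ?rmorphD ?rmorphM;
  [exact: JD | exact: JM].
Qed.

(** Treats localisations and quotients together: up to a unit every element of [B] comes from [A],
    so an ideal of [B] is generated by the image of its preimage. *)
Lemma noetherian_fractions (A B : comPzRingType) (phi : {rmorphism A -> B}) :
  (forall b, exists a v w, v * w = 1 /\ v * b = phi a) -> noetherian A -> noetherian B.
Proof.
move=> frac /noetherian_seq noeth; apply/noetherian_seq => J idJ.
have [l [Jl gen]] := noeth _ (ideal_preimage phi idJ).
exists (map phi l); split; first by move=> _ /mapP [x /Jl Jx ->].
move=> K idK Kl b Jb; have [a [v [w [vw e]]]] := frac b.
have Ka : K (phi a).
  apply: (gen _ (ideal_preimage phi idK)) => [x xl|] /=; first exact/Kl/map_f.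
  by rewrite -e; case: idJ => _ _; apply.
case: idK => _ _ KM; have := KM w _ Ka; rewrite -e mulrA [w * v]mulrC vw mul1r.
by [].
Qed.

Lemma noetherian_stationary (A : comPzRingType) (L : nat -> set A) : noetherian A ->
  (forall n, is_ideal (L n)) -> (forall n, L n `<=` L n.+1) -> exists N, forall n, L n `<=` L N.
Proof.
move=> /noetherian_seq noeth idL Lsub.
have Lmono n m : (n <= m)%N -> L n `<=` L m.
  by move=> /subnK <-; elim: (m - n)%N => // k IH x /IH; exact: Lsub.
have [|l [Ll gen]] := noeth (\bigcup_n L n).
  split=> [|a b [n _ an] [m _ bm]|a b [n _ bn]]; first by exists 0%N => //; case: (idL 0%N).
    exists (maxn n m) => //; case: (idL (maxn n m)) => _ + _; apply.
      exact: (Lmono _ _ (leq_maxl n m)).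
    exact: (Lmono _ _ (leq_maxr n m)).
  by exists n => //; case: (idL n) => _ _; apply.
have [N NP] : exists N, forall x, x \in l -> L N x.
  elim: l Ll {gen} => [|x l IH] Ll; first by exists 0%N.
  have [|N NP] := IH; first by move=> y yl; apply: Ll; rewrite inE yl orbT.
  have [n _ nx] := Ll x (mem_head _ _).
  exists (maxn n N) => y; rewrite inE => /orP [/eqP ->|/NP].
    exact: (Lmono _ _ (leq_maxl n N)).
  exact: (Lmono _ _ (leq_maxr n N)).
by exists N => n x nx; apply: (gen _ (idL N) NP); exists n.
Qed.

Section Adjunction.
Variables (R S : comPzRingType) (phi : {rmorphism R -> S}) (g : S).

(** [low n s] says that [s] is the value at [g] of a polynomial of degree less
    than [n] over [R]. *)
Fixpoint low n s : Prop :=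
  if n is n'.+1 then exists r, low n' (s - phi r * g ^+ n') else s = 0.

Lemma low0 n : low n 0.
Proof. by elim: n => //= n IH; exists 0; rewrite rmorph0 mul0r subr0. Qed.

Lemma lowD n s t : low n s -> low n t -> low n (s + t).
Proof.
elim: n s t => [|n IH] s t /=; first by move=> -> ->; rewrite addr0.
move=> [r rs] [r' rt]; exists (r + r'); rewrite rmorphD.
by have := IH _ _ rs rt; congr low; ring.
Qed.

Lemma lowZ n r s : low n s -> low n (phi r * s).
Proof.
elim: n s => [|n IH] s /=; first by move=> ->; rewrite mulr0.
by move=> [r' rs]; exists (r * r'); have := IH _ rs; rewrite rmorphM; congr low; ring.
Qed.

Lemma lowM n s : low n s -> low n.+1 (g * s).
Proof.
elim: n s => [|n IH] s; first by move=> /= ->; exists 0; rewrite rmorph0; ring.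
by move=> [r /IH rs]; exists r; move: rs; congr (low n.+1 _); rewrite exprS; ring.
Qed.

Lemma lowMX n k s : low n s -> low (k + n) (g ^+ k * s).
Proof.
move=> ns; elim: k => [|k IH]; first by rewrite expr0 mul1r.
by rewrite exprS -mulrA; exact: lowM.
Qed.

Lemma lowS n s : low n s -> low n.+1 s.
Proof. by exists 0; rewrite rmorph0 mul0r subr0. Qed.

Lemma low_leq n m s : (n <= m)%N -> low n s -> low m s.
Proof. by move=> /subnK <- ns; elim: (m - n)%N => // k; exact: lowS. Qed.

Definition adjoined : set S := [set s | exists n, low n s].

Lemma adjoinedD s t : adjoined s -> adjoined t -> adjoined (s + t).
Proof.
move=> [n ns] [m mt]; exists (maxn n m).
by apply: lowD; [apply: low_leq ns; exact: leq_maxl | apply: low_leq mt; exact: leq_maxr].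
Qed.

Lemma adjoinedZ r s : adjoined s -> adjoined (phi r * s).
Proof. by move=> [n ns]; exists n; exact: lowZ. Qed.

Lemma adjoinedM s t : adjoined s -> adjoined t -> adjoined (s * t).
Proof.
move=> [n ns] gt; elim: n s ns => [|n IH] s /=.
  by move=> ->; rewrite mul0r; exists 0%N.
move=> [r /IH rs]; rewrite -[s](subrK (phi r * g ^+ n)) mulrDl; apply: adjoinedD => //.
by rewrite -mulrA; apply: adjoinedZ; case: gt => m mt; exists (n + m)%N; exact: lowMX.
Qed.

Lemma adjoined_cst r : adjoined (phi r).
Proof. by exists 1%N; exists r; rewrite /= expr0 mulr1 subrr. Qed.

Lemma adjoined_gen : adjoined g.
Proof.
by exists 2%N; exists 1; rewrite rmorph1 mul1r expr1 subrr; exact: low0.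
Qed.

(** The argument with leading coefficients is run in [S] itself. As [low] asks for some expression
    by powers of [g] and not a unique one, no polynomial ring is needed: [L n] collects the possible
    coefficients of [g ^+ n] in elements of [J] of degree at most [n]. *)
Theorem hilbert_basis : noetherian R -> (forall s, adjoined s) -> noetherian S.
Proof.
move=> noethR gen; apply/noetherian_seq => J [J0 JD JM].
pose L n : set R := [set r | exists s, J s /\ low n (s - phi r * g ^+ n)].
have idL n : is_ideal (L n).
  split=> /=.
  - by exists 0; split=> //; rewrite rmorph0 mul0r subr0; exact: low0.
  - move=> r r' [s [Js rs]] [s' [Js' rs']]; exists (s + s'); split; first exact: JD.
    by have := lowD rs rs'; congr low; rewrite rmorphD; ring.
  - move=> c r [s [Js rs]]; exists (phi c * s); split; first exact: JM.
    by have := lowZ c rs; congr low; rewrite rmorphM; ring.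
have Lsub n : L n `<=` L n.+1.
  move=> r [s [Js rs]]; exists (g * s); split; first exact: JM.
  by have := lowM rs; congr low; rewrite exprS; ring.
have [N NP] := noetherian_stationary noethR idL Lsub.
have /choice [l lP] n := (noetherian_seq R).1 noethR (L n) (idL n).
have /choice [lift liftP] (nr : nat * R) : exists s, L nr.1 nr.2 ->
    J s /\ low nr.1 (s - phi nr.2 * g ^+ nr.1).
  have [[s sP]|no] := pselect (L nr.1 nr.2); first by exists s.
  by exists 0.
(* Elements of [J] lifting generators of [L n] for [n] up to the index [N] where the chain stops
   growing. *)
exists (flatten [seq [seq lift (n, r) | r <- l n] | n <- iota 0 N.+1]); split.
  move=> x /flattenP [_ /mapP [n _ ->] /mapP [r rl ->]].
  by have [] := liftP (n, r) ((lP n).1 r rl).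
move=> K [K0 KD KM] KG.
suff main d s : J s -> low d s -> K s by move=> s Js; have [d ds] := gen s; exact: main ds.
elim: d s => [|d IH] s Js; first by move=> /= ->.
move=> [r rs]; have Lr : L d r by exists s.
(* Beyond degree [N] no new coefficients occur, so the leading coefficient is already realised in
   degree [m]; multiplying by [g ^+ (d - m)] returns to degree [d] and cancels the leading term. *)
pose m := minn d N.
have Lm : L m r by rewrite /m /minn; case: ifP => // _; exact: NP Lr.
have md : (m <= d)%N by exact: geq_minl.
have mN : (m < N.+1)%N by rewrite ltnS geq_minr.
have [k [Kk Jk km]] : exists k, [/\ K k, J k & low m (k - phi r * g ^+ m)].
  apply: ((lP m).2 [set r | exists k, [/\ K k, J k & low m (k - phi r * g ^+ m)]]); last exact: Lm.
    split=> /=.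
    - by exists 0; split=> //; rewrite rmorph0 mul0r subr0; exact: low0.
    - move=> a b [k [Kk Jk rk]] [k' [Kk' Jk' rk']]; exists (k + k').
      split; [exact: KD | exact: JD |].
      by have := lowD rk rk'; congr low; rewrite rmorphD; ring.
    - move=> c a [k [Kk Jk rk]]; exists (phi c * k); split; [exact: KM | exact: JM |].
      by have := lowZ c rk; congr low; rewrite rmorphM; ring.
  move=> {Lr rs Lm}r rl; exists (lift (m, r)); have [Jm lm] := liftP (m, r) ((lP m).1 r rl).
  split=> //; apply: KG; apply/flattenP; exists [seq lift (m, r) | r <- l m].
    by apply/mapP; exists m => //; rewrite mem_iota.
  by apply/mapP; exists r.
have -> : s = (s + phi (- 1) * (g ^+ (d - m) * k)) + g ^+ (d - m) * k.
  by rewrite rmorphN rmorph1; ring.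
apply: (KD); last exact: (KM).
apply: IH; first by apply: (JD) => //; apply: (JM); exact: (JM).
have := lowMX (d - m) km; rewrite subnK // => dk.
have := lowD rs (lowZ (- 1) dk); congr low.
have -> : g ^+ d = g ^+ (d - m) * g ^+ m by rewrite -exprD subnK.
by rewrite rmorphN rmorph1; ring.
Qed.

End Adjunction.

Section SubsetRing.
Variables (S : comPzRingType) (P : set S).
Hypotheses (P1 : P 1) (PD : forall s t, P s -> P t -> P (s + t))
  (PM : forall s t, P s -> P t -> P (s * t)) (PN : P (- 1)).

Definition subset_ring := {s : S | P s}.
HB.instance Definition _ := gen_eqMixin subset_ring.
HB.instance Definition _ := gen_choiceMixin subset_ring.
Implicit Types a b c : subset_ring.

Lemma subset_ring_eq a b : sval a = sval b -> a = b.
Proof.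
by case: a b => [s hs] [t ht] /= e; subst t; congr exist; exact: Prop_irrelevance.
Qed.

Definition sr_zero : subset_ring.
Proof. by exists 0; rewrite -(subrr 1); exact: PD. Defined.
Definition sr_one : subset_ring := exist _ 1 P1.
Definition sr_add a b : subset_ring := exist _ _ (PD (svalP a) (svalP b)).
Definition sr_mul a b : subset_ring := exist _ _ (PM (svalP a) (svalP b)).
Definition sr_opp a : subset_ring := exist _ _ (PM PN (svalP a)).

Lemma sr_addA : associative sr_add.
Proof. by move=> a b c; apply: subset_ring_eq; exact: addrA. Qed.
Lemma sr_addC : commutative sr_add.
Proof. by move=> a b; apply: subset_ring_eq; exact: addrC. Qed.
Lemma sr_add0 : left_id sr_zero sr_add.
Proof. by move=> a; apply: subset_ring_eq; exact: add0r. Qed.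
Lemma sr_addN : left_inverse sr_zero sr_opp sr_add.
Proof. by move=> a; apply: subset_ring_eq; rewrite /= mulN1r addNr. Qed.
HB.instance Definition _ := GRing.isZmodule.Build subset_ring sr_addA sr_addC sr_add0 sr_addN.

Lemma sr_mulA : associative sr_mul.
Proof. by move=> a b c; apply: subset_ring_eq; exact: mulrA. Qed.
Lemma sr_mulC : commutative sr_mul.
Proof. by move=> a b; apply: subset_ring_eq; exact: mulrC. Qed.
Lemma sr_mul1 : left_id sr_one sr_mul.
Proof. by move=> a; apply: subset_ring_eq; exact: mul1r. Qed.
Lemma sr_mulDl : left_distributive sr_mul sr_add.
Proof. by move=> a b c; apply: subset_ring_eq; exact: mulrDl. Qed.
HB.instance Definition _ :=
  GRing.Zmodule_isComPzRing.Build subset_ring sr_mulA sr_mulC sr_mul1 sr_mulDl.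

Lemma subring_exists : exists (A : comPzRingType) (iota : {rmorphism A -> S}),
  injective iota /\ forall s, P s <-> exists x, iota x = s.
Proof.
have [||| iota iE] := @exists_rmorphism subset_ring S sval; [by []..|].
exists subset_ring, iota; split; first by move=> a b; rewrite !iE; exact: subset_ring_eq.
move=> s; split=> [Ps|[a <-]]; last by rewrite iE; exact: (svalP a).
by exists (exist _ s Ps); rewrite iE.
Qed.

End SubsetRing.

(** The elements of [l] are adjoined one at a time by [hilbert_basis], starting from the image of
    [phi]. The last conclusion is the induction principle for the ring so generated. *)
Lemma noetherian_adjoin (R S : comPzRingType) (phi : {rmorphism R -> S}) (l : seq S) :
  noetherian R -> exists (A : comPzRingType) (iota : {rmorphism A -> S}),
    [/\ noetherian A, injective iota, (forall r, exists a, iota a = phi r),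
        (forall x, x \in l -> exists a, iota a = x) &
        forall P : set S, (forall s t, P s -> P t -> P (s + t)) ->
          (forall s t, P s -> P t -> P (s * t)) -> (forall r, P (phi r)) ->
          (forall x, x \in l -> P x) -> forall a, P (iota a)].
Proof.
move=> noethR; elim: l => [|x l [A [iota [noethA iota_inj phiA lA minA]]]].
  have [||||A [iota [iota_inj iotaP]]] := @subring_exists S [set s | exists r, phi r = s].
  - by exists 1; rewrite rmorph1.
  - by move=> _ _ [r <-] [r' <-]; exists (r + r'); rewrite rmorphD.
  - by move=> _ _ [r <-] [r' <-]; exists (r * r'); rewrite rmorphM.
  - by exists (- 1); rewrite rmorphN rmorph1.
  have phiA r : exists a, iota a = phi r by apply/iotaP; exists r.
  exists A, iota; split=> //; last first.
    by move=> P _ _ Pphi _ a; have /iotaP [r <-] : exists b, iota b = iota a by exists a.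
  have [f fP] := choice phiA.
  have [|||h hE] := @exists_rmorphism R A f.
  - by move=> r r'; apply: iota_inj; rewrite rmorphD !fP rmorphD.
  - by move=> r r'; apply: iota_inj; rewrite rmorphM !fP rmorphM.
  - by apply: iota_inj; rewrite fP !rmorph1.
  apply: (noetherian_fractions (phi := h)) noethR => a.
  have /iotaP [r e] : exists b, iota b = iota a by exists a.
  exists r, 1, 1; rewrite !mul1r; split=> //; apply: iota_inj.
  by rewrite hE fP e.
have [||||B [kappa [kappa_inj kappaP]]] := @subring_exists S (adjoined iota x).
- by have := adjoined_cst iota x 1; rewrite rmorph1.
- exact: adjoinedD.
- exact: adjoinedM.
- by have := adjoined_cst iota x (- 1); rewrite rmorphN rmorph1.
have iotaB a : exists b, kappa b = iota a by apply/kappaP; exact: adjoined_cst.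
have [f fP] := choice iotaB.
have [|||h hE] := @exists_rmorphism A B f.
- by move=> r r'; apply: kappa_inj; rewrite rmorphD !fP rmorphD.
- by move=> r r'; apply: kappa_inj; rewrite rmorphM !fP rmorphM.
- by apply: kappa_inj; rewrite fP !rmorph1.
have [y yx] : exists y, kappa y = x by apply/kappaP; exact: adjoined_gen.
exists B, kappa; split=> //.
- apply: (hilbert_basis (phi := h) (g := y) noethA) => b.
  have /kappaP [n] : exists b', kappa b' = kappa b by exists b.
  exists n; move: n b p => n; elim: n => [|n IH] b /=.
    by rewrite -(rmorph0 kappa) => /kappa_inj.
  move=> [r rb]; exists r; apply: IH; move: rb; congr low.
  by rewrite rmorphB rmorphM rmorphXn yx hE fP.
- by move=> r; have [a <-] := phiA r; exact: iotaB.
- move=> z; rewrite inE => /orP [/eqP ->|/lA [a <-]]; first by exists y.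
  exact: iotaB.
- move=> P PD PM Pphi Pl b.
  have /kappaP [n nb] : exists b', kappa b' = kappa b by exists b.
  move: (kappa b) nb; elim: n => [|n IH] s /=.
    by move=> ->; rewrite -(rmorph0 phi).
  have Pi a : P (iota a).
    by apply: minA => // z zl; apply: Pl; rewrite inE zl orbT.
  move=> [r /IH rb]; rewrite -[s](subrK (iota r * x ^+ n)); apply: (PD) => //.
  apply: (PM) => //; elim: n {IH rb} => [|n IH]; first by rewrite expr0 -(rmorph1 phi).
  by rewrite exprS; apply: (PM) => //; apply: Pl; rewrite mem_head.
Qed.

End Noetherian.

(** * Derivations, nilpotents and normalisation *)

Definition ring_derivation (A : comPzRingType) (d : A -> A) :=
  {morph d : s t / s + t} /\ forall s t, d (s * t) = s * d t + t * d s.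

Definition invertible_integers (A : comPzRingType) := forall n, exists u : A, n.+1%:R * u = 1.

Section RingDerivations.
Variables (A : comPzRingType) (d : A -> A).
Hypothesis derd : ring_derivation d.

Lemma rderD s t : d (s + t) = d s + d t. Proof. exact: derd.1. Qed.
Lemma rderM s t : d (s * t) = s * d t + t * d s. Proof. exact: derd.2. Qed.
Lemma rder0 : d 0 = 0. Proof. by apply: (addrI (d 0)); rewrite -rderD !addr0. Qed.
Lemma rder1 : d 1 = 0.
Proof. by apply: (addrI (d 1)); rewrite addr0 -[in RHS](mulr1 1) rderM !mul1r. Qed.
Lemma rderN s : d (- s) = - d s.
Proof. by apply: (addrI (d s)); rewrite -rderD !subrr rder0. Qed.
Lemma rderB s t : d (s - t) = d s - d t. Proof. by rewrite rderD rderN. Qed.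

Lemma rderX s n : d (s ^+ n.+1) = n.+1%:R * s ^+ n * d s.
Proof.
elim: n => [|n IH]; first by rewrite expr0 expr1; ring.
by rewrite exprS rderM IH -[n.+2]addn1 natrD exprS; ring.
Qed.

(** Differentiating a relation [a ^+ m.+1 * d a ^+ r = 0] and multiplying by [d a] trades one factor
    [a] for two factors [d a], up to the invertible integer m + 1 and a multiple of the relation
    itself. *)
Lemma nilpotent_rder a : invertible_integers A -> nilpotent a -> nilpotent (d a).
Proof.
move=> char0 [n an].
have step m r : a ^+ m.+1 * d a ^+ r = 0 -> a ^+ m * d a ^+ r.+2 = 0.
  move=> e; have [u mu] := char0 m; apply: (mulr_can mu); rewrite mulr0.
  have := congr1 (fun x => d a * d x) e; rewrite /= rder0 mulr0 rderM rderX.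
  case: r e => [|r] e; first by rewrite expr0 rder1 => <-; rewrite !exprS expr0; ring.
  rewrite rderX => e'.
  transitivity (d a * (a ^+ m.+1 * (r.+1%:R * d a ^+ r * d (d a)) +
      d a ^+ r.+1 * (m.+1%:R * a ^+ m * d a)) - r.+1%:R * d (d a) * (a ^+ m.+1 * d a ^+ r.+1)).
    by rewrite !exprS; ring.
  by rewrite e e'; ring.
have {an} : a ^+ n * d a ^+ 0 = 0 by rewrite an mul0r.
elim: n 0%N => [|n IH] r; first by rewrite expr0 mul1r; exists r.
by move=> /step /IH.
Qed.

End RingDerivations.

Lemma nilpotent_ideal (A : comPzRingType) : is_ideal [set a : A | nilpotent a].
Proof.
split=> /=.
- by exists 1%N; rewrite expr1.
- move=> a b [n an] [m bm]; exists (n + m)%N.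
  by have [c [c' ->]] := pow_add_ideal a b n m; rewrite an bm !mulr0 addr0.
- by move=> a b [n bn]; exists n; rewrite exprMn bn mulr0.
Qed.

(** If [c j] is not nilpotent, some multiple [t] of a power of [c j] annihilates the
    nilradical although [t * c j] is nonzero; then [t c] is a nontrivial relation. *)
Lemma independent_mod_nilpotents (A : comPzRingType) (I : finType) (D : I -> A -> A) (c : I -> A) :
  noetherian A ->
  (forall e : I -> A, (forall s, \sum_j e j * D j s = 0) -> forall j, e j = 0) ->
  (forall s, nilpotent (\sum_j c j * D j s)) -> forall j, nilpotent (c j).
Proof.
move=> /noetherian_seq noeth indep nilc j; apply: contrapT => nj.
have [l [nill gen]] := noeth _ (nilpotent_ideal A).
have [x [xj xl]] : exists x, (forall n, x * c j ^+ n <> 0) /\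
    forall y, y \in l -> exists n, x * y * c j ^+ n = 0.
  elim: l nill {gen} => [|y l IH] nill.
    by exists 1; split=> // n; rewrite mul1r => e; apply: nj; exists n.
  have [|x [xj xl]] := IH; first by move=> z zl; apply: nill; rewrite inE zl orbT.
  have [k yk] := nill y (mem_head _ _).
  (* [e] is an exponent at which no power of [c j] kills [x * y ^+ e], while some power kills the
     product with one more [y]. It exists because [y] is nilpotent. *)
  have [e [ej [n ne]]] : exists e, (forall n, x * y ^+ e * c j ^+ n <> 0) /\
      exists n, x * y ^+ e.+1 * c j ^+ n = 0.
    have : exists n, x * y ^+ k * c j ^+ n = 0 by exists 0%N; rewrite yk mulr0 mul0r.
    elim: k {yk} => [[n]|k IHk hk]; first by rewrite expr0 mulr1 => /xj.
    have [|none] := pselect (exists n, x * y ^+ k * c j ^+ n = 0); first exact: IHk.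
    by exists k; split=> // n e; apply: none; exists n.
  exists (x * y ^+ e); split=> // z; rewrite inE => /orP [/eqP ->|/xl [m em]].
    by exists n; rewrite -[x * _ * y]mulrA -exprSr.
  exists m; have -> : x * y ^+ e * z * c j ^+ m = y ^+ e * (x * z * c j ^+ m) by ring.
  by rewrite em mulr0.
have [N NP] : exists N, forall y, y \in l -> x * y * c j ^+ N = 0.
  elim: l xl {nill gen} => [|y l IH] xl; first by exists 0%N.
  have [|N NP] := IH; first by move=> z zl; apply: xl; rewrite inE zl orbT.
  have [n e] := xl y (mem_head _ _).
  exists (n + N)%N => z; rewrite inE exprD => /orP [/eqP ->|/NP e'].
    by rewrite mulrA e mul0r.
  by rewrite [c j ^+ n * _]mulrC mulrA e' mul0r.
pose t := x * c j ^+ N.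
have tn y : nilpotent y -> t * y = 0.
  move=> ny; rewrite mulrC; apply: (gen _ (annihilator_ideal t)) ny => z /NP /=.
  by rewrite mulrCA mulrA.
apply: (xj N.+1); rewrite exprSr mulrA -/t; apply: (indep (fun j => t * c j)) => s.
transitivity (t * \sum_i c i * D i s); last exact: tn.
by rewrite mulr_sumr; apply: eq_bigr => i _; rewrite mulrA.
Qed.

(** * Derivations of total rings of fractions and integral elements *)

Section Seidenberg.
Variables (A Q : comPzRingType) (q : {rmorphism A -> Q}) (d : A -> A).
Hypotheses (noethA : noetherian A) (char0 : invertible_integers A).
Hypotheses (tfq : is_total_fractions_red q) (derd : ring_derivation d).

Lemma nzd_redM (s t : A) : nonzerodivisor_red s -> nonzerodivisor_red t ->
  nonzerodivisor_red (s * t).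
Proof. by move=> ns nt b; rewrite -mulrA => /ns /nt. Qed.

Lemma nzd_red1 : nonzerodivisor_red (1 : A).
Proof. by move=> b; rewrite mul1r. Qed.

Lemma nzd_redX (s : A) n : nonzerodivisor_red s -> nonzerodivisor_red (s ^+ n).
Proof.
by move=> ns; elim: n => [|n IH]; [exact: nzd_red1 | rewrite exprS; exact: nzd_redM].
Qed.

Lemma tf_can s (y z : Q) : nonzerodivisor_red s -> y * q s = z * q s -> y = z.
Proof.
have [_ tinv _] := tfq.
by move=> /tinv [u su] e; apply: (mulr_can su); rewrite mulrC e mulrC.
Qed.

(** The quotient rule without division: differentiate [y * q s = q a]. *)
Definition quotient_der_rel (y z : Q) := exists a s,
  [/\ nonzerodivisor_red s, y * q s = q a & z * q s = q (d a) - y * q (d s)].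

Lemma quotient_der_ex y : exists z, quotient_der_rel y z.
Proof.
have [_ tinv tfrac] := tfq; have [a [s [ns e]]] := tfrac y; have [u su] := tinv s ns.
exists ((q (d a) - y * q (d s)) * u), a, s; split=> //.
by rewrite -mulrA [u * _]mulrC su mulr1.
Qed.

(** If a/s and b/t agree in [Q], then [a * t - b * s] is nilpotent, hence so is its derivative,
    which [q] therefore kills. *)
Lemma quotient_der_uniq y z z' : quotient_der_rel y z -> quotient_der_rel y z' -> z = z'.
Proof.
move=> [a [s [ns e ez]]] [b [t [nt e' ez']]]; have [tker _ _] := tfq.
have : q (d (a * t - b * s)) = 0.
  apply/tker; apply: (nilpotent_rder derd char0); apply/tker.
  by rewrite rmorphB !rmorphM -e -e'; ring.
rewrite (rderB derd) !(rderM derd) rmorphB !rmorphD !rmorphM => e0.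
apply: (tf_can ns); apply: (tf_can nt).
have -> : z * q s * q t = q (d a) * q t - q (d s) * (y * q t) by rewrite ez; ring.
have -> : z' * q s * q t = (z' * q t) * q s by ring.
apply/eqP; rewrite ez' -subr_eq0 -e0 e' -e; apply/eqP; ring.
Qed.

Lemma quotient_der : exists D : Q -> Q, ring_derivation D /\ forall a, D (q a) = q (d a).
Proof.
have [D DP] := choice quotient_der_ex.
exists D; split; [split|].
- move=> y z; apply: (quotient_der_uniq (DP _)).
  have [a [s [ns e ey]]] := DP y; have [b [t [nt e' ez]]] := DP z.
  exists (a * t + b * s), (s * t); split; first exact: nzd_redM.
    by rewrite rmorphD !rmorphM -e -e'; ring.
  have -> : (D y + D z) * q (s * t) = (D y * q s) * q t + (D z * q t) * q s.
    by rewrite rmorphM; ring.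
  by rewrite ey ez (rderD derd) !(rderM derd) !rmorphD !rmorphM -e -e'; ring.
- move=> y z; apply: (quotient_der_uniq (DP _)).
  have [a [s [ns e ey]]] := DP y; have [b [t [nt e' ez]]] := DP z.
  exists (a * b), (s * t); split; first exact: nzd_redM.
    by rewrite !rmorphM -e -e'; ring.
  have -> : (y * D z + z * D y) * q (s * t) = y * (D z * q t) * q s + z * (D y * q s) * q t.
    by rewrite rmorphM; ring.
  by rewrite ey ez !(rderM derd) !rmorphD !rmorphM -e -e'; ring.
- move=> a; apply: (quotient_der_uniq (DP _)).
  exists a, 1; split; [exact: nzd_red1 | by rewrite rmorph1 mulr1 |].
  by rewrite (rder1 derd) rmorph0 rmorph1; ring.
Qed.

Section IteratedDerivative.
Variables (D : Q -> Q) (derD : ring_derivation D) (y : Q).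

(** [iterated_comm m n u] is the value at [u] of the [n]-fold commutator of the
    operator [D ^ m] with multiplication by [y]. *)
Fixpoint iterated_comm m n u : Q :=
  if n is n'.+1 then iterated_comm m n' (u * y) - y * iterated_comm m n' u else iter m D u.

(** For an operator T, the commutator of D T with [y] is D applied to the commutator of T with [y],
    plus [D y] times T; this iterates. At [n = 0] the second term has coefficient 0, so the
    truncated predecessor is harmless. *)
Lemma iterated_commS m n u :
  iterated_comm m.+1 n u = D (iterated_comm m n u) + n%:R * D y * iterated_comm m n.-1 u.
Proof.
elim: n u => [|n IH] u /=; first by ring.
rewrite !IH (rderB derD) (rderM derD).
case: n {IH} => [|n] /=; first by ring.
by rewrite -[n.+2]addn1 natrD; ring.
Qed.

Lemma iterated_comm0 n u : iterated_comm 0 n.+1 u = 0.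
Proof.
elim: n u => [|n IH] u; first by rewrite /=; ring.
by have /= -> := IH (u * y); have /= -> := IH u; ring.
Qed.

(** [D ^ m] is a differential operator of order [m]: its m-fold commutator with [y] is
    multiplication by its symbol, and further commutators vanish. *)
Lemma iterated_comm_diag m u :
  (forall n, (m < n)%N -> iterated_comm m n u = 0) /\
  iterated_comm m m u = (m`!)%:R * u * D y ^+ m.
Proof.
elim: m => [|m [IH1 IH2]].
  split; first by case=> // n _; exact: iterated_comm0.
  by rewrite /= fact0 expr0; ring.
split=> [[//|n] mn|].
  by rewrite iterated_commS [n.+1.-1]/= !IH1 ?(ltnW mn) // (rder0 derD); ring.
by rewrite iterated_commS [m.+1.-1]/= IH1 // (rder0 derD) IH2 factS natrM exprS; ring.
Qed.

(** Expanding the commutator puts factors [y] inside or outside the iterated derivative; the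
    exponents [i] and [l] absorb them, and each resulting term is a product of two elements of
    [P]. *)
Lemma iterated_comm_stable (P : set Q) e :
  (forall s t, P s -> P t -> P (s - t)) -> (forall s t, P s -> P t -> P (s * t)) ->
  (forall s, P s -> P (D s)) -> (forall i, P (e * y ^+ i)) ->
  forall n m l i, P (e * y ^+ l * iterated_comm m n (e * y ^+ i)).
Proof.
move=> PB PM PD Pe; elim=> [|n IH] m l i /=.
  by apply: (PM) => //; elim: m => //= m; exact: PD.
rewrite -[e * _ * y]mulrA -exprSr mulrBr; apply: (PB) => //.
by rewrite mulrA -[e * _ * y]mulrA -exprSr.
Qed.

End IteratedDerivative.

(** If [y] is a/s and satisfies a monic equation of degree [m], then [s ^+ m] is a denominator of
    the powers below [m], and the equation reduces the higher powers to these. *)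
Lemma integral_denominator y : integral_over q y ->
  exists s, nonzerodivisor_red s /\ forall n, exists a, q s * y ^+ n = q a.
Proof.
move=> [m [c e]]; have [_ _ tfrac] := tfq; have [a [s [ns ya]]] := tfrac y.
exists (s ^+ m); split; first exact: nzd_redX.
elim/ltn_ind => n IH; have [nm|mn] := leqP m n; last first.
  exists (s ^+ (m - n) * a ^+ n).
  rewrite rmorphM !rmorphXn -ya exprMn -{1}(subnK (ltnW mn)) exprD; ring.
have yn : y ^+ n = - \sum_(j < m) q (c j) * y ^+ (n - m + j).
  rewrite -{1}(subnK nm) exprD; have -> : y ^+ m = - \sum_(j < m) q (c j) * y ^+ j.
    by apply/eqP; rewrite -addr_eq0 e.
  by rewrite mulrN mulr_sumr; congr (- _); apply: eq_bigr => j _; rewrite exprD; ring.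
have /choice [b bP] (j : 'I_m) : exists b, q (s ^+ m) * y ^+ (n - m + j) = q b.
  by apply: IH; rewrite -{2}(subnK nm) ltn_add2l.
exists (- \sum_(j < m) c j * b j); rewrite yn mulrN mulr_sumr rmorphN rmorph_sum.
by congr (- _); apply: eq_bigr => j _; rewrite rmorphM -bP; ring.
Qed.

Lemma low_sum y n z : low q y n z -> exists c : 'I_n -> A, z = \sum_(i < n) q (c i) * y ^+ i.
Proof.
suff H : low q y n z -> exists c : nat -> A, z = \sum_(i < n) q (c i) * y ^+ i.
  by move=> /H [c ->]; exists (fun i => c i).
elim: n z => [|n IH] z /=; first by move=> ->; exists (fun=> 0); rewrite big_ord0.
move=> [r /IH [c e]]; exists (fun i => if i == n then r else c i).
rewrite big_ord_recr /= eqxx -[z](subrK (q r * y ^+ n)) e; congr (_ + _).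
by apply: eq_bigr => i _; rewrite ltn_eqF.
Qed.

(** All powers of [z] lie in the module of fractions with denominator [s]. In [L n] are the
    numerators of the combinations of the first [n] powers; when this chain of ideals stops, some
    power of [z] is a combination of lower ones. *)
Lemma almost_integral s z : nonzerodivisor_red s ->
  (forall n, exists a, q s * z ^+ n = q a) -> integral_over q z.
Proof.
move=> ns sz; have [_ tinv _] := tfq; have [u su] := tinv s ns.
pose L n : set A := [set a | low q z n (u * q a)].
have [||N NP] := noetherian_stationary (L := L) noethA.
- move=> n; rewrite /L; split=> [|a b /= la lb|a b /= lb] /=; first by rewrite rmorph0 mulr0; exact: low0.
    by rewrite rmorphD mulrDr; exact: lowD.
  by rewrite rmorphM mulrCA; exact: lowZ.
- by move=> n a; exact: lowS.
have [a sa] := sz N.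
have : L N a.
  apply: (NP N.+1); exists 1; rewrite -sa mulrA [u * _]mulrC su rmorph1 subrr.
  exact: low0.
rewrite /L /= -sa mulrA [u * _]mulrC su mul1r => /low_sum [c e].
exists N, (fun i => - c i); rewrite {1}e -big_split big1 // => i _ /=.
by rewrite rmorphN mulNr subrr.
Qed.

(** Seidenberg's theorem: the leading coefficients of [e^(tD) y - y] witness that
    [D y] is almost integral, hence integral because [A] is Noetherian. *)
Theorem seidenberg (D : Q -> Q) y : ring_derivation D -> (forall a, D (q a) = q (d a)) ->
  integral_over q y -> integral_over q (D y).
Proof.
move=> derD Dq /integral_denominator [s [ns sy]].
apply: (@almost_integral (s * s)); first exact: nzd_redM.
move=> n; pose P : set Q := [set z | exists a, z = q a].
(* By [iterated_comm_diag] this element is n! times the square of [q s] times [D y ^+ n]. With n!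
   inverted, the square of [s] is a common denominator of all powers of [D y]. *)
have [a] : P (q s * iterated_comm D y n n (q s)).
  have := @iterated_comm_stable D y P (q s) _ _ _ _ n n 0 0.
  rewrite !expr0 !mulr1; apply.
  - by move=> _ _ [a ->] [b ->]; exists (a - b); rewrite rmorphB.
  - by move=> _ _ [a ->] [b ->]; exists (a * b); rewrite rmorphM.
  - by move=> _ [a ->]; exists (d a).
  - by move=> i; have [a e] := sy i; exists a.
rewrite (iterated_comm_diag derD y n (q s)).2 => e.
have [u nu] : exists u : A, (n`!)%:R * u = 1.
  by have [u] := char0 (n`!).-1; rewrite prednK ?fact_gt0 //; exists u.
exists (u * a); rewrite !rmorphM -e.
have : q ((n`!)%:R * u) = 1 by rewrite nu rmorph1.
rewrite rmorphM rmorph_nat => nu'.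
transitivity ((n`!)%:R * q u * (q s * q s * D y ^+ n)); first by rewrite nu' mul1r.
by ring.
Qed.

End Seidenberg.

(** * The integral closure of the reduced ring *)

Section Normalisation.
Variables (A B : comPzRingType) (f : {rmorphism A -> B}).
Hypothesis normf : is_normalisation_ring f.

Lemma normalisation_denominator (y : B) : exists a s, y * f s = f a /\ forall z, z * f s = 0 -> z = 0.
Proof.
have [Q [q [j [tfq injj jf _]]]] := normf; have [_ tinv tfrac] := tfq.
have [a [s [ns e]]] := tfrac (j y); exists a, s; split.
  by apply: injj; rewrite rmorphM !jf.
move=> z /(congr1 j); rewrite rmorphM rmorph0 jf => e'; apply: injj; rewrite rmorph0.
by apply: (tf_can tfq ns); rewrite e' mul0r.
Qed.

(** A nonzerodivisor of [A] stays one modulo nilpotents, so it becomes invertible in the total ring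
    of fractions. *)
Lemma normalisation_regular (h : A) (z : B) : (forall b, h * b = 0 -> b = 0) -> f h * z = 0 -> z = 0.
Proof.
move=> regh; have [Q [q [j [tfq injj jf _]]]] := normf.
have nh : nonzerodivisor_red h.
  move=> b [n]; rewrite exprMn => e; exists n.
  elim: n {b}(b ^+ n) e => [|n IH] b; first by rewrite expr0 mul1r.
  by rewrite exprS -mulrA => /regh; exact: IH.
move=> /(congr1 j); rewrite rmorphM rmorph0 jf => e; apply: injj; rewrite rmorph0.
by apply: (tf_can tfq nh); rewrite mul0r mulrC.
Qed.

Lemma normalisation_reduced (y : B) : nilpotent y -> y = 0.
Proof.
move=> [n yn]; have [Q [q [j [tfq injj jf _]]]] := normf; have [tker tinv tfrac] := tfq.
have [a [s [ns e]]] := tfrac (j y); apply: injj; rewrite rmorph0.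
apply: (tf_can tfq ns); rewrite mul0r e; apply/tker.
have [m am] : nilpotent (a ^+ n).
  by apply/tker; rewrite rmorphXn -e exprMn -rmorphXn yn rmorph0 mul0r.
by exists (n * m)%N; rewrite exprM.
Qed.

Lemma normalisation_ker (a : A) : f a = 0 -> nilpotent a.
Proof.
have [Q [q [j [tfq injj jf _]]]] := normf; have [tker tinv tfrac] := tfq.
by move=> fa; apply/tker; rewrite -jf fa rmorph0.
Qed.

Lemma normalisation_derivation (d : A -> A) : noetherian A -> invertible_integers A ->
  ring_derivation d -> exists e : B -> B, ring_derivation e /\ forall a, e (f a) = f (d a).
Proof.
move=> noethA char0 derd; have [Q [q [j [tfq injj jf intj]]]] := normf.
have [D [derD Dq]] := quotient_der char0 tfq derd.
have /choice [e eP] y : exists z, j z = D (j y).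
  by apply/intj; apply: (seidenberg noethA char0 tfq derD Dq); apply/intj; exists y.
exists e; split; [split|].
- by move=> s t; apply: injj; rewrite rmorphD !eP rmorphD (rderD derD).
- by move=> s t; apply: injj; rewrite rmorphD !rmorphM !eP rmorphM (rderM derD).
- by move=> a; apply: injj; rewrite eP !jf Dq.
Qed.

End Normalisation.

(** * The ideal of a closed subscheme and charts of its blowing up *)

Section NoetherianSchemes.
Variable X : scheme.

Lemma noetherian_basic (U : opens X) (f : sect U) : affine U -> noetherian (sect U) ->
  noetherian (sect (basic f)).
Proof.
move=> affU; apply: (noetherian_fractions (phi := res (basic_sub (f := f)))) => b.
have [n [s e]] := aff_frac affU (basic_sub (f := f)) b (@subset_refl _ _) (@subset_refl _ _).
have [v fv] := basic_inv f.
by exists s, (res (basic_sub (f := f)) f ^+ n), (v ^+ n); split=> //; exact: invX.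
Qed.

Lemma noetherian_nbhd (V : opens X) x : locally_noetherian X -> oset V x ->
  exists U, [/\ oset U x, affine U, noetherian (sect U) & U <=o V].
Proof.
move=> noethX Vx; have [U [Ux affU noethU]] := noethX x.
have [f [fx fV]] := aff_basis affU Ux Vx.
by exists (basic f); split=> //; [exact: affine_basic | exact: noetherian_basic].
Qed.

End NoetherianSchemes.

Section IdealSheaf.
Variables (Z X : scheme) (i : morphism Z X).
Hypothesis ci : closed_immersion i.

Lemma ideal_sheaf_ideal (U : opens X) : is_ideal (@ideal_sheaf Z X i U).
Proof.
split=> [|a b|a b]; rewrite /ideal_sheaf /=.
- exact: rmorph0.
- by move=> ea eb; rewrite rmorphD ea eb addr0.
- by move=> eb; rewrite rmorphM eb mulr0.
Qed.

Lemma ideal_sheaf_res (U V : opens X) (h : V <=o U) (s : sect U) :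
  ideal_sheaf i s -> ideal_sheaf i (res h s).
Proof.
rewrite /ideal_sheaf /= => e.
have k : preim i V <=o preim i U by move=> x; exact: h.
by rewrite -(pull_res (@preim_sub _ _ i U) (@preim_sub _ _ i V) h k) e rmorph0.
Qed.

Lemma closed_immersion_small (U : opens X) (W : opens Z) x : affine U -> oset U x ->
  (forall z, i z = x -> oset W z) ->
  exists e : sect U, unit_at e x /\ forall z, unit_at e (i z) -> oset W z.
Proof.
move=> affU Ux Wx; have [_ iclosed _] := ci.
have : closed (i @` (~` oset W)) by apply: iclosed; apply: open_closedC; exact: open_oset.
rewrite -openC => oV.
have [|e [ex eV]] := aff_basis affU (V := Opens oV) Ux.
  by move=> [z nWz e]; apply: nWz; exact: Wx.
by exists e; split=> // z ez; apply: contrapT => nWz; apply: (eV _ ez); exists z.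
Qed.

(** The preimage of [U] in [Z] is not assumed affine. Since [i] is closed and injective, [U] is
    covered by loci D(e) whose preimages lie in affine open subsets of [Z], where [aff_zero] gives
    an exponent. The set [good] is an ideal, so [aff_qc1] yields one exponent for all. *)
Lemma ideal_sheaf_quasi_coherent (U : opens X) (f s : sect U) : affine U ->
  ideal_sheaf i (res (basic_sub (f := f)) s) -> exists n, ideal_sheaf i (f ^+ n * s).
Proof.
move=> affU es; pose v := pull i (@preim_sub _ _ i U) s.
pose fz := pull i (@preim_sub _ _ i U) f.
pose good (e : sect U) := exists n, forall (W : opens Z) (k : W <=o preim i U),
  (forall z, oset W z -> unit_at e (i z)) -> res k (fz ^+ n * v) = 0.
have : good 1; last first.
  move=> [n /(_ _ (@subset_refl _ _))]; rewrite res_id => e; exists n.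
  by rewrite /ideal_sheaf /= rmorphM rmorphXn e // => z Uz; exact: unit_at1.
apply: (aff_qc1 affU) => [|x Ux].
  split.
  - exists 0%N => W k W0; apply: sect_empty => z /W0.
    exact: (sch_local X).1.
  - move=> e e' [n en] [n' en']; exists (n + n')%N => W k We; apply: sect_sep => z Wz.
    have [ez|ez] := (sch_local X).2 _ _ _ _ (We z Wz).
      have kz : omeet W (preim i (basic e)) <=o W by exact: omeetl.
      exists _, kz; split=> //; rewrite resE rmorph0 exprD mulrAC rmorphM en ?mul0r //.
      by move=> y [].
    have kz : omeet W (preim i (basic e')) <=o W by exact: omeetl.
    exists _, kz; split=> //; rewrite resE rmorph0 exprD -mulrA rmorphM en' ?mulr0 //.
    by move=> y [].
  - move=> c e [n en]; exists n => W k We; apply: en => z /We /unit_atM [].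
    by [].
(* Away from the image of [Z], a small enough D(e) has empty preimage and the exponent 0 will do. *)
have [[z izx]|noz] := pselect (exists z, i z = x); last first.
  have [|e [ex eW]] := @closed_immersion_small U (Opens open0) x affU Ux.
    by move=> z izx; case: noz; exists z.
  exists e; split=> //; exists 0%N => W k We; apply: sect_empty => z /We /eW.
  by [].
have Uz : oset (preim i U) z by rewrite /= izx.
have [W1 [W1z affW1 W1U]] := affine_nbhd Uz.
have [|e [ex eW]] := @closed_immersion_small U W1 x affU Ux.
  by move=> z' iz'x; case: ci => /(_ z z') inj _ _; rewrite -inj // iz'x.
exists e; split=> //.
pose f1 := res W1U fz; pose v1 := res W1U v.
have [|n en] := aff_zero affW1 (h := basic_sub (f := f1)) (f := f1) (s := v1) (@subset_refl _ _).
  rewrite resE /v pull_resl.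
  have k : oset (basic f1) `<=` i @^-1` oset (basic f).
    move=> y /= f1y; apply/(unit_at_pull (@preim_sub _ _ i U)); last first.
      by move: (f1y) => /unit_at_res; apply; exact: unit_at_mem f1y.
    exact: (W1U _ (unit_at_mem f1y)).
  rewrite -(pull_resr _ k (basic_sub (f := f))).
  have kk : basic f1 <=o preim i (basic f) by exact: k.
  have := congr1 (res kk) es; rewrite rmorph0 pull_resl => <-; exact: pull_irr.
exists n => W k We.
have kW : W <=o W1 by move=> y /We /eW.
rewrite (res_irr _ (subset_trans kW W1U)) -resE rmorphM rmorphXn -/f1 -/v1 en.
exact: rmorph0.
Qed.

Lemma ideal_sheaf_local (U V : opens X) (s : sect V) x : affine U -> oset U x -> oset V x ->
  ideal_sheaf i s -> exists (f : sect U) n (s' : sect U),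
    [/\ unit_at f x, represents s f n s' & ideal_sheaf i s'].
Proof.
move=> affU Ux Vx Is.
have [f [n [s' [fx [hf e]]]]] :=
  represents_ex affU (omeetr V U) (res (omeetl V U) s) (conj Vx Ux).
have [m Im] : exists m, ideal_sheaf i (f ^+ m * s').
  apply: ideal_sheaf_quasi_coherent => //; rewrite -e.
  have [_ _] := ideal_sheaf_ideal (basic f); apply.
  by do 2!apply: ideal_sheaf_res.
exists f, (m + n)%N, (f ^+ m * s'); split=> //; exists (subset_trans hf (omeetl V U)).
by rewrite rmorphM -e rmorphXn exprD resE mulrA.
Qed.

(** By quasi-coherence a section of the ideal of [Z] over any [V] is locally a fraction with
    numerator in the ideal over [U]; hence the inverse image ideal is locally generated by the ideal
    over one affine [U]. The factor [u] is the pulled back denominator, inverted. *)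
Lemma pull_ideal_local (T : scheme) (g : morphism T X) (U V : opens X) (W : opens T)
    (h : oset W `<=` g @^-1` oset V) (hU : oset W `<=` g @^-1` oset U) (s : sect V) t :
  affine U -> oset W t -> ideal_sheaf i s ->
  exists (W' : opens T) (k : W' <=o W) (s' : sect U) (u : sect W'),
    [/\ oset W' t, ideal_sheaf i s' & res k (pull g h s) = u * res k (pull g hU s')].
Proof.
move=> affU Wt Is.
have [f [n [s' [ft [hf e] Is']]]] := ideal_sheaf_local affU (hU t Wt) (h t Wt) Is.
have k : omeet W (preim g (basic f)) <=o W by exact: omeetl.
have kf : oset (omeet W (preim g (basic f))) `<=` g @^-1` oset (basic f) by exact: omeetr.
have [v fv] := basic_inv f.
exists _, k, s', (pull g kf v ^+ n); split=> //.
rewrite !pull_resl -(pull_resr _ kf hf) -(pull_resr _ kf (basic_sub (f := f))) -e.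
rewrite rmorphM rmorphXn mulrA -exprMn -rmorphM [v * _]mulrC fv rmorph1 expr1n.
by rewrite mul1r.
Qed.

Lemma inverse_image_idealM (T : scheme) (g : morphism T X) (V : opens X) (W W' : opens T)
    (h : oset W `<=` g @^-1` oset V) (k : W' <=o W) (s : sect V) (u : sect W') :
  ideal_sheaf i s -> inverse_image_ideal i g (u * res k (pull g h s)).
Proof.
move=> Is t Wt; have h' := subset_trans k h.
exists W', (@subset_refl _ _), V, h', 1%N, (fun=> s), (fun=> u); split=> //.
by rewrite big_ord1 res_id pull_resl; congr (_ * _); exact: pull_irr.
Qed.

(** For a test scheme lying over an affine [U], the Cartier condition can be checked on sections
    over [U]: local quotients by the regular section [h] are unique and therefore glue. *)
Lemma cartier_preimage_affine (T : scheme) (g : morphism T X) (U : opens X)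
    (hU : oset (otop T) `<=` g @^-1` oset U) (h : sect (otop T)) n (x : 'I_n -> sect U)
    (a : 'I_n -> sect (otop T)) :
  affine U ->
  (forall (W : opens T) (u : sect W), res (@sub_otop _ W) h * u = 0 -> u = 0) ->
  (forall s, ideal_sheaf i s -> exists u, pull g hU s = u * h) ->
  (forall j, ideal_sheaf i (x j)) -> h = \sum_j a j * pull g hU (x j) ->
  cartier_preimage i g.
Proof.
move=> affU reg Ih Ix hx t; exists (otop T), h; split=> // [W hW u|W hW s].
  by rewrite (res_irr _ (@sub_otop _ W)); exact: reg.
split.
- move=> invs; pose hh (V : opens T) := res (@sub_otop _ V) h.
  pose mult (V : opens T) (r : sect V) y := exists (V' : opens T) (k : V' <=o V),
    oset V' y /\ exists u, res k r = u * hh V'.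
  have hh_res (V V' : opens T) (k : V' <=o V) : res k (hh V) = hh V'.
    by rewrite /hh resE (res_irr _ (@sub_otop _ V')).
  have multD (V : opens T) (r r' : sect V) y : mult V r y -> mult V r' y -> mult V (r + r') y.
    move=> [V1 [k1 [V1y [u1 e1]]]] [V2 [k2 [V2y [u2 e2]]]].
    exists (omeet V1 V2), (subset_trans (omeetl V1 V2) k1); split=> //.
    exists (res (omeetl V1 V2) u1 + res (omeetr V1 V2) u2).
    rewrite mulrDl -(hh_res _ _ (omeetl V1 V2)) -rmorphM -e1.
    rewrite resE (hh_res _ _ (omeetl V1 V2)) -(hh_res _ _ (omeetr V1 V2)) -rmorphM -e2 resE.
    by rewrite rmorphD; congr (_ + _); exact: res_irr.
  have multM (V : opens T) (r c : sect V) y : mult V r y -> mult V (c * r) y.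
    move=> [V1 [k1 [V1y [u1 e1]]]]; exists V1, k1; split=> //; exists (res k1 c * u1).
    by rewrite rmorphM e1 mulrA.
  have mult_s y : oset W y -> mult W s y.
    move=> Wy; have [W1 [k1 [V [h1 [m [z [c [W1y Iz e]]]]]]]] := invs y Wy.
    have mult1 : mult W1 (res k1 s) y.
      rewrite e; elim/big_ind: _.
      - exists W1, (@subset_refl _ _); split=> //; exists 0.
        by rewrite rmorph0 mul0r.
      - by move=> *; exact: multD.
      - move=> j _; apply: multM.
        have hU1 : oset W1 `<=` g @^-1` oset U by move=> w _; exact: (hU w I).
        have [W2 [k2 [s' [u [W2y Is' e2]]]]] := pull_ideal_local h1 hU1 affU W1y (Iz j).
        exists W2, k2; split=> //; have [u' e'] := Ih _ Is'.
        exists (u * res (@sub_otop _ W2) u'); rewrite e2 -mulrA -rmorphM -e' !pull_resl.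
        by congr (_ * _); exact: pull_irr.
    have [W2 [k2 [W2y [u e2]]]] := mult1.
    by exists W2, (subset_trans k2 k1); split=> //; exists u; rewrite -e2 resE.
  have [||u uP] := sheaf_glue (res_sheaf T) (U := W)
      (P := fun V k u => res k s = u * hh V).
  + move=> V V' k k' u u' W' l l' e e'; apply/eqP; rewrite -subr_eq0; apply/eqP.
    apply: reg; rewrite -/(hh W') mulrC mulrBl.
    rewrite -{1}(hh_res _ _ l) -(hh_res _ _ l') -!rmorphM -e -e' !resE.
    by rewrite (res_irr _ (subset_trans l' k')) subrr.
  + by move=> y /mult_s [V [k [Vy [u e]]]]; exists V, k, u.
  exists u; apply: sect_sep => y /mult_s [V [k [Vy [u' e]]]].
  exists V, k; split=> //; rewrite rmorphM (uP _ _ _ e) e; congr (_ * _).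
  by rewrite resE; exact: res_irr.
- move=> [u ->] y Wy.
  have hW' : oset W `<=` g @^-1` oset U by move=> w _; exact: (hU w I).
  exists W, (@subset_refl _ _), U, hW', n, x, (fun j => u * res hW (a j)); split=> //.
  rewrite res_id hx rmorph_sum mulr_sumr; apply: eq_bigr => j _.
  by rewrite rmorphM mulrA pull_resl; congr (_ * _); exact: pull_irr.
Qed.

Lemma spec_const_regular (R : comPzRingType) (h : R) : (forall r, h * r = 0 -> r = 0) ->
  forall (W : opens (Spec R)) (u : sect W), spec_const W h * u = 0 -> u = 0.
Proof.
move=> reg W u e; apply: (@spec_sect_ext _ W) => p Wp.
have [v [pv uv]] := val_at_ex u p.
have := val_at_mul Wp (val_at_sconst h Wp) uv.
have -> : smul (sconst W h) u = 0 by exact: e.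
move=> /val_at_fun /(_ (val_at_sconst 0 Wp)) [c [pc /= ec]].
exists v; split=> //; apply: (val_at_eq (v := (0, 1)) (avoids1 p) (val_at_sconst 0 Wp)).
apply: frac_eq_sym; exists c; split=> //=.
rewrite mulr1 mul0r mulr0; apply: reg; move: ec; rewrite mulr1 mul0r mulr0 => <-; ring.
Qed.

Lemma cartier_spec (R : comPzRingType) (U : opens X) (psi : {rmorphism sect U -> R})
    (f : sect U) (g : morphism (Spec R) X) (h : oset (otop (Spec R)) `<=` g @^-1` oset U) :
  affine U -> (forall s, pull g h s = spec_const (otop _) (psi s)) ->
  (forall r, psi f * r = 0 -> r = 0) -> ideal_sheaf i f ->
  (forall s, ideal_sheaf i s -> exists r, psi s = r * psi f) ->
  cartier_preimage i g.
Proof.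
move=> affU gE reg If Is.
apply: (cartier_preimage_affine (hU := h) (n := 1) (x := fun=> f) (a := fun=> 1)
  (h := spec_const (otop _) (psi f))) => //.
- by move=> W u; rewrite (@res_const R); exact: spec_const_regular.
- move=> s /Is [r e]; exists (spec_const (otop _) r).
  by rewrite gE /= e rmorphM.
- by rewrite big_ord1 mul1r gE.
Qed.

Lemma blowup_eq_mor (B : scheme) (b : morphism B X) (T : scheme) (u v : morphism T B) :
  is_blowup i b -> cartier_preimage i (comp_mor b v) ->
  eq_mor (comp_mor b u) (comp_mor b v) -> eq_mor u v.
Proof.
move=> [_ univ] /univ [w [_ wu]] uv.
apply: (eq_mor_trans (wu u uv)); apply: eq_mor_sym; apply: wu; exact: eq_mor_refl.
Qed.

(** On a chart, the ideal of the exceptional divisor is generated by the pullback of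
    [chart_eq], a section of the ideal of [Z]. *)
Record chart (B : scheme) (b : morphism B X) (U : opens X) (W : opens B) := Chart {
  chart_affU : affine U;
  chart_noethU : noetherian (sect U);
  chart_affW : affine W;
  chart_sub : oset W `<=` b @^-1` oset U;
  chart_eq : sect U;
  chart_eq_ideal : ideal_sheaf i chart_eq;
  chart_reg : forall (W' : opens B) (k : W' <=o W) (u : sect W'),
    res k (pull b chart_sub chart_eq) * u = 0 -> u = 0;
  chart_gens : seq (sect U);
  chart_gens_ideal : forall s, s \in chart_gens -> ideal_sheaf i s;
  chart_gens_gen : forall J, is_ideal J -> (forall s, s \in chart_gens -> J s) ->
    forall s, ideal_sheaf i s -> J s;
  chart_div : forall s, ideal_sheaf i s ->
    exists u, pull b chart_sub s = u * pull b chart_sub chart_eq }.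

(** Near [y] the exceptional ideal has a regular generator [h]. Each generator of the ideal of [Z]
    is some [u j] times [h], and [h] is a combination of these generators. In the local ring at [y]
    one [u j] is then a unit, and the corresponding equation of [Z] can replace [h]. *)
Lemma chart_exists (B : scheme) (b : morphism B X) (N : opens B) (V : opens X) y :
  locally_noetherian X -> cartier_preimage i b -> oset N y -> oset V (b y) ->
  exists U W (c : chart b U W), [/\ oset W y, W <=o N & U <=o V].
Proof.
move=> noethX cart Ny Vy; have [W0 [h [W0y reg0 char0]]] := cart y.
have [U [Uy affU noethU UV]] := noetherian_nbhd noethX Vy.
have [l [Il genl]] := (noetherian_seq _).1 noethU _ (ideal_sheaf_ideal U).
pose W1 := omeet (omeet W0 N) (preim b U).
have k1 : W1 <=o W0 by move=> x [[]].
have W1N : W1 <=o N by move=> x [[]].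
have W1U : oset W1 `<=` b @^-1` oset U by move=> x [_].
have W1y : oset W1 y by [].
have div1 s : ideal_sheaf i s -> exists u, pull b W1U s = u * res k1 h.
  move=> Is; apply/char0.
  by have := inverse_image_idealM W1U (@subset_refl _ _) 1 Is; rewrite mul1r res_id.
have [W2 [k2 [V2 [h2 [m [z [a [W2y Iz e2]]]]]]]] : exists (W' : opens B) (hW : W' <=o W1)
    (V : opens X) (h' : oset W' `<=` b @^-1` oset V) (n : nat)
       (x : 'I_n -> sect V) (a : 'I_n -> sect W'),
       [/\ oset W' y, forall j, ideal_sheaf i (x j) &
           res hW (res k1 h) = \sum_(j < n) a j * pull b h' (x j)].
  have : inverse_image_ideal i b (res k1 h) by apply/char0; exists 1; rewrite mul1r.
  exact.
pose span (W : opens B) (k : W <=o W1) (r : sect W) := exists c : 'I_(size l) -> sect W,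
  r = \sum_j c j * res k (pull b W1U l`_j).
have spanD W k r r' : span W k r -> span W k r' -> span W k (r + r').
  move=> [c ->] [c' ->]; exists (fun j => c j + c' j).
  by rewrite -big_split; apply: eq_bigr => j _; rewrite mulrDl.
have spanM W k u r : span W k r -> span W k (u * r).
  move=> [c ->]; exists (fun j => u * c j).
  by rewrite mulr_sumr; apply: eq_bigr => j _; rewrite mulrA.
have span0 W k : span W k 0.
  by exists (fun=> 0); rewrite big1 // => j _; rewrite mul0r.
have span_res W k W' k' (l' : W' <=o W) r : span W k r -> span W' k' (res l' r).
  move=> [c ->]; exists (fun j => res l' (c j)).
  rewrite rmorph_sum; apply: eq_bigr => j _; rewrite rmorphM resE.
  by congr (_ * _); exact: res_irr.
have span_ideal s : ideal_sheaf i s -> span W1 (@subset_refl _ _) (pull b W1U s).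
  apply: (genl [set s | span W1 (@subset_refl _ _) (pull b W1U s)]).
    split; rewrite /= ?rmorph0 //.
    - by move=> r t; rewrite rmorphD; exact: spanD.
    - by move=> r t; rewrite rmorphM; exact: spanM.
  move=> {}s sl; have sj : (index s l < size l)%N by rewrite index_mem.
  exists (fun j => (j == Ordinal sj)%:R).
  rewrite (bigD1 (Ordinal sj)) //= eqxx mul1r nth_index // res_id big1 ?addr0 //.
  by move=> j /negPf ->; rewrite mul0r.
have [W3 [k3 [W3y W3span]]] : exists W3 (k3 : W3 <=o W1),
    oset W3 y /\ span W3 k3 (res k3 (res k1 h)).
  have : exists W3 (k3 : W3 <=o W2), oset W3 y /\
      span W3 (subset_trans k3 k2) (res k3 (res k2 (res k1 h))).
    rewrite e2; elim/big_ind: _.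
    - exists W2, (@subset_refl _ _); split=> //; rewrite rmorph0; exact: span0.
    - move=> r r' [V1 [l1 [V1y s1]]] [V3 [l3 [V3y s3]]].
      exists (omeet V1 V3), (subset_trans (omeetl V1 V3) l1); split=> //.
      rewrite rmorphD; apply: spanD.
        have := span_res _ _ _ (subset_trans (subset_trans (omeetl V1 V3) l1) k2)
          (omeetl V1 V3) _ s1.
        by rewrite resE.
      have := span_res _ _ _ (subset_trans (subset_trans (omeetl V1 V3) l1) k2)
          (omeetr V1 V3) _ s3.
      by rewrite resE (res_irr _ (subset_trans (omeetl V1 V3) l1)).
    - move=> j _.
      have [W3 [k3 [s' [u [W3y Is' e3]]]]] :=
        pull_ideal_local h2 (subset_trans k2 W1U) affU W2y (Iz j).
      exists W3, k3; split=> //; rewrite rmorphM e3; apply: (spanM); apply: (spanM).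
      have := span_res _ _ _ (subset_trans k3 k2) (subset_trans k3 k2) _ (span_ideal _ Is').
      by rewrite pull_resl pull_resl; congr span; exact: pull_irr.
  move=> [W3 [k3 [W3y s3]]]; exists W3, (subset_trans k3 k2); split=> //.
  by move: s3; rewrite !resE; congr span; exact: res_irr.
have [c ec] := W3span.
have /choice [u uP] (j : 'I_(size l)) : exists u, pull b W1U l`_j = u * res k1 h.
  by apply: div1; apply: Il; exact: mem_nth.
(* The regular factor [h] is cancelled from its own expression by the generators. *)
have e1 : \sum_j c j * res k3 (u j) = 1.
  apply/eqP; rewrite eq_sym -subr_eq0; apply/eqP.
  apply: (reg0 _ (subset_trans k3 k1)); rewrite mulrBr mulr1 -resE {1}ec.
  apply/eqP; rewrite subr_eq0 mulr_sumr; apply/eqP; apply: eq_bigr => j _.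
  by rewrite uP rmorphM; ring.
have [j0 uj0] : exists j0, unit_at (u j0) y.
  have : unit_at (\sum_j c j * res k3 (u j)) y by rewrite e1; exact: unit_at1.
  move=> /unit_at_sum [j /unit_atM [_ uj]]; exists j.
  by move: uj => /unit_at_res; apply.
have [W [Wy affW Wu]] := affine_nbhd (V := basic (u j0)) uj0.
have k : W <=o W1 := subset_trans Wu (basic_sub (f := u j0)).
have hWU := subset_trans k W1U.
have [v uv] : exists v, res k (u j0) * v = 1.
  by apply: unit_glue => x Wx; apply/unit_at_res => //; exact: Wu.
have eE : pull b hWU l`_j0 = res k (u j0) * res k (res k1 h).
  by rewrite -rmorphM -uP pull_resl; exact: pull_irr.
have Ij0 : ideal_sheaf i l`_j0 by apply: Il; exact: mem_nth.
have reg (W' : opens B) (l' : W' <=o W) (r : sect W') :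
    res l' (pull b hWU l`_j0) * r = 0 -> r = 0.
  rewrite eE rmorphM mulrAC mulrC [res k (res _ h)]resE [res l' (res _ h)]resE => /reg0 e.
  have uv' : res l' (res k (u j0)) * res l' v = 1 by rewrite -rmorphM uv rmorph1.
  by apply: (mulr_can uv'); rewrite e mulr0.
have div s : ideal_sheaf i s -> exists w, pull b hWU s = w * pull b hWU l`_j0.
  move=> /div1 [w e]; exists (res k w * v); rewrite eE.
  have -> : pull b hWU s = res k (pull b W1U s) by rewrite pull_resl; exact: pull_irr.
  have -> : res k w * v * (res k (u j0) * res k (res k1 h)) =
    (res k (u j0) * v) * (res k w * res k (res k1 h)) by ring.
  by rewrite uv mul1r e rmorphM.
exists U, W, (Chart affU noethU affW Ij0 reg Il (fun J idJ Jl s => genl J idJ Jl s) div).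
by split=> //; exact: subset_trans k W1N.
Qed.

End IdealSheaf.

Arguments chart_sub {Z X i B b U W} c _ _.

(** * Testing the blowing up against spectra *)

Lemma mor_of_ring (A S : comPzRingType) (e : {rmorphism A -> S}) :
  exists m : morphism (Spec S) (Spec A),
    (forall (V : opens (Spec A)) (W : opens (Spec S)) (h : oset W `<=` m @^-1` oset V) a,
       pull m h (spec_const V a) = spec_const W (e a)) /\
    (forall p a, avoids (m p) a <-> avoids p (e a)).
Proof.
have [f fP] := choice (@spec_const_surj A).
have [|||phi phiE] :=
  @exists_rmorphism (@sect (Spec A) (otop _)) (@sect (Spec S) (otop _))
    (fun s => spec_const (otop _) (e (f s))).
- move=> s t; rewrite -!rmorphD; congr (spec_const _ (e _)); apply: spec_const_inj.
  by rewrite rmorphD -!fP.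
- move=> s t; rewrite -!rmorphM; congr (spec_const _ (e _)); apply: spec_const_inj.
  by rewrite rmorphM -!fP.
- rewrite -[RHS](rmorph1 (spec_const (otop _))) -(rmorph1 e); congr (spec_const _ (e _)).
  by apply: spec_const_inj; rewrite -fP rmorph1.
have [m [h mE]] := @mor_to_affine (Spec S) (Spec A) (otop _) phi (spec_affine A).
have mc (V : opens (Spec A)) (W : opens (Spec S)) (k : oset W `<=` m @^-1` oset V) a :
    pull m k (spec_const V a) = spec_const W (e a).
  rewrite -(@spec_res A _ V (@sub_otop _ V)) (pull_resr (subset_trans (@sub_otop _ W) h)).
  rewrite -pull_resl mE phiE (@spec_res S); congr (spec_const _ (e _)).
  by apply: spec_const_inj; rewrite -fP.
exists m; split=> // p a.
rewrite -(@spec_const_unit A (otop _) a (m p) I) -(@spec_const_unit S (otop _) (e a) p I).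
by rewrite -(unit_at_pull h) // mc.
Qed.

(** Stands for the inclusion of [W] in [B]: using the spectrum of its ring of sections, [W] need not
    be made into a scheme. *)
Lemma mor_of_affine (B : scheme) (W : opens B) : affine W ->
  exists j : morphism (Spec (sect W)) B,
    [/\ forall p, oset W (j p),
        forall T (h : oset T `<=` j @^-1` oset W) s, pull j h s = spec_const T s,
        forall p (t : sect W), unit_at t (j p) <-> avoids p t &
        forall y, oset W y -> exists p, j p = y].
Proof.
move=> affW.
have [j [h jE]] := @mor_to_affine (Spec (sect W)) B W (spec_const (otop _)) affW.
have jW p : oset W (j p) by exact: (h p I).
have ju p (t : sect W) : unit_at t (j p) <-> avoids p t.
  by rewrite -(@spec_const_unit (sect W) (otop _) t p I) -(unit_at_pull h) // jE.
exists j; split=> //.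
- move=> T k s.
  by rewrite -(@spec_res (sect W) _ T (@sub_otop _ T)) -jE pull_resl; exact: pull_irr.
- move=> y Wy; exists (exist _ _ (vanishing_prime Wy)).
  by apply: (aff_inj affW) => // t; rewrite ju /avoids /=; split=> [/contrapT|? ?].
Qed.

Section BlowupLift.
Variables (Z X : scheme) (i : morphism Z X) (B : scheme) (b : morphism B X).
Hypotheses (ci : closed_immersion i) (blow : is_blowup i b).

(** If the pullback of functions from [V] to [W] factors through a ring [R] in which [f] is a
    regular generator of the ideal of [Z], then the inclusion of [W] in [B] factors through the
    spectrum of [R]. The ring will be the one generated by the quotients of equations, the dual
    numbers over [W], or the functions on [V] themselves. *)
Lemma blowup_lift (V : opens X) (W : opens B) (hW : oset W `<=` b @^-1` oset V)
    (R : comPzRingType) (psi : {rmorphism sect V -> R}) (e : {rmorphism R -> sect W})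
    (f : sect V) :
  affine V -> affine W -> (forall s, e (psi s) = pull b hW s) ->
  ideal_sheaf i f -> (forall r, psi f * r = 0 -> r = 0) ->
  (forall r, pull b hW f * r = 0 -> r = 0) ->
  (forall s, ideal_sheaf i s -> exists r, psi s = r * psi f) ->
  exists (g : morphism (Spec R) B) (m : morphism (Spec (sect W)) (Spec R)),
    [/\ forall (W' : opens B) (T : opens (Spec R)) (h1 : oset W' `<=` b @^-1` oset V)
          (h2 : oset T `<=` g @^-1` oset W') s, pull g h2 (pull b h1 s) = spec_const T (psi s),
        forall (T : opens (Spec R)) (T' : opens (Spec (sect W)))
          (h : oset T' `<=` m @^-1` oset T) r, pull m h (spec_const T r) = spec_const T' (e r),
        forall (T : opens (Spec R)) (T' : opens (Spec (sect W)))
          (h1 : oset T `<=` g @^-1` oset W) (h2 : oset T' `<=` m @^-1` oset T) t,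
          pull m h2 (pull g h1 t) = spec_const T' t,
        forall p a, avoids (m p) a <-> avoids p (e a) &
        [/\ forall q, oset V (b (g q)), forall p, oset W (g (m p)) &
        forall y, oset W y -> exists p, g (m p) = y /\ forall t : sect W, avoids p t <-> unit_at t y]].
Proof.
move=> affV affW ee If reg regW div.
have [m [mc mu]] := mor_of_ring e.
have [j [jW jc ju jy]] := mor_of_affine affW.
have [gX [hV gE]] := @mor_to_affine (Spec R) X V (spec_const (otop _) \o psi) affV.
have cartg : cartier_preimage i gX.
  by apply: (cartier_spec ci (psi := psi) (f := f) (h := hV)).
have [g [bg _]] := blow.2 _ _ cartg.
have hbj : oset (otop (Spec (sect W))) `<=` comp_mor b j @^-1` oset V.
  by move=> p _; exact: (hW _ (jW p)).
have jtop : oset (otop (Spec (sect W))) `<=` j @^-1` oset W by move=> p _; exact: jW.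
have bjE s : pull (comp_mor b j) hbj s = spec_const (otop _) (pull b hW s).
  by rewrite (comp_pullE hbj hW jtop) jc.
have cartj : cartier_preimage i (comp_mor b j).
  apply: (cartier_spec ci (psi := pull b hW) (f := f) (h := hbj)) => // s /div [r er].
  by exists (e r); rewrite -!ee er rmorphM.
(* Both morphisms lift the same morphism to [X], under which the inverse image of [Z] is Cartier;
   uniqueness of lifts to the blowing up identifies them. *)
have gm_j : eq_mor (comp_mor g m) j.
  apply: (blowup_eq_mor blow cartj).
  apply: (eq_mor_trans (eq_mor_assoc b g m)).
  apply: (eq_mor_trans (eq_mor_comp_l m bg)).
  have hgm : oset (otop (Spec (sect W))) `<=` comp_mor gX m @^-1` oset V.
    by move=> p _; exact: (hV (m p) I).
  apply: (mor_eq_affine (hf := hgm) (hg := hbj)) => // s.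
  by rewrite bjE (comp_pullE (V' := otop _) hgm hV (fun x _ => I)) gE /= mc ee.
have gmE p : g (m p) = j p by exact: gm_j.1.
exists g, m; split=> //.
- move=> W' T h1 h2 s.
  have h3 : oset T `<=` comp_mor b g @^-1` oset V by move=> p /h2 /h1.
  rewrite -(comp_pullE h3 h1 h2) (bg.2 _ _ h3 (subset_trans (@sub_otop _ T) hV)).
  by rewrite -pull_resl gE /= (@spec_res R).
- move=> T T' h1 h2 t.
  have h3 : oset T' `<=` comp_mor g m @^-1` oset W by move=> p /h2 /h1.
  have h4 : oset T' `<=` j @^-1` oset W by move=> p _; exact: jW.
  by rewrite -(comp_pullE h3 h1 h2) (gm_j.2 _ _ h3 h4) jc.
- split=> [q|p|y /jy [p jp]]; first by rewrite [b _](bg.1 q); exact: (hV q I).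
    by rewrite gmE; exact: jW.
  by exists p; rewrite gmE; split=> // t; rewrite -jp ju.
Qed.

Lemma chart_restrict (U : opens X) (W W' : opens B) (c : chart i b U W) : affine W' -> W' <=o W ->
  exists c' : chart i b U W', chart_eq c' = chart_eq c.
Proof.
move=> affW' k; have hs := subset_trans k (chart_sub c).
have E s : pull b hs s = res k (pull b (chart_sub c) s).
  by rewrite pull_resl; exact: pull_irr.
have reg (W2 : opens B) (k2 : W2 <=o W') (u : sect W2) :
    res k2 (pull b hs (chart_eq c)) * u = 0 -> u = 0.
  by rewrite E resE => /chart_reg.
have div s : ideal_sheaf i s -> exists u, pull b hs s = u * pull b hs (chart_eq c).
  by move=> /(chart_div c) [u e]; exists (res k u); rewrite !E e rmorphM.
by exists (Chart (chart_affU c) (chart_noethU c) affW' (chart_eq_ideal c) reg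
  (@chart_gens_ideal _ _ _ _ _ _ _ c) (@chart_gens_gen _ _ _ _ _ _ _ c) div).
Qed.

(** The last clause says that the functions on [W] are obtained from those on [U] by sums, products,
    quotients by the exceptional equation and division by units. The subring [A] generated by these
    quotients is Noetherian, and lifting its spectrum to [B] shows that functions on [W] are
    fractions over [A]. *)
Lemma good_chart_exists (N : opens B) (V : opens X) y :
  locally_noetherian X -> oset N y -> oset V (b y) ->
  exists U W (c : chart i b U W), [/\ oset W y, W <=o N, U <=o V, noetherian (sect W) &
    forall P : set (sect W), (forall s t, P s -> P t -> P (s + t)) ->
      (forall s t, P s -> P t -> P (s * t)) -> (forall s, P (pull b (chart_sub c) s)) ->
      (forall s u, pull b (chart_sub c) s = u * pull b (chart_sub c) (chart_eq c) -> P u) ->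
      (forall e v t, e * v = 1 -> P e -> P (e * t) -> P t) -> forall t, P t].
Proof.
move=> noethX Ny Vy.
have [U [W0 [c [W0y W0N UV]]]] := chart_exists ci noethX blow.1 Ny Vy.
have affU := chart_affU c; have affW0 := chart_affW c.
set hW0 := chart_sub c; set f := chart_eq c.
have regW0 r : pull b hW0 f * r = 0 -> r = 0.
  by move=> e; apply: (chart_reg (c := c) (k := @subset_refl _ _)); rewrite res_id.
have /choice [u uP] s : exists u, ideal_sheaf i s -> pull b hW0 s = u * pull b hW0 f.
  have [/(chart_div c) [u e]|no] := pselect (ideal_sheaf i s); first by exists u.
  by exists 0.
have [A [iota [noethA iota_inj phiA lA minA]]] :=
  noetherian_adjoin (pull b hW0) (map u (chart_gens c)) (chart_noethU c).
have [psif psifP] := choice phiA.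
have [|||psi psiE] := @exists_rmorphism _ _ psif.
- by move=> s t; apply: iota_inj; rewrite rmorphD !psifP rmorphD.
- by move=> s t; apply: iota_inj; rewrite rmorphM !psifP rmorphM.
- by apply: iota_inj; rewrite psifP !rmorph1.
have iotapsi s : iota (psi s) = pull b hW0 s by rewrite psiE.
have If := chart_eq_ideal c.
have [||g [m [gb mc gm mu [_ gmW gmy]]]] :=
  blowup_lift (hW := hW0) (psi := psi) (e := iota) (f := f) affU affW0 iotapsi If _ regW0.
- move=> r e; apply: iota_inj; rewrite rmorph0; apply: regW0.
  by rewrite -iotapsi -rmorphM e rmorph0.
- apply: (chart_gens_gen (c := c)).
    split=> /=; first by exists 0; rewrite rmorph0 mul0r.
      by move=> s t [r e] [r' e']; exists (r + r'); rewrite rmorphD e e' mulrDl.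
    by move=> s t [r e]; exists (psi s * r); rewrite rmorphM e mulrA.
  move=> s sl; have [r er] : exists r, iota r = u s by apply: lA; exact: map_f.
  exists r; apply: iota_inj; rewrite rmorphM !iotapsi er; apply: uP.
  exact: (chart_gens_ideal sl).
have [p [gmp pu]] := gmy y W0y.
(* The morphism [g] from the spectrum of [A] need not land in [W0]; it does so on some D(a0) around
   the point over [y], which is why the chart is shrunk to D(e0). *)
have oW0 : spec_open (g @^-1` oset W0) := open_preim g W0.
have [a0 [pa0 a0W]] := oW0 (m p) (gmW p).
pose e0 := iota a0.
(* Pulled back by [g] to D(a0), [t] becomes a fraction over [A]; pulling back further by [m] returns
   [t] itself. *)
have fracA (t : sect W0) : exists N0 a, e0 ^+ N0 * t = iota a.
  have h1 : oset (spec_basic a0) `<=` g @^-1` oset W0 by exact: a0W.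
  have [//|n [a e]] := @spec_frac A (spec_basic a0) a0 (pull g h1 t).
  have h2 := @preim_sub _ _ m (spec_basic a0).
  have := congr1 (pull m h2) e; rewrite rmorphM rmorphXn !mc gm -rmorphXn -rmorphM.
  move=> /eqP; rewrite -subr_eq0 -rmorphB => /eqP.
  move=> /(@spec_zero (sect W0) _ e0) [q /(mu q)|M eM]; first by [].
  exists (M + n)%N, (a0 ^+ M * a).
  apply/eqP; rewrite rmorphM rmorphXn -subr_eq0 exprD -mulrA -mulrBr; apply/eqP; exact: eM.
have e0y : unit_at e0 y by apply/pu/mu.
pose W := basic e0; have WW0 : W <=o W0 by exact: basic_sub.
have [v ev] : exists v, res WW0 e0 * v = 1.
  by apply: unit_glue => x Wx; apply/unit_at_res.
have fracW (t : sect W) : exists N0 a, res WW0 e0 ^+ N0 * t = res WW0 (iota a).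
  have [n [s es]] := aff_frac affW0 WW0 t (@subset_refl _ _) (@subset_refl _ _).
  have [N0 [a ea]] := fracA s; exists (N0 + n)%N, a.
  by rewrite exprD -mulrA es -rmorphXn -rmorphM ea.
have [c' c'E] := chart_restrict c (affine_basic e0 affW0) WW0.
exists U, W, c'; split=> //.
- exact: subset_trans WW0 W0N.
- apply: (noetherian_fractions (phi := res WW0 \o iota)) noethA => t.
  have [N0 [a ea]] := fracW t.
  by exists a, (res WW0 e0 ^+ N0), (v ^+ N0); split=> //; exact: invX.
- move=> P PD PM Pb Pu Pdiv.
  have Piota a : P (res WW0 (iota a)).
    apply: (minA [set s | P (res WW0 s)]) => /= [s t|s t|s|].
    - by rewrite rmorphD; exact: PD.
    - by rewrite rmorphM; exact: PM.
    - have := Pb s; rewrite pull_resl; congr P; exact: pull_irr.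
    - move=> _ /mapP [s sl ->]; apply: (Pu s); rewrite c'E -/f.
      have := uP s (chart_gens_ideal sl) => /(congr1 (res WW0)).
      by rewrite rmorphM !pull_resl => e; rewrite !(pull_irr _ (subset_trans WW0 hW0)).
  move=> t; have [N0 [a ea]] := fracW t.
  apply: (Pdiv (res WW0 (iota (a0 ^+ N0))) (v ^+ N0)) => //.
    by rewrite !rmorphXn invX.
  by rewrite !rmorphXn ea; exact: Piota.
Qed.

End BlowupLift.

(** * Lifting derivations *)

Section DualNumbers.
Variable A : comPzRingType.

Definition dual := (A * A)%type.
HB.instance Definition _ := GRing.Zmodule.copy dual (A * A)%type.

Definition dual_one : dual := (1, 0).
Definition dual_mul (x y : dual) : dual := (x.1 * y.1, x.1 * y.2 + y.1 * x.2).

Lemma dual_mulA : associative dual_mul.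
Proof. by move=> [a b] [c d] [e f]; rewrite /dual_mul /=; congr (_, _); ring. Qed.
Lemma dual_mulC : commutative dual_mul.
Proof. by move=> [a b] [c d]; rewrite /dual_mul /=; congr (_, _); ring. Qed.
Lemma dual_mul1 : left_id dual_one dual_mul.
Proof. by move=> [a b]; rewrite /dual_mul /=; congr (_, _); ring. Qed.
Lemma dual_mulDl : left_distributive dual_mul +%R.
Proof. by move=> [a b] [c d] [e f]; rewrite /dual_mul /=; congr (_, _); rewrite /=; ring. Qed.

HB.instance Definition _ :=
  GRing.Zmodule_isComPzRing.Build dual dual_mulA dual_mulC dual_mul1 dual_mulDl.

Lemma dualD (a b c d : A) : ((a, b) : dual) + (c, d) = (a + c, b + d). Proof. by []. Qed.
Lemma dualM (a b c d : A) : ((a, b) : dual) * (c, d) = (a * c, a * d + c * b).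
Proof. by []. Qed.

Lemma dual_fst : exists e : {rmorphism dual -> A}, e =1 fst.
Proof. by apply: exists_rmorphism; [move=> [? ?] [? ?]|move=> [? ?] [? ?]|]. Qed.

Lemma dual_derivation (R : comPzRingType) (phi : {rmorphism R -> A}) (d : R -> A) :
  {morph d : s t / s + t} -> (forall s t, d (s * t) = phi s * d t + phi t * d s) ->
  exists psi : {rmorphism R -> dual}, psi =1 (fun s => (phi s, d s)).
Proof.
move=> dD dM; apply: exists_rmorphism => [s t|s t|].
- by rewrite rmorphD dD.
- by rewrite rmorphM dM.
- rewrite rmorph1; congr (_, _).
  by apply: (addrI (d 1)); rewrite addr0 -[in RHS](mulr1 1) dM rmorph1 !mul1r.
Qed.

Lemma derivation_of_dual (R : comPzRingType) (psi : {rmorphism R -> dual}) :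
  (forall s t, (psi (s + t)).2 = (psi s).2 + (psi t).2) /\
  (forall s t, (psi (s * t)).2 = (psi s).1 * (psi t).2 + (psi t).1 * (psi s).2).
Proof. by split=> s t; rewrite ?rmorphD ?rmorphM. Qed.

End DualNumbers.

Section ChartDerivation.
Variables (Z X : scheme) (i : morphism Z X) (B : scheme) (b : morphism B X).
Hypotheses (ci : closed_immersion i) (blow : is_blowup i b).

(** The derivation [d] is a morphism from the first-order thickening of [W] to [X];
    invariance makes the preimage of [Z] in this thickening a Cartier divisor. *)
Lemma chart_derivation (U : opens X) (W : opens B) (c : chart i b U W) (d : sect U -> sect U) :
  ring_derivation d -> (forall s, ideal_sheaf i s -> ideal_sheaf i (d s)) ->
  exists e : sect W -> sect W, ring_derivation e /\
    forall s, e (pull b (chart_sub c) s) = pull b (chart_sub c) (d s).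
Proof.
move=> derd Id; set hW := chart_sub c; set f := chart_eq c.
have regW r : pull b hW f * r = 0 -> r = 0.
  by move=> e; apply: (chart_reg (c := c) (k := @subset_refl _ _)); rewrite res_id.
have [e eE] := dual_fst (sect W).
have [||psi psiE] := @dual_derivation (sect W) (sect U) (pull b hW) (fun s => pull b hW (d s)).
- by move=> s t; rewrite (rderD derd) rmorphD.
- by move=> s t; rewrite (rderM derd) rmorphD !rmorphM.
have epsi s : e (psi s) = pull b hW s by rewrite eE psiE.
have If := chart_eq_ideal c.
have [u uP] := chart_div c (Id _ If).
have [||g [m [gb mc gm mu [_ gmW gmy]]]] :=
  blowup_lift ci blow (hW := hW) (psi := psi) (e := e) (f := f) (chart_affU c) (chart_affW c)
    epsi If _ regW.
- move=> [r r']; rewrite psiE dualM => -[/regW -> ].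
  by rewrite mul0r addr0 => /regW ->.
- move=> s Is; have [w wP] := chart_div c Is; have [w' w'P] := chart_div c (Id _ Is).
  (* The quotient of [psi s] by [psi f] in the dual numbers, the derivative of [f] being [u] times
     [f] after pullback. Invariance of [Z] provides [u] and [w']. *)
  exists (w, w' - u * w); rewrite !psiE dualM /= wP w'P uP.
  by congr (_, _); ring.
(* Every prime of the dual numbers contains the element of square zero, hence comes from a prime of
   [sect W] through [m]; so [g] maps the whole thickening into [W]. *)
have gW : oset (otop (Spec (dual (sect W)))) `<=` g @^-1` oset W.
  move=> q _; suff [p ->] : exists p, q = m p by exact: gmW.
  case: q => Q primeQ; have [Q0 QD QM Q1 QP] := primeQ.
  have Q2 (a : sect W) : Q (0, a) by
    have [] := QP ((0, a) : dual _) ((0, a) : dual _); rewrite ?dualM ?mul0r ?addr0.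
  have primeP : prime_ideal [set a : sect W | Q (a, 0)].
    split=> //=.
    - by move=> s t Qs /(QD _ _ Qs); rewrite dualD addr0.
    - by move=> s t /(QM ((s, 0) : dual _)); rewrite dualM !mulr0 addr0.
    - by move=> s t Qst; apply: QP; rewrite dualM !mulr0 addr0.
  exists (exist _ _ primeP); apply: spec_eq; apply/seteqP; split=> -[a a'] /= Qa.
    apply: contrapT => /mu; rewrite eE; apply => /=.
    have := QD _ _ Qa (Q2 (- a')).
    by rewrite dualD addr0 subrr.
  apply: contrapT => nQ.
  have /mu : avoids (m (exist _ _ primeP)) ((a, a') : dual _).
    apply/mu; rewrite eE /avoids /= => Qa0; apply: nQ.
    by have := QD _ _ Qa0 (Q2 a'); rewrite dualD addr0 add0r.
  by move/mu; apply.
have [chif chifP] := choice (@spec_const_surj (dual (sect W))).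
have chiP t : pull g gW t = spec_const (otop _) (chif (pull g gW t)) by exact: chifP.
have [|||chi chiE] := @exists_rmorphism (sect W) (dual (sect W)) (fun t => chif (pull g gW t)).
- by move=> s t; apply: spec_const_inj; rewrite [RHS]rmorphD -!chiP rmorphD.
- by move=> s t; apply: spec_const_inj; rewrite [RHS]rmorphM -!chiP rmorphM.
- by apply: spec_const_inj; rewrite -chiP !rmorph1.
(* Reduction of the thickening recovers the inclusion of [W], so [chi] is the identity plus a
   first-order part, which is the derivation sought. *)
have chi1 t : (chi t).1 = t.
  have := gm _ (otop _) gW (fun x _ => I) t; rewrite chiP -chiE mc eE.
  exact: spec_const_inj.
have [chiD chiM] := derivation_of_dual chi.
exists (fun t => (chi t).2); split; first by split=> // s t; rewrite chiM !chi1.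
move=> s; have -> : chi (pull b hW s) = psi s; last by rewrite psiE.
by apply: spec_const_inj; rewrite chiE -chiP gb.
Qed.

End ChartDerivation.

(** * First-order thickenings and extension of derivations *)

Section Thickening.
Variable Y : ringedSpace.
Implicit Types U V W : opens Y.

Section ThickRes.
Variables (U V : opens Y) (h : V <=o U).

Definition thick_res (s : dual (sect U)) : dual (sect V) := (res h s.1, res h s.2).

Lemma thick_resD : {morph thick_res : s t / s + t}.
Proof. by move=> [a b] [c d]; rewrite /thick_res dualD /= !rmorphD. Qed.
Lemma thick_resM : monoid_morphism thick_res.
Proof.
split=> [|[a b] [c d]]; first by rewrite /thick_res /= rmorph1 rmorph0.
by rewrite /thick_res dualM /= rmorphD !rmorphM.
Qed.
HB.instance Definition _ :=
  GRing.isZmodMorphism.Build _ _ thick_res (additive_zmod_morphism thick_resD).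
HB.instance Definition _ := GRing.isMonoidMorphism.Build _ _ thick_res thick_resM.

End ThickRes.

Lemma thick_sheaf : is_sheaf (fun U V h => @thick_res U V h).
Proof.
split.
  split=> [U h [a b]|U V W h h' h'' [a b]]; rewrite /thick_res /=.
    by rewrite !res_id.
  by rewrite !resE !(res_irr _ h'').
move=> I U V hV cov s compat.
have [_ gl] := res_sheaf Y.
have [|a [aP au]] := gl I U V hV cov (fun j => (s j).1).
  by move=> j k W hj hk; have /(congr1 fst) := compat j k W hj hk.
have [|b [bP bu]] := gl I U V hV cov (fun j => (s j).2).
  by move=> j k W hj hk; have /(congr1 snd) := compat j k W hj hk.
exists (a, b); split=> [j|[a' b'] abP].
  by rewrite /thick_res /= aP bP; case: (s j).
congr (_, _); first by apply: au => j; have /(congr1 fst) := abP j.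
by apply: bu => j; have /(congr1 snd) := abP j.
Qed.

Definition thickening : ringedSpace :=
  @RingedSpace Y (fun U => dual (sect U) : comPzRingType)
    (fun U V h => thick_res h : {rmorphism dual (sect U) -> dual (sect V)}) thick_sheaf.

End Thickening.

Section DerivationExtension.
Variables (k : fieldType) (Y : ringedSpace) (c : {rmorphism k -> sect (otop Y)}).

(** A derivation is the first-order part of a ring morphism to the dual numbers, so it extends to
    all open subsets by [sheaf_extension] applied to the thickening. *)
Lemma derivation_extend (U : opens Y) (d : sect U -> sect U) : affine U -> ring_derivation d ->
  (forall a, d (res (@sub_otop _ U) (c a)) = 0) ->
  exists D : derivation c U, forall V (h : V <=o U) s, der D h (res h s) = res h (d s).
Proof.
move=> affU derd dc.
have [phi phiE] := @dual_derivation (sect U) (sect U) idfun d (rderD derd) (rderM derd).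
have [|P [_ Pres Pphi]] :=
    @sheaf_extension Y (thickening Y) U U id (phi : {rmorphism sect U -> @sect (thickening Y) U}) affU.
  move=> f x Ux [V [h [Vx [t ft]]]]; exists V, h; split=> //.
  (* The inverse in the dual numbers: reciprocal and derivative of the reciprocal. *)
  exists (t, - (t * t * res h (d f))).
  have -> : res (r := thickening Y) h (phi f) = (res h f, res h (d f)) by rewrite phiE.
  rewrite [LHS]dualM ft; congr (_, _).
  transitivity (t * res h (d f) * (1 - res h f * t)); first by ring.
  by rewrite ft subrr mulr0.
pose Q V (h : V <=o U) (s : sect V) : dual (sect V) := P V h V h (fun x Vx => Vx) s.
have QD V (h : V <=o U) s t : Q V h (s + t) = Q V h s + Q V h t by rewrite /Q rmorphD.
have QM V (h : V <=o U) s t : Q V h (s * t) = Q V h s * Q V h t by rewrite /Q rmorphM.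
have Qphi V (h : V <=o U) s : Q V h (res h s) = (res h s, res h (d s)).
  by rewrite /Q Pphi phiE.
have Qres V W (hV : V <=o U) (hW : W <=o U) (h : W <=o V) s :
    (res h (Q V hV s).1, res h (Q V hV s).2) = Q W hW (res h s).
  exact: (Pres V hV W hW V hV W hW (fun x Vx => Vx) (fun x Vx => Vx) h h s).
(* The zeroth-order part of the extension is still the identity, as one checks on fractions; only
   then is the first-order part a derivation. *)
have Q1 V (h : V <=o U) s : (Q V h s).1 = s.
  apply: sect_sep => x Vx.
  have [f [hf [n [s' [fx e]]]]] := aff_local_frac affU h s Vx.
  exists _, hf; split=> //; have bU := basic_sub (f := f); rewrite !(res_irr _ bU) in e.
  have [v fv] := basic_inv f.
  have E := Qres V (basic f) h bU hf s; have /= -> := congr1 fst E.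
  have := congr1 (fun z => (Q (basic f) bU z).1) e; rewrite (res_irr _ bU) in fv.
  rewrite -rmorphXn QM !Qphi /= rmorphXn => e'.
  by apply: (mulr_can (invX n fv)); rewrite e' -e.
have derD' V (h : V <=o U) : {morph (fun s => (Q V h s).2) : s t / s + t}.
  by move=> s t; rewrite QD.
have derM' V (h : V <=o U) s t :
    (Q V h (s * t)).2 = s * (Q V h t).2 + t * (Q V h s).2.
  rewrite QM.
  by transitivity ((Q V h s).1 * (Q V h t).2 + (Q V h t).1 * (Q V h s).2); last rewrite !Q1.
have derC' V (h : V <=o U) a : (Q V h (res (@sub_otop _ V) (c a))).2 = 0.
  by rewrite -(res_res (@sub_otop _ U) h) Qphi /= dc rmorph0.
have der_res' V W (hV : V <=o U) (hW : W <=o U) (h : W <=o V) s :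
    res h (Q V hV s).2 = (Q W hW (res h s)).2.
  by rewrite -(Qres V W hV hW h s).
exists (Derivation derD' derM' derC' der_res') => V h s /=.
by rewrite Qphi.
Qed.

Lemma der_irr (U V : opens Y) (D : derivation c U) (h h' : V <=o U) s : der D h s = der D h' s.
Proof. by congr (der D _ s); exact: Prop_irrelevance. Qed.

Lemma ring_derivation_der (U V : opens Y) (D : derivation c U) (h : V <=o U) :
  ring_derivation (der D h).
Proof. by split; [exact: derD | exact: derM]. Qed.

End DerivationExtension.

(** The quotient rule with denominators cleared; it carries every property of a derivation from an
    affine ring to its fractions. *)
Lemma rder_fraction (A : comPzRingType) (d : A -> A) (f s t : A) n :
  ring_derivation d -> f ^+ n * s = t ->
  f ^+ n.+1 * d s = f * d t - n%:R * d f * t.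
Proof.
move=> derd <-; rewrite (rderM derd); case: n => [|n].
  by rewrite expr0 (rder1 derd) expr1; ring.
by rewrite (rderX derd) !exprS; ring.
Qed.

Lemma lifts_of_generators (k : fieldType) (T X : scheme) (p : morphism T X)
    (cT : {rmorphism k -> sect (otop T)}) (cX : {rmorphism k -> sect (otop X)})
    (U : opens X) (W : opens T) (h : oset W `<=` p @^-1` oset U) (D : derivation cX U)
    (D' : derivation cT W) : affine U ->
  (forall s : sect U, der D' (@subset_refl _ (oset W)) (pull p h s) =
     pull p h (der D (@subset_refl _ (oset U)) s)) -> lifts p D D'.
Proof.
move=> affU gen V V' hV hV' hp s; apply: sect_sep => x V'x.
have [f [hf [n [s' [fx e]]]]] := aff_local_frac affU hV s (hp _ V'x).
have bU := basic_sub (f := f); rewrite !(res_irr _ bU) in e.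
have k1 : omeet V' (preim p (basic f)) <=o V' by exact: omeetl.
have kp : oset (omeet V' (preim p (basic f))) `<=` p @^-1` oset (basic f) by exact: omeetr.
exists _, k1; split=> //; have k2 := subset_trans k1 hV'.
have [v] := basic_inv f; rewrite (res_irr _ bU) => fv.
have pfv : pull p kp (res bU f) * pull p kp v = 1 by rewrite -rmorphM fv rmorph1.
apply: (mulr_can (invX n.+1 pfv)).
rewrite (der_res D' _ k2) !pull_resl -(pull_resr _ kp hf) -(pull_resr _ kp hf).
rewrite (der_res D hV bU).
have gen' (r : sect U) : der D' k2 (pull p kp (res bU r)) =
    pull p kp (res bU (der D (@subset_refl _ (oset U)) r)).
  rewrite !(pull_resr (subset_trans k2 h)) -!(pull_resl h k2) -gen.
  by rewrite (der_res D' _ k2).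
have dU r : res bU (der D (@subset_refl _ (oset U)) r) = der D bU (res bU r).
  exact: der_res.
have E1 : pull p kp (res bU f) ^+ n * pull p kp (res hf s) = pull p kp (res bU s').
  by rewrite -rmorphXn -rmorphM e.
rewrite (rder_fraction (ring_derivation_der D' k2) E1) !gen'.
have := rder_fraction (ring_derivation_der D bU) e.
rewrite -!dU => /(congr1 (pull p kp)); rewrite rmorphM rmorphXn => ->.
by rewrite rmorphB !rmorphM rmorph_nat.
Qed.

(** * Pullback of a module with a basis *)

Section OModules.
Variables (X : ringedSpace) (E : omodule X).
Implicit Types U V W : opens X.

Lemma mres_id U (h : U <=o U) (m : msect E U) : mres h m = m.
Proof. exact: (mres_sheaf E).1.1. Qed.

Lemma mres_mres U V W (h : V <=o U) (h' : W <=o V) (h'' : W <=o U) (m : msect E U) :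
  mres h' (mres h m) = mres h'' m.
Proof. exact: (mres_sheaf E).1.2. Qed.

Lemma mres_irr U V (h h' : V <=o U) (m : msect E U) : mres h m = mres h' m.
Proof. by congr (mres _ _); exact: Prop_irrelevance. Qed.

Lemma mres0 U V (h : V <=o U) : mres h (0 : msect E U) = 0.
Proof. by apply: (addrI (mres h 0)); rewrite -mresD !addr0. Qed.

Lemma mres_sum U V (h : V <=o U) (I : finType) (F : I -> msect E U) :
  mres h (\sum_i F i) = \sum_i mres h (F i).
Proof. exact: (big_morph _ (@mresD _ _ _ _ h) (mres0 h)). Qed.

Lemma msect_sep U (m m' : msect E U) :
  (forall x, oset U x -> exists V (h : V <=o U), oset V x /\ mres h m = mres h m') -> m = m'.
Proof. exact: (sheaf_sep (mres_sheaf E)). Qed.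

Definition is_basis U n (b : 'I_n -> msect E U) := forall V (h : V <=o U) (m : msect E V),
  exists! c : 'I_n -> sect V, m = \sum_(j < n) c j *: mres h (b j).

End OModules.

Section OmodMorphisms.
Variables (X : ringedSpace) (E F : omodule X) (phi : omod_mor E F).

Lemma omod_morP U a (m m' : msect E U) : phi U (a *: m + m') = a *: phi U m + phi U m'.
Proof. exact: omod_mor_linear. Qed.

Lemma omod_mor0 U : phi U 0 = 0.
Proof.
have := omod_morP 1 (0 : msect E U) 0; rewrite !scale1r addr0 => e.
by apply: (addrI (phi U 0)); rewrite addr0 -e.
Qed.

Lemma omod_morD U (m m' : msect E U) : phi U (m + m') = phi U m + phi U m'.
Proof. by rewrite -[m]scale1r omod_morP !scale1r. Qed.

Lemma omod_morZ U a (m : msect E U) : phi U (a *: m) = a *: phi U m.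
Proof. by rewrite -[a *: m]addr0 omod_morP omod_mor0 addr0. Qed.

Lemma omod_morB U (m m' : msect E U) : phi U (m - m') = phi U m - phi U m'.
Proof. by rewrite -[- m']scaleN1r omod_morD omod_morZ scaleN1r. Qed.

Lemma omod_mor_sum U (I : finType) (m : I -> msect E U) :
  phi U (\sum_i m i) = \sum_i phi U (m i).
Proof. exact: (big_morph _ (@omod_morD U) (omod_mor0 U)). Qed.

End OmodMorphisms.

Section FreeModule.
Variables (X : ringedSpace) (n : nat).
Implicit Types U V W : opens X.

Definition row_res U V (h : V <=o U) (r : 'rV[sect U]_n) : 'rV[sect V]_n := map_mx (res h) r.

Lemma row_resD U V (h : V <=o U) : {morph row_res h : r s / r + s}.
Proof. by move=> r s; apply/rowP => j; rewrite !mxE rmorphD. Qed.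

Lemma row_resZ U V (h : V <=o U) (a : sect U) (r : 'rV[sect U]_n) :
  row_res h (a *: r) = res h a *: row_res h r.
Proof. by apply/rowP => j; rewrite !mxE rmorphM. Qed.

Lemma row_sheaf : is_sheaf (fun U V h => row_res h : 'rV[sect U]_n -> 'rV[sect V]_n).
Proof.
split.
  split=> [U h r|U V W h h' h'' r]; apply/rowP => j; rewrite !mxE; first exact: res_id.
  exact: res_res.
move=> I U V hV cov s compat; have [_ gl] := res_sheaf X.
have /choice [t tP] j : exists t : sect U, (forall i, res (hV i) t = s i 0 j) /\
    forall t', (forall i, res (hV i) t' = s i 0 j) -> t = t'.
  have [|t [tP tu]] := gl I U V hV cov (fun i => s i 0 j); last by exists t.
  by move=> i i' W hi hi'; have /rowP /(_ j) := compat i i' W hi hi'; rewrite !mxE.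
exists (\row_j t j); split=> [i|r rP]; apply/rowP => j; rewrite !mxE; first exact: (tP j).1.
by apply: (tP j).2 => i; have /rowP /(_ j) := rP i; rewrite !mxE.
Qed.

Definition free_module : omodule X :=
  @OModule X (fun U => 'rV[sect U]_n : lmodType (sect U)) row_res row_resD row_resZ row_sheaf.

End FreeModule.

Section ExtendedRestriction.
Variables (X : ringedSpace) (W0 : opens X) (E : omodule X).
Implicit Types U V W : opens X.

(** Sections of the direct image of the restriction of [E] to [W0]. *)
Definition xr_sect U := (msect E (omeet U W0) : Type).
HB.instance Definition _ U := GRing.Zmodule.copy (xr_sect U) (msect E (omeet U W0)).

Definition xr_scale U (a : sect U) (m : xr_sect U) : xr_sect U :=
  res (omeetl U W0) a *: (m : msect E (omeet U W0)).

Lemma xr_scaleA U (a b : sect U) (m : xr_sect U) :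
  xr_scale a (xr_scale b m) = xr_scale (a * b) m.
Proof. by rewrite /xr_scale scalerA rmorphM. Qed.
Lemma xr_scale1 U : left_id 1 (@xr_scale U).
Proof. by move=> m; rewrite /xr_scale rmorph1 scale1r. Qed.
Lemma xr_scaleDr U : right_distributive (@xr_scale U) +%R.
Proof. by move=> a m m'; exact: scalerDr. Qed.
Lemma xr_scaleDl U (m : xr_sect U) : {morph (@xr_scale U)^~ m : a b / a + b}.
Proof. by move=> a b; rewrite /xr_scale rmorphD; exact: scalerDl. Qed.

HB.instance Definition _ U := GRing.Zmodule_isLmodule.Build (sect U) (xr_sect U)
  (@xr_scaleA U) (@xr_scale1 U) (@xr_scaleDr U) (@xr_scaleDl U).

Lemma omeet_sub U V : V <=o U -> omeet V W0 <=o omeet U W0.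
Proof. by move=> h x [/h]. Qed.

Definition xr_res U V (h : V <=o U) (m : xr_sect U) : xr_sect V := mres (omeet_sub h) m.

Lemma xr_resD U V (h : V <=o U) : {morph xr_res h : m m' / m + m'}.
Proof. by move=> m m'; exact: mresD. Qed.

Lemma xr_resZ U V (h : V <=o U) (a : sect U) (m : xr_sect U) :
  xr_res h (a *: m) = res h a *: xr_res h m.
Proof.
transitivity (mres (omeet_sub h) (res (omeetl U W0) a *: (m : msect E (omeet U W0)))).
  by [].
transitivity (res (omeetl V W0) (res h a) *: mres (omeet_sub h) m); last by [].
have e : res (omeet_sub h) (res (omeetl U W0) a) = res (omeetl V W0) (res h a).
  by rewrite !resE; exact: res_irr.
by rewrite mresZ e.
Qed.

Lemma xr_sheaf : is_sheaf (fun U V h => xr_res h : xr_sect U -> xr_sect V).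
Proof.
split.
  split=> [U h m|U V W h h' h'' m]; first exact: mres_id.
  exact: mres_mres.
move=> I U V hV cov s compat; have [_ gl] := mres_sheaf E.
apply: (gl I (omeet U W0) (fun i => omeet (V i) W0) (fun i => omeet_sub (hV i)) _ s).
  by move=> x [/cov [i _ Vx] W0x]; exists i.
move=> i j W hi hj.
have ki : W <=o V i by move=> x /hi [].
have kj : W <=o V j by move=> x /hj [].
have kk : W <=o omeet W W0 by move=> x Wx; split=> //; have [] := hi x Wx.
have := congr1 (mres kk) (compat i j W ki kj); rewrite /xr_res.
by rewrite !(mres_mres _ _ (subset_trans kk (omeet_sub _))) !(mres_irr _ hi) !(mres_irr _ hj).
Qed.

(** The universal property of the pullback tests against modules on the whole space, while a basis
    exists only over an open set; restricting and pushing forward again reconciles the two. *)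
Definition extended_restriction : omodule X :=
  @OModule X (fun U => xr_sect U : lmodType (sect U)) xr_res xr_resD xr_resZ xr_sheaf.

End ExtendedRestriction.

Section PullbackBasis.
Variables (T X : scheme) (f : morphism T X) (E : omodule X) (M : omodule T).
Variable eta : mod_over f E M.
Hypothesis pbk : is_pullback eta.
Variables (V : opens X) (n : nat) (b : 'I_n -> msect E V).
Hypothesis basis : is_basis b.

Let W0 := preim f V.

Lemma coordinates_ex (V' : opens X) (m : msect E V') : exists c : 'I_n -> sect (omeet V' V),
  mres (omeetl V' V) m = \sum_(j < n) c j *: mres (omeetr V' V) (b j).
Proof. by have [c []] := basis (omeetr V' V) (mres (omeetl V' V) m); exists c. Qed.

Let co (V' : opens X) (m : msect E V') := projT1 (cid (coordinates_ex m)).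

Let coP (V' : opens X) (m : msect E V') :
  mres (omeetl V' V) m = \sum_(j < n) co m j *: mres (omeetr V' V) (b j).
Proof. exact: projT2 (cid (coordinates_ex m)). Qed.

Lemma basis_coord_uniq (V' : opens X) (h : V' <=o V) (c c' : 'I_n -> sect V') :
  \sum_(j < n) c j *: mres h (b j) = \sum_(j < n) c' j *: mres h (b j) -> c = c'.
Proof.
by move=> e; have [d [_ du]] := basis h (\sum_(j < n) c j *: mres h (b j));
  rewrite -(du c) // (du c').
Qed.

Let coD (V' : opens X) (m m' : msect E V') : co (m + m') = (fun j => co m j + co m' j).
Proof.
apply: (basis_coord_uniq (h := omeetr V' V)); rewrite -coP mresD !coP -big_split.
by apply: eq_bigr => j _; rewrite scalerDl.
Qed.

Let coZ (V' : opens X) a (m : msect E V') : co (a *: m) = (fun j => res (omeetl V' V) a * co m j).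
Proof.
apply: (basis_coord_uniq (h := omeetr V' V)); rewrite -coP mresZ !coP scaler_sumr.
by apply: eq_bigr => j _; rewrite scalerA.
Qed.

Let co_res (V' V'' : opens X) (h : V'' <=o V') (k : omeet V'' V <=o omeet V' V) (m : msect E V') :
  co (mres h m) = (fun j => res k (co m j)).
Proof.
apply: (basis_coord_uniq (h := omeetr V'' V)).
rewrite -coP (mres_mres _ _ (subset_trans (omeetl V'' V) h)).
rewrite -(mres_mres (omeetl V' V) k) coP mres_sum; apply: eq_bigr => j _.
by rewrite mresZ (mres_mres _ _ (omeetr V'' V)).
Qed.

Let co_basis j : co (b j) = (fun l => (l == j)%:R).
Proof.
apply: (basis_coord_uniq (h := omeetr V V)); rewrite -coP (bigD1 j) //= eqxx scale1r.
rewrite big1 ?addr0 => [|l /negPf ->]; last by rewrite scale0r.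
exact: mres_irr.
Qed.

Let sub1 (V' : opens X) (W : opens T) (h : oset W `<=` f @^-1` oset V') :
  oset (omeet W W0) `<=` f @^-1` oset (omeet V' V).
Proof. by move=> x [/h]. Qed.

(** Coordinates in the basis map [E] to the free module extended from [W0]; the induced morphism on
    [M] provides the coordinate functions [coef]. *)
Let gamma1_fun (V' : opens X) (W : opens T) (h : oset W `<=` f @^-1` oset V') (m : msect E V') :
  msect (extended_restriction W0 (free_module T n)) W := \row_j pull f (sub1 h) (co m j).

Lemma gamma1_add V' W (h : oset W `<=` f @^-1` oset V') :
  {morph gamma1_fun h : m m' / m + m'}.
Proof. by move=> m m'; apply/rowP => j; rewrite !mxE coD rmorphD. Qed.

Lemma gamma1_scale V' W (h : oset W `<=` f @^-1` oset V') (a : sect V') (m : msect E V') :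
  gamma1_fun h (a *: m) = pull f h a *: gamma1_fun h m.
Proof.
apply/rowP => j; rewrite !mxE coZ rmorphM; congr (_ * _).
by rewrite pull_resl (pull_resr (subset_trans (omeetl W W0) h)).
Qed.

Lemma gamma1_res (V' V'' : opens X) (W W' : opens T)
  (h : oset W `<=` f @^-1` oset V') (h' : oset W' `<=` f @^-1` oset V'')
  (hV : V'' <=o V') (hW : W' <=o W) (m : msect E V') :
  mres hW (gamma1_fun h m) = gamma1_fun h' (mres hV m).
Proof.
have k : omeet V'' V <=o omeet V' V by move=> x [/hV].
by apply/rowP => j; rewrite !mxE (co_res hV k); exact: pull_res.
Qed.

Let gamma1 : mod_over f E (extended_restriction W0 (free_module T n)) :=
  ModOver gamma1_add gamma1_scale gamma1_res.

Let phi : omod_mor M (extended_restriction W0 (free_module T n)) := projT1 (cid (pbk gamma1)).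

Let phi_eta V' W (h : oset W `<=` f @^-1` oset V') (m : msect E V') :
  phi W (mo_fun eta h m) = gamma1_fun h m.
Proof. exact: (projT2 (cid (pbk gamma1))).1. Qed.

Let coef W (m : msect M W) (j : 'I_n) : sect (omeet W W0) :=
  (phi W m : 'rV[sect (omeet W W0)]_n) 0 j.

Lemma coef_linear W a (m m' : msect M W) j :
  coef (a *: m + m') j = res (omeetl W W0) a * coef m j + coef m' j.
Proof. by rewrite /coef omod_morP !mxE. Qed.

Let etab W (k : W <=o W0) j := mo_fun eta (k : oset W `<=` f @^-1` oset V) (b j).

Lemma coef_res W W' (h : W' <=o W) (m : msect M W) j :
  coef (mres h m) j = res (omeet_sub h) (coef m j).
Proof. by rewrite /coef -omod_mor_res mxE. Qed.

Let gamma2_fun (V' : opens X) (W : opens T) (h : oset W `<=` f @^-1` oset V') (m : msect E V') :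
  msect (extended_restriction W0 M) W := mres (omeetl W W0) (mo_fun eta h m).

Lemma gamma2_add V' W (h : oset W `<=` f @^-1` oset V') :
  {morph gamma2_fun h : m m' / m + m'}.
Proof. by move=> m m'; rewrite /gamma2_fun mo_add; exact: (mresD (omeetl W W0)). Qed.

Lemma gamma2_scale V' W (h : oset W `<=` f @^-1` oset V') (a : sect V') (m : msect E V') :
  gamma2_fun h (a *: m) = pull f h a *: gamma2_fun h m.
Proof. by rewrite /gamma2_fun mo_scale; exact: (mresZ (omeetl W W0)). Qed.

Lemma gamma2_res (V' V'' : opens X) (W W' : opens T)
  (h : oset W `<=` f @^-1` oset V') (h' : oset W' `<=` f @^-1` oset V'')
  (hV : V'' <=o V') (hW : W' <=o W) (m : msect E V') :
  mres hW (gamma2_fun h m) = gamma2_fun h' (mres hV m).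
Proof.
rewrite /gamma2_fun -(mo_res _ h h' hV hW) (mres_mres _ _ (subset_trans (omeetl W' W0) hW)).
exact: (mres_mres (omeetl W W0) (omeet_sub hW)).
Qed.

Let gamma2 : mod_over f E (extended_restriction W0 M) :=
  ModOver gamma2_add gamma2_scale gamma2_res.

Let rho_fun W (m : msect M W) : msect (extended_restriction W0 M) W := mres (omeetl W W0) m.

Lemma rho_linear W : linear (@rho_fun W).
Proof. by move=> a m m'; rewrite /rho_fun mresD mresZ. Qed.

Lemma rho_res U W (h : W <=o U) (m : msect M U) : mres h (rho_fun m) = rho_fun (mres h m).
Proof.
rewrite /rho_fun [RHS](mres_mres _ _ (subset_trans (omeetl W W0) h)).
exact: (mres_mres (omeetl U W0) (omeet_sub h)).
Qed.

Let rho := OmodMor rho_linear rho_res.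

Let sigma_fun W (m : msect M W) : msect (extended_restriction W0 M) W :=
  \sum_(j < n) coef m j *: etab (omeetr W W0) j.

Lemma sigma_linear W : linear (@sigma_fun W).
Proof.
move=> a m m'; rewrite /sigma_fun.
rewrite [RHS](_ : _ = res (omeetl W W0) a *: (\sum_(j < n) coef m j *: etab (omeetr W W0) j) +
  \sum_(j < n) coef m' j *: etab (omeetr W W0) j) // scaler_sumr -big_split.
by apply: eq_bigr => j _; rewrite coef_linear scalerDl scalerA.
Qed.

Lemma etab_res W W' (k : W <=o W0) (k' : W' <=o W0) (h : W' <=o W) j :
  mres h (etab k j) = etab k' j.
Proof.
by rewrite /etab (mo_res _ _ (k' : oset W' `<=` f @^-1` oset V) (@subset_refl _ (oset V))) mres_id.
Qed.

Lemma sigma_res U W (h : W <=o U) (m : msect M U) : mres h (sigma_fun m) = sigma_fun (mres h m).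
Proof.
transitivity (mres (omeet_sub h) (\sum_(j < n) coef m j *: etab (omeetr U W0) j)).
  by [].
rewrite mres_sum; apply: eq_bigr => j _.
by rewrite mresZ coef_res (etab_res _ (omeetr W W0)).
Qed.

Let sigma := OmodMor sigma_linear sigma_res.

(** Restriction to [W0], and expansion by means of [coef], are two morphisms from [M] to its
    extended restriction. They agree after composition with [eta], so the uniqueness part of the
    universal property makes them equal. *)
Lemma pullback_span W (m : msect M W) :
  mres (omeetl W W0) m = \sum_(j < n) coef m j *: etab (omeetr W W0) j.
Proof.
have [psi [_ psiu]] := pbk gamma2.
transitivity (psi W m).
  by rewrite -(psiu rho).
rewrite -(psiu sigma) // => V' W' h u.
rewrite /= /sigma_fun /gamma2_fun.
have k := sub1 h.
rewrite (mo_res eta h k (omeetl V' V) (omeetl W' W0)) coP.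
have mo_sum (F : 'I_n -> msect E (omeet V' V)) :
    mo_fun eta k (\sum_j F j) = \sum_j mo_fun eta k (F j).
  apply: (big_morph _ (mo_add eta k)); apply: (addrI (mo_fun eta k 0)).
  by rewrite -mo_add !addr0.
rewrite mo_sum; apply: eq_bigr => j _; rewrite mo_scale.
have -> : mo_fun eta k (mres (omeetr V' V) (b j)) = etab (omeetr W' W0) j.
  have k' : oset (omeet W' W0) `<=` f @^-1` oset V by exact: omeetr.
  rewrite -(mo_res eta k' k (omeetr V' V) (@subset_refl _ _)) mres_id.
  by congr (mo_fun eta _ _); exact: Prop_irrelevance.
by rewrite /coef phi_eta mxE (pull_irr _ k).
Qed.

(** Existence of coordinates is [pullback_span]; they are unique because [coef] takes Kronecker
    delta values on the proposed basis. *)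
Theorem pullback_basis (hV : oset (preim f V) `<=` f @^-1` oset V) :
  is_basis (fun j => mo_fun eta hV (b j)).
Proof.
move=> W k m; have kk : W <=o omeet W W0 by move=> x Wx; split=> //; exact: k.
have etabE j : mres k (mo_fun eta hV (b j)) = etab k j by exact: (etab_res _ k k).
exists (fun j => res kk (coef m j)); split.
  have := congr1 (mres kk) (pullback_span m).
  rewrite (mres_mres _ _ (@subset_refl _ _)) mres_id mres_sum => {1}->.
  by apply: eq_bigr => j _; rewrite mresZ (etab_res _ k) etabE.
move=> c ->; apply: funext => j.
have coefS (I : seq 'I_n) : coef (\sum_(l <- I) c l *: mres k (mo_fun eta hV (b l))) j =
    \sum_(l <- I) res (omeetl W W0) (c l) * coef (etab k l) j.
  elim: I => [|l I IH]; first by rewrite !big_nil /coef omod_mor0 mxE.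
  by rewrite !big_cons coef_linear IH etabE.
rewrite coefS rmorph_sum (bigD1 j) //= big1 ?addr0 => [|l lj].
  rewrite /coef /etab phi_eta mxE co_basis eqxx rmorph1 mulr1 resE.
  exact: res_id.
by rewrite /coef /etab phi_eta mxE co_basis eq_sym (negPf lj) !rmorph0 mulr0 rmorph0.
Qed.

End PullbackBasis.

(** * Derivations lifted to the normalised blowing up *)

Lemma fin_common_bound (I : finType) (P : I -> nat -> Prop) :
  (forall i n m, (n <= m)%N -> P i n -> P i m) -> (forall i, exists n, P i n) ->
  exists N, forall i, P i N.
Proof.
move=> mono /choice [n nP]; exists (\max_i n i)%N => i; apply: mono (nP i).
exact: leq_bigmax.
Qed.

Lemma aff_regular (X : ringedSpace) (U : opens X) (h : sect U) : affine U ->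
  (forall u, h * u = 0 -> u = 0) ->
  forall V (k : V <=o U) (u : sect V), res k h * u = 0 -> u = 0.
Proof.
move=> affU reg V k u e; apply: sect_sep => x Vx.
have [f [hf [n [s [fx es]]]]] := aff_local_frac affU k u Vx.
have bU := basic_sub (f := f); rewrite !(res_irr _ bU) in es.
have [v] := basic_inv f; rewrite (res_irr _ bU) => fv.
exists _, hf; split=> //; rewrite rmorph0; apply: (mulr_can (invX n fv)); rewrite mulr0 es.
have [|m] := aff_zero affU (h := bU) (f := f) (s := h * s) (@subset_refl _ _).
  rewrite rmorphM -es mulrCA; have := congr1 (res hf) e.
  by rewrite rmorphM rmorph0 resE (res_irr _ bU) => ->; rewrite mulr0.
rewrite mulrCA => /reg /(congr1 (res bU)); rewrite rmorphM rmorphXn rmorph0 => e'.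
by apply: (mulr_can (invX m fv)); rewrite e' mulr0.
Qed.

Lemma rder_fraction_eq0 (A : comPzRingType) (d : A -> A) (f v s t : A) n :
  ring_derivation d -> f * v = 1 -> f ^+ n * s = t -> d f = 0 -> d t = 0 -> d s = 0.
Proof.
move=> derd fv e df dt; apply: (mulr_can (invX n.+1 fv)).
by rewrite (rder_fraction derd e) df dt; ring.
Qed.

Section Derivations.
Variables (k : fieldType) (Y : ringedSpace) (c : {rmorphism k -> sect (otop Y)}).

Lemma der_sub (U : opens Y) (D E : derivation c U) V (h : V <=o U) s :
  der (D - E) h s = der D h s - der E h s.
Proof. by []. Qed.

Lemma der_sum (U : opens Y) (I : finType) (D : I -> derivation c U) V (h : V <=o U) s :
  der (\sum_i D i) h s = \sum_i der (D i) h s.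
Proof. by apply: (big_morph (fun D => der D h s)). Qed.

Lemma derivation_eq0_affine (U : opens Y) (D : derivation c U) : affine U ->
  (forall s, der D (@subset_refl _ (oset U)) s = 0) -> D = 0.
Proof.
move=> affU D0; apply: derivation_eq => V h s; rewrite [RHS](_ : _ = 0) //.
apply: sect_sep => x Vx; have [f [hf [n [s' [fx es]]]]] := aff_local_frac affU h s Vx.
have bU := basic_sub (f := f); rewrite !(res_irr _ bU) in es.
have [v] := basic_inv f; rewrite (res_irr _ bU) => fv.
have dU r : der D bU (res bU r) = 0.
  by rewrite -(der_res D (@subset_refl _ (oset U)) bU) D0 rmorph0.
exists _, hf; split=> //; rewrite rmorph0 (der_res D h bU).
exact: (rder_fraction_eq0 (ring_derivation_der D bU) fv es (dU _) (dU _)).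
Qed.

End Derivations.

Section Lifting.
Variables (k : fieldType) (hk : [pchar k] =i pred0).
Variables (X : scheme) (c : {rmorphism k -> sect (otop X)}) (hX : locally_noetherian X).
Variables (Z : scheme) (i : morphism Z X) (hi : closed_immersion i).
Variables (B : scheme) (b : morphism B X) (hb : is_blowup i b).
Variables (Xt : scheme) (nu : morphism Xt B) (hnu : is_normalisation nu).

Let p := comp_mor b nu.
Let cT := induced_base p c.

Lemma lifts_res (V V' : opens X) (W W' : opens Xt) (hV : V' <=o V) (hW : W' <=o W)
    (D : derivation c V) (E : derivation cT W) :
  lifts p D E -> lifts p (der_restrict hV D) (der_restrict hW E).
Proof. by move=> L V1 W1 k1 l1 h s /=; exact: L. Qed.

Lemma lifts_resr (V : opens X) (W W' : opens Xt) (hW : W' <=o W)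
    (D : derivation c V) (E : derivation cT W) :
  lifts p D E -> lifts p D (der_restrict hW E).
Proof. by move=> L V1 W1 k1 l1 h s /=; exact: L. Qed.

(** As [W] lies over [V'], a section over [V1] has the same pullback as its restriction to the
    intersection with [V']. *)
Lemma lifts_resl (V V' : opens X) (W : opens Xt) (hV : V' <=o V)
    (D : derivation c V) (E : derivation cT W) : oset W `<=` p @^-1` oset V' ->
  lifts p (der_restrict hV D) E -> lifts p D E.
Proof.
move=> hW L V1 W1 k1 l1 h s.
have h2 : oset W1 `<=` p @^-1` oset (omeet V1 V') by move=> x W1x; split; [exact: h | exact/hW/l1].
rewrite -(pull_resr h h2 (omeetl V1 V')) (L _ _ (omeetr V1 V') l1 h2).
rewrite [der (der_restrict _ _) _ _]/=.
rewrite -(pull_resr h h2 (omeetl V1 V')) (der_res D k1 (subset_trans (omeetl V1 V') k1)).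
by congr (pull p h2 _); exact: der_irr.
Qed.

Lemma pchar_invertible (V : opens B) : invertible_integers (sect V).
Proof.
move=> n; have n0 : (n.+1%:R : k) != 0 by rewrite (pcharf0P k).1.
exists (pull b (fun x _ => I : oset (otop X) (b x)) (c (n.+1%:R)^-1)).
have -> : n.+1%:R = pull b (fun x _ => I : oset (otop X) (b x)) (c n.+1%:R) :> sect V.
  by rewrite !rmorph_nat.
by rewrite -!rmorphM mulfV // !rmorph1.
Qed.

Lemma lift_unique (V : opens X) (W : opens Xt) (D : derivation c V) (E E' : derivation cT W) :
  oset W `<=` p @^-1` oset V -> lifts p D E -> lifts p D E' -> E = E'.
Proof.
move=> hW LE LE'; apply/eqP; rewrite -subr_eq0; apply/eqP.
set F := E - E'.
have F0 (V1 : opens X) (W1 : opens Xt) (k1 : V1 <=o V) (l1 : W1 <=o W)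
    (h : oset W1 `<=` p @^-1` oset V1) s : der F l1 (pull p h s) = 0.
  by rewrite der_sub (LE _ _ k1) (LE' _ _ k1) subrr.
clearbody F.
apply: derivation_eq => W1 l1 s; rewrite [RHS](_ : _ = 0) //.
apply: sect_sep => t W1t.
have [U [WB [ch [WBt _ UV _ gen]]]] := good_chart_exists hi hb (y := nu t) hX
  (I : oset (otop B) (nu t)) (hW t (l1 _ W1t)).
have affWB := chart_affW ch; have [affA normA] := hnu affWB.
set hWB := chart_sub ch in gen.
have [g [hg [n [s' [gt es]]]]] := aff_local_frac affA (omeetr W1 (preim nu WB))
  (res (omeetl W1 (preim nu WB)) s) (conj W1t WBt).
have bA := basic_sub (f := g); rewrite !(res_irr _ bA) resE in es.
have [v] := basic_inv g; rewrite (res_irr _ bA) => gv.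
pose k1 := subset_trans hg (omeetl W1 (preim nu WB)); pose k2 := subset_trans k1 l1.
exists (basic g), k1; split=> //; rewrite rmorph0 (der_res F l1 k2).
have derF := ring_derivation_der F k2.
set nuB := pull nu (@preim_sub _ _ nu WB).
have regh (u : sect (basic g)) :
    res bA (nuB (pull b hWB (chart_eq ch))) * u = 0 -> u = 0.
  apply: aff_regular => // z; apply: (normalisation_regular normA) => r e.
  by apply: (chart_reg (c := ch) (k := @subset_refl _ _)); rewrite res_id.
have FU r : der F k2 (res bA (nuB (pull b hWB r))) = 0.
  have hp : oset (preim nu WB) `<=` p @^-1` oset U by move=> x /= /hWB.
  have -> : res bA (nuB (pull b hWB r)) = pull p (subset_trans bA hp) r.
    by rewrite -(comp_pullE hp hWB (@preim_sub _ _ nu WB)) pull_resl.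
  exact: F0.
have FB r : der F k2 (res bA (nuB r)) = 0.
  apply: (gen [set r | der F k2 (res bA (nuB r)) = 0]) => [s1 s2|s1 s2|s1|s1 u|e w s1] /=.
  - by move=> e1 e2; rewrite !rmorphD (rderD derF) e1 e2 addr0.
  - by move=> e1 e2; rewrite !rmorphM (rderM derF) e1 e2 !mulr0 addr0.
  - exact: FU.
  (* Applying [F] to [s = u f], where [F] kills [s] and [f], leaves f times the derivative of [u];
     the exceptional equation [f] remains regular on the normalisation. *)
  - move=> e; apply: regh; have := FU s1; rewrite e !rmorphM (rderM derF) FU mulr0 add0r.
    by [].
  - move=> ew e1 e2.
    have ew' : res bA (nuB e) * res bA (nuB w) = 1 by rewrite -!rmorphM ew !rmorph1.
    apply: (@rder_fraction_eq0 _ _ _ _ _ (res bA (nuB (e * s1))) 1 derF ew') => //.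
    by rewrite expr1 !rmorphM.
(* A function on the normalisation is a quotient of functions from the blowing up, with regular
   denominator, and [F] kills numerator and denominator. *)
have FA y : der F k2 (res bA y) = 0.
  have [a [d [e reg]]] := normalisation_denominator normA y.
  have regd : forall u, nuB d * u = 0 -> u = 0 by move=> u; rewrite mulrC; exact: reg.
  apply: (aff_regular affA regd (k := bA)).
  have := FB a; rewrite -[nuB a]e rmorphM (rderM derF) FB mulr0 add0r.
  by [].
exact: (rder_fraction_eq0 derF gv es (FA _) (FA _)).
Qed.

Section OneDerivation.
Variables (V : opens X) (D : derivation c V).
Hypothesis invD : forall (V' : opens X) (h : V' <=o V) s,
  ideal_sheaf i s -> ideal_sheaf i (der D h s).

Lemma lift_local t : oset V (p t) -> exists (W : opens Xt) (E : derivation cT W),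
  [/\ oset W t, oset W `<=` p @^-1` oset V & lifts p D E].
Proof.
move=> Vt.
have [U [WB [ch [WBt _ UV noethW _]]]] := good_chart_exists hi hb (y := nu t) hX
  (I : oset (otop B) (nu t)) Vt.
have [affA normA] := hnu (chart_affW ch).
set hWB := chart_sub ch.
have [d [derd dE]] := chart_derivation hi hb ch (ring_derivation_der D UV) (@invD U UV).
have [e [dere eE]] := normalisation_derivation normA noethW (pchar_invertible WB) derd.
set nuB := pull nu (@preim_sub _ _ nu WB) in eE.
have hp : oset (preim nu WB) `<=` p @^-1` oset U by move=> x /= /hWB.
have pE r : pull p hp r = nuB (pull b hWB r) by exact: comp_pullE.
have [|E EP] := @derivation_extend k Xt cT (preim nu WB) e affA dere.
  move=> a.
  have -> : res (@sub_otop _ (preim nu WB)) (cT a) =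
      pull p hp (res (@sub_otop _ U) (c a)).
    have ht : oset (otop Xt) `<=` p @^-1` oset (otop X) by [].
    rewrite (pull_resr (subset_trans (@sub_otop _ (preim nu WB)) ht)) -pull_resl.
    by congr (res _ _); exact: pull_irr.
  by rewrite pE eE dE derC !rmorph0.
exists (preim nu WB), E; split=> //; first by move=> x /= /hWB /UV.
apply: (lifts_resl (hV := UV)) => //.
apply: (lifts_of_generators (h := hp)) => [|s]; first exact: chart_affU ch.
have := EP _ (@subset_refl _ _) (pull p hp s); rewrite !res_id => ->.
rewrite pE eE dE -pE; congr (pull p hp _); rewrite [RHS]/=; exact: der_irr.
Qed.

(** Local lifts agree on overlaps by uniqueness and so glue; being a lift is itself a local
    condition. *)
Lemma lift_exists (W : opens Xt) : oset W `<=` p @^-1` oset V ->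
  exists E : derivation cT W, lifts p D E.
Proof.
move=> hW.
have [||E EP] := sheaf_glue (der_restrict_sheaf cT) (U := W) (P := fun W1 l1 E => lifts p D E).
- move=> W1 W2 l1 l2 E1 E2 W' k1 k2 L1 L2.
  apply: (lift_unique (D := D)); [|exact: lifts_resr|exact: lifts_resr].
  exact: subset_trans k1 (subset_trans l1 hW).
- move=> t Wt; have [W' [E [W't hW' L]]] := lift_local (hW t Wt).
  exists (omeet W W'), (omeetl W W'), (der_restrict (omeetr W W') E).
  by split=> //; exact: lifts_resr.
exists E => V1 W1 hV1 hW1 h s; apply: sect_sep => t W1t.
have [W' [E' [W't hW' L]]] := lift_local (hW t (hW1 _ W1t)).
have := EP (omeet W W') (omeetl W W') (der_restrict (omeetr W W') E') (lifts_resr _ L).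
move=> EE; have l : omeet W1 W' <=o W1 := omeetl W1 W'.
exists (omeet W1 W'), l; split=> //.
have l2 : omeet W1 W' <=o omeet W W' by move=> x [/hW1].
have l3 := subset_trans l hW1; have l4 := omeetr W1 W'.
rewrite (der_res E hW1 l3) !pull_resl -(L V1 _ hV1 l4).
have /(congr1 (fun G => der G l2 (pull p (subset_trans l h) s))) E1 := EE.
transitivity (der (der_restrict (omeetl W W') E) l2 (pull p (subset_trans l h) s)).
  exact: der_irr.
rewrite E1; exact: (der_irr E' (subset_trans l2 (omeetr W W')) l4).
Qed.

End OneDerivation.

End Lifting.

(** * Linear independence of the lifted derivations *)

Section Independence.
Variables (k : fieldType) (X : scheme) (c : {rmorphism k -> sect (otop X)}).
Variables (F : omodule X) (a : omod_mor F (tangent_sheaf c)).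
Hypothesis a_inj : forall U, injective (@omod_fun _ _ _ a U).
Variables (Z : scheme) (i : morphism Z X) (hi : closed_immersion i).
Variables (B : scheme) (b : morphism B X) (hb : is_blowup i b).

(** A relation over the affine [U] between the derivations on [sect U] is a relation of derivations
    of the sheaf, and injectivity of [a] over [U] turns it into one between basis elements. *)
Lemma basis_independent (V : opens X) n (bs : 'I_n -> msect F V) (U : opens X) (UV : U <=o V)
    (e : 'I_n -> sect U) : is_basis bs -> affine U ->
  (forall s, \sum_j e j * der (a V (bs j)) UV s = 0) -> forall j, e j = 0.
Proof.
move=> basis affU e0.
have : \sum_j e j *: mres UV (bs j) = 0.
  apply: (a_inj (U := U)); rewrite omod_mor0 omod_mor_sum.
  apply: (derivation_eq0_affine affU) => s; rewrite der_sum -[RHS](e0 s).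
  apply: eq_bigr => j _; rewrite omod_morZ -omod_mor_res /= res_id; congr (_ * _).
  exact: der_irr.
move=> z; have [d [_ du]] := basis _ UV 0.
have e1 : d = e by apply: du.
have e2 : d = (fun=> 0) by apply: du; rewrite big1 // => j _; rewrite scale0r.
by move=> j; rewrite -e1 e2.
Qed.

(** Away from the exceptional divisor, the blowing up is an isomorphism: its inverse,
    given by the universal property, carries the relation down to [X]. *)
Lemma chart_independent (V : opens X) n (bs : 'I_n -> msect F V) (U : opens X) (W : opens B)
    (ch : chart i b U W) (UV : U <=o V) (x : 'I_n -> sect W) : is_basis bs ->
  (forall s, nilpotent (\sum_j x j *
     pull b (chart_sub ch) (der (a V (bs j)) UV s))) ->
  forall j, nilpotent (x j * pull b (chart_sub ch) (chart_eq ch)).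
Proof.
move=> basis; set hW := chart_sub ch; set f := chart_eq ch => nilx j.
have affU := chart_affU ch.
(* A section that is invertible at no point of an affine open set is nilpotent. A point [w] where
   the product is invertible lies off the exceptional divisor. *)
apply: (aff_nilp (chart_affW ch)) => w /unit_atM [xw fw].
have Ww := unit_at_mem xw.
have fx : unit_at f (b w) := pull_local Ww fw.
pose V0 := basic f; have V0U : V0 <=o U := basic_sub (f := f).
have affV0 : affine V0 := affine_basic f affU.
have noethV0 := noetherian_basic (f := f) affU (chart_noethU ch).
have [W1 [W1w affW1 W1sub]] := affine_nbhd (V := omeet W (preim b V0)) (conj Ww fx).
have hW1 : oset W1 `<=` b @^-1` oset V0 by move=> y /W1sub [].
have [v] := basic_inv f; rewrite (res_irr _ V0U) => fv.
have unit_reg (A : comPzRingType) (g g' r : A) : g * g' = 1 -> g * r = 0 -> r = 0.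
  by move=> gg e; apply: (mulr_can gg); rewrite e mulr0.
have bfv : pull b hW1 (res V0U f) * pull b hW1 v = 1 by rewrite -rmorphM fv rmorph1.
(* Where [f] is invertible the ideal of [Z] is the unit ideal, so [sect V0] itself may serve as test
   ring: [g] is a section of the blowing up over [V0]. *)
have [|||s Is|g [m [gb mc gm mu [gV gmW gmy]]]] := blowup_lift hi hb (hW := hW1) (psi := idfun)
    (e := pull b hW1) (f := res V0U f) affV0 affW1 (fun=> erefl).
- by apply: ideal_sheaf_res; exact: chart_eq_ideal.
- by move=> r; exact: unit_reg fv.
- by move=> r; exact: unit_reg bfv.
- by exists (s * v); rewrite /= -mulrA [v * _]mulrC fv mulr1.
have [p [gp pu]] := gmy w W1w.
have oW : spec_open (g @^-1` oset W) := open_preim g W.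
have Wgp : oset W (g (m p)) by rewrite gp.
have [a0 [pa0 a0W]] := oW (m p) Wgp.
(* On D(a0) the section [g] lands in [W], so the coefficients [x] pull back to fractions there, with
   numerators [al] and a common denominator. *)
pose T0 : opens (Spec (sect V0)) := spec_basic a0.
have hT0 : oset T0 `<=` g @^-1` oset W by exact: a0W.
have [N NP] : exists N, forall l, exists al,
    spec_const T0 a0 ^+ N * pull g hT0 (x l) = spec_const T0 al.
  apply: fin_common_bound => [l n1 n2 n12 [al e]|l].
    exists (a0 ^+ (n2 - n1) * al); rewrite [RHS]rmorphM -e rmorphXn mulrA -exprD.
    by rewrite subnK.
  by have [//|n1 [al e]] := @spec_frac _ T0 a0 (pull g hT0 (x l)); exists n1, al.
have {NP} /choice [al alP] := NP.
have V0V := subset_trans V0U UV.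
pose dV l (s : sect V0) := der (a V (bs l)) V0V s.
have dVder l : ring_derivation (dV l) by exact: ring_derivation_der.
have gbU (r : sect U) : pull g hT0 (pull b hW r) = spec_const T0 (res V0U r).
  pose W' := omeet W (preim b V0).
  have h1 : oset W' `<=` b @^-1` oset V0 by exact: omeetr.
  have h2 : oset T0 `<=` g @^-1` oset W' by move=> q T0q; split; [exact: a0W | exact: gV].
  rewrite -(gb W' T0 h1 h2) -(pull_resr hT0 h2 (omeetl W (preim b V0))) pull_resl.
  by congr (pull g h2 _); rewrite (pull_resr (subset_trans (omeetl W (preim b V0)) hW)).
(* The power of [a0] needed to return from D(a0) depends on [s]; since nilpotency is all that is
   claimed, a single factor [a0] serves every [s]. *)
have nilU s : nilpotent (\sum_l (a0 * al l) * dV l (res V0U s)).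
  have [M eM] := nilx s.
  have : spec_const T0 ((\sum_l al l * dV l (res V0U s)) ^+ M) = 0.
    have -> : \sum_l al l * dV l (res V0U s) = \sum_l al l * res V0U (der (a V (bs l)) UV s).
      by apply: eq_bigr => l _; rewrite /dV (der_res _ UV V0V).
    rewrite rmorphXn rmorph_sum.
    have -> : \sum_l spec_const T0 (al l * res V0U (der (a V (bs l)) UV s)) =
        spec_const T0 a0 ^+ N * pull g hT0 (\sum_l x l * pull b hW (der (a V (bs l)) UV s)).
      rewrite rmorph_sum mulr_sumr; apply: eq_bigr => l _.
      by rewrite rmorphM -alP -gbU rmorphM mulrA.
    by rewrite exprMn -[pull g hT0 _ ^+ M]rmorphXn eM rmorph0 mulr0.
  move=> /(spec_zero (f := a0)) [//|K eK].
  exists (K + M)%N.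
  have -> : \sum_l a0 * al l * dV l (res V0U s) = a0 * \sum_l al l * dV l (res V0U s).
    by rewrite mulr_sumr; apply: eq_bigr => l _; rewrite mulrA.
  rewrite exprMn addnC !exprD.
  transitivity (a0 ^+ M * (\sum_l al l * dV l (res V0U s)) ^+ K *
    (a0 ^+ K * (\sum_l al l * dV l (res V0U s)) ^+ M)); first by ring.
  by rewrite eK mulr0.
(* Functions on [V0] have powers of [f] as denominators, and the quotient rule extends the relation
   to them. *)
have nilV0 s : nilpotent (\sum_l (a0 * al l) * dV l s).
  have [nil0 nilD nilM] := nilpotent_ideal (sect V0).
  have [q [s' es]] := aff_frac affU V0U s (@subset_refl _ _) (@subset_refl _ _).
  have E : res V0U f ^+ q.+1 * (\sum_l (a0 * al l) * dV l s) =
      res V0U f * (\sum_l (a0 * al l) * dV l (res V0U s')) +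
      - (q%:R * res V0U s') * (\sum_l (a0 * al l) * dV l (res V0U f)).
    rewrite !mulr_sumr -big_split; apply: eq_bigr => l _.
    by rewrite mulrCA (rder_fraction (dVder l) es) /=; ring.
  have -> : \sum_l (a0 * al l) * dV l s =
      v ^+ q.+1 * (res V0U f ^+ q.+1 * (\sum_l (a0 * al l) * dV l s)).
    by rewrite mulrA [v ^+ _ * _]mulrC (invX _ fv) mul1r.
  by apply: (nilM); rewrite E; apply: (nilD); apply: (nilM); exact: nilU.
have [M eM] : nilpotent (a0 * al j).
  apply: (independent_mod_nilpotents (D := dV) (c := fun l => a0 * al l)) => //.
  by move=> e e0; exact: (basis_independent basis affV0 e0).
have T0p : oset T0 (m p) by exact: pa0.
(* At the point over [w], [al j] is invertible because [x j] is, and so is [a0]; their product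
   cannot be nilpotent. *)
have : unit_at (spec_const T0 (al j) : @sect (Spec _) T0) (m p).
  rewrite -alP; apply/unit_atM; split.
    by apply: unit_atX; apply/(@spec_const_unit _ T0).
  by apply/(unit_at_pull hT0) => //; rewrite gp.
move=> /(@spec_const_unit _ T0 _ _ T0p) pal.
apply: (@avoids0 _ (m p)); rewrite -eM; apply: avoidsX; exact/avoidsM.
Qed.

End Independence.

(** * The pulled back foliation *)

Section PullbackFoliation.
Variables (k : fieldType) (hk : [pchar k] =i pred0).
Variables (X : scheme) (c : {rmorphism k -> sect (otop X)}) (hX : locally_noetherian X).
Variables (F : omodule X) (a : omod_mor F (tangent_sheaf c)).
Hypotheses (hF : foliation a) (hFfree : locally_free F).
Variables (Z : scheme) (i : morphism Z X) (hi : closed_immersion i).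
Hypothesis hZ : foliation_invariant a i.
Variables (B : scheme) (b : morphism B X) (hb : is_blowup i b).
Variables (Xt : scheme) (nu : morphism Xt B) (hnu : is_normalisation nu).
Variables (piF : omodule Xt) (eta : mod_over (comp_mor b nu) F piF).
Hypothesis heta : is_pullback eta.

Local Notation p := (comp_mor b nu).
Local Notation cT := (induced_base p c).

(** Lifts are chosen arbitrarily; their uniqueness makes the choice additive, linear and compatible
    with restriction. *)
Lemma foliation_lift : exists gamma : mod_over p F (tangent_sheaf cT),
  forall (V : opens X) (W : opens Xt) (h : oset W `<=` p @^-1` oset V) (u : msect F V),
    lifts p (a V u) (mo_fun gamma h u).
Proof.
have ex (V : opens X) (W : opens Xt) (h : oset W `<=` p @^-1` oset V) (u : msect F V) :
    exists E : derivation cT W, lifts p (a V u) E.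
  by apply: (lift_exists hk hX hi hb hnu) => // V' hV s; exact: hZ.
pose g (V : opens X) (W : opens Xt) (h : oset W `<=` p @^-1` oset V) (u : msect F V) :
  msect (tangent_sheaf cT) W := projT1 (cid (ex V W h u)).
have gP V W h u : lifts p (a V u) (g V W h u) := projT2 (cid (ex V W h u)).
have uniq V W h u (E : derivation cT W) : lifts p (a V u) E -> g V W h u = E.
  by move=> L; exact: (lift_unique hX hi hb hnu h (gP V W h u) L).
have gD V W h : {morph g V W h : m m' / m + m'}.
  move=> m m'; apply: uniq; rewrite omod_morD => V1 W1 k1 l1 h1 s.
  transitivity (der (g V W h m : derivation cT W) l1 (pull p h1 s) +
    der (g V W h m' : derivation cT W) l1 (pull p h1 s)); first by [].
  by rewrite (gP V W h m V1 W1 k1 l1 h1) (gP V W h m' V1 W1 k1 l1 h1) -rmorphD.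
have gZ V W h (r : sect V) (m : msect F V) : g V W h (r *: m) = pull p h r *: g V W h m.
  apply: uniq; rewrite omod_morZ => V1 W1 k1 l1 h1 s.
  transitivity (res l1 (pull p h r) * der (g V W h m : derivation cT W) l1 (pull p h1 s)).
    by [].
  rewrite (gP V W h m V1 W1 k1 l1 h1) pull_resl -(pull_resr _ h1 k1) -rmorphM.
  by [].
have gR (V V' : opens X) (W W' : opens Xt)
    (h : oset W `<=` p @^-1` oset V) (h' : oset W' `<=` p @^-1` oset V')
    (hV : V' <=o V) (hW : W' <=o W) (m : msect F V) :
    mres hW (g V W h m) = g V' W' h' (mres hV m).
  symmetry; apply: uniq; rewrite -omod_mor_res; exact: lifts_res.
by exists (ModOver gD gZ gR) => V W h u; exact: gP.
Qed.

Lemma pullback_locally_free : locally_free piF.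
Proof.
move=> t; have [V [n [bs [Vt basis]]]] := hFfree (p t).
exists (preim p V), n, (fun j => mo_fun eta (@preim_sub _ _ p V) (bs j)); split=> //.
exact: (pullback_basis heta basis).
Qed.

Lemma locally_free_coherent : coherent piF.
Proof.
move=> t; have [U0 [n [bs [U0t basis]]]] := pullback_locally_free t.
have [U [Ut affU UU0]] := affine_nbhd U0t.
pose bU j := mres UU0 (bs j).
have span V (h : V <=o U) (m : msect piF V) :
    exists e : 'I_n -> sect V, m = \sum_j e j *: mres h (bU j).
  have [e [-> _]] := basis V (subset_trans h UU0) m; exists e.
  by apply: eq_bigr => j _; rewrite (mres_mres _ _ (subset_trans h UU0)).
have indep V (h : V <=o U) (e : 'I_n -> sect V) :
    \sum_j e j *: mres h (bU j) = 0 -> forall j, e j = 0.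
  move=> e0; have [d [_ du]] := basis V (subset_trans h UU0) 0.
  have e1 : d = e.
    apply: du; rewrite -[LHS]e0; apply: eq_bigr => j _.
    by rewrite (mres_mres _ _ (subset_trans h UU0)).
  have e2 : d = (fun=> 0) by apply: du; rewrite big1 // => j _; rewrite scale0r.
  by move=> j; rewrite -e1 e2.
exists U; split=> //.
- exists n, bU => m; have [e ->] := span U (@subset_refl _ _) m; exists e.
  by apply: eq_bigr => j _; rewrite mres_id.
- move=> f m; have [e ->] := span _ (basic_sub (f := f)) m.
  have [N NP] : exists N, forall j, exists r : sect U,
      res (basic_sub (f := f)) f ^+ N * e j = res (basic_sub (f := f)) r.
    apply: fin_common_bound => [j n1 n2 n12 [r er]|j].
      exists (f ^+ (n2 - n1) * r).
      by rewrite [RHS]rmorphM -er rmorphXn mulrA -exprD subnK.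
    exact: (aff_frac affU (basic_sub (f := f)) (e j) (@subset_refl _ _) (@subset_refl _ _)).
  have {NP} /choice [r rP] := NP.
  exists N, (\sum_j r j *: bU j); rewrite mres_sum scaler_sumr; apply: eq_bigr => j _.
  by rewrite mresZ scalerA rP.
- move=> f m; have [e ->] := span U (@subset_refl _ _) m.
  rewrite mres_sum => e0.
  have e1 j : res (basic_sub (f := f)) (e j) = 0.
    apply: (indep _ (basic_sub (f := f)) (fun j => res (basic_sub (f := f)) (e j))) j.
    rewrite -[RHS]e0; apply: eq_bigr => j _.
    by rewrite mresZ mres_id.
  have [N NP] : exists N, forall j, f ^+ N * e j = 0.
    apply: fin_common_bound => [j n1 n2 n12 er|j].
      by rewrite -(subnK n12) exprD -mulrA er mulr0.
    exact: (aff_zero affU (@subset_refl _ _) (e1 j)).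
  exists N; rewrite scaler_sumr big1 // => j _.
  by rewrite scalerA NP scale0r.
Qed.

Variable theta : omod_mor piF (tangent_sheaf cT).
Hypothesis thetaP : forall (V : opens X) (W : opens Xt) (h : oset W `<=` p @^-1` oset V)
  (u : msect F V), lifts p (a V u) (theta W (mo_fun eta h u)).

(** The coefficients of a relation on the normalisation are carried to the chart of the blowing up
    by clearing denominators, where [chart_independent] applies. The denominators and the
    exceptional equation are regular on the reduced normalisation, so the coefficients vanish. *)
Lemma theta_ker (W : opens Xt) (w : msect piF W) : theta W w = 0 -> w = 0.
Proof.
move=> tw; apply: msect_sep => t Wt.
have [_ a_inj _] := hF.
have [V [n [bs [Vt basis]]]] := hFfree (p t).
have [U [WB [ch [WBt _ UV _ _]]]] := good_chart_exists hi hb (y := nu t) hX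
  (I : oset (otop B) (nu t)) Vt.
have affWB := chart_affW ch; have [affA normA] := hnu affWB.
set hWB := chart_sub ch.
set nuB := pull nu (@preim_sub _ _ nu WB).
have [g [gt gW]] := aff_basis affA (WBt : oset (preim nu WB) t) Wt.
have bA := basic_sub (f := g); have [v] := basic_inv g; rewrite (res_irr _ bA) => gv.
exists (basic g), gW; split=> //; rewrite mres0.
have kV : basic g <=o preim p V by move=> x /bA /hWB /UV.
have [e [ew _]] := pullback_basis heta basis (@preim_sub _ _ p V) kV (mres gW w).
have hU : oset (basic g) `<=` p @^-1` oset U by move=> x /bA /hWB.
have hpA : oset (preim nu WB) `<=` p @^-1` oset U by move=> x /hWB.
have pE r : pull p hU r = res bA (nuB (pull b hWB r)).
  rewrite -(comp_pullE hpA hWB (@preim_sub _ _ nu WB)) pull_resl.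
  exact: pull_irr.
pose E j : derivation cT (basic g) :=
  theta (basic g) (mres kV (mo_fun eta (@preim_sub _ _ p V) (bs j))).
have EP j : lifts p (a V (bs j)) (E j).
  by rewrite /E -omod_mor_res; apply: lifts_resr; exact: thetaP.
have sumE : \sum_j e j *: E j = 0.
  have : theta (basic g) (mres gW w) = 0 by rewrite -omod_mor_res tw mres0.
  by rewrite ew omod_mor_sum => e0; rewrite -[RHS]e0; apply: eq_bigr => j _; rewrite omod_morZ.
have rel s : \sum_j e j * res bA (nuB (pull b hWB (der (a V (bs j)) UV s))) = 0.
  have := congr1 (fun D : derivation cT (basic g) =>
    der D (@subset_refl _ (oset (basic g))) (pull p hU s)) sumE.
  rewrite der_sum => e0; rewrite -[RHS]e0; apply: eq_bigr => j _.
  rewrite -pE -(EP j _ _ UV (@subset_refl _ (oset (basic g)))).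
  by rewrite [RHS](_ : _ = res (@subset_refl _ (oset (basic g))) (e j) *
    der (E j) (@subset_refl _ (oset (basic g))) (pull p hU s)) // res_id.
have [N NP] : exists N, forall j, exists y : sect (preim nu WB), res bA g ^+ N * e j = res bA y.
  apply: fin_common_bound => [j n1 n2 n12 [y ey]|j].
    exists (g ^+ (n2 - n1) * y).
    by rewrite [RHS]rmorphM -ey rmorphXn mulrA -exprD subnK.
  exact: (aff_frac affA bA (e j) (@subset_refl _ _) (@subset_refl _ _)).
have {NP} /choice [y yP] := NP.
(* Returning from D(g) costs a power of [g] depending on [s]; reducedness of the normalisation
   replaces it by the single factor [g]. *)
have relA s : \sum_j (g * y j) * nuB (pull b hWB (der (a V (bs j)) UV s)) = 0.
  have [|m em] := aff_zero affA (h := bA) (f := g) (V := basic g)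
    (s := \sum_j y j * nuB (pull b hWB (der (a V (bs j)) UV s))) (@subset_refl _ _).
    rewrite -[RHS](mulr0 (res bA g ^+ N)) -(rel s) mulr_sumr rmorph_sum.
    by apply: eq_bigr => j _; rewrite rmorphM -yP mulrA.
  apply: (normalisation_reduced normA).
  have -> : \sum_j (g * y j) * nuB (pull b hWB (der (a V (bs j)) UV s)) =
      g * \sum_j y j * nuB (pull b hWB (der (a V (bs j)) UV s)).
    by rewrite mulr_sumr; apply: eq_bigr => j _; rewrite mulrA.
  move: em; set z := \sum_j _ => em; exists m.+1.
  transitivity (g * z ^+ m * (g ^+ m * z)); first by rewrite exprMn !exprS; ring.
  by rewrite em mulr0.
have /choice [a' aP] j := normalisation_denominator normA (g * y j).
have /choice [d dP] := aP.
(* A common denominator [s0] of the coefficients, with numerators [a0 j] on the blowing up. *)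
pose s0 := \prod_j d j; pose a0 j := a' j * \prod_(l | l != j) d l.
have s0reg z : z * nuB s0 = 0 -> z = 0.
  rewrite /s0; move: z; elim/big_ind: _ => [z|s1 s2 r1 r2 z|j _ z].
  - by rewrite rmorph1 mulr1.
  - by rewrite rmorphM mulrA => /r2 /r1.
  - exact: (dP j).2.
have a0P j : g * y j * nuB s0 = nuB (a0 j).
  by rewrite /s0 (bigD1 j) //= /a0 !rmorphM mulrA (dP j).1.
have nil s : nilpotent (\sum_j a0 j * pull b hWB (der (a V (bs j)) UV s)).
  apply: (normalisation_ker normA).
  transitivity (nuB s0 * \sum_j (g * y j) * nuB (pull b hWB (der (a V (bs j)) UV s))).
    rewrite rmorph_sum mulr_sumr; apply: eq_bigr => j _.
    by rewrite [LHS]rmorphM -/nuB -a0P mulrA [nuB s0 * _]mulrC.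
  by rewrite relA mulr0.
have nil2 := chart_independent a_inj hi hb basis nil.
have y0 j : g * y j = 0.
  apply: s0reg; apply: (normalisation_regular normA (h := pull b hWB (chart_eq ch))).
    by move=> r er; apply: (chart_reg (c := ch) (k := @subset_refl _ _)); rewrite res_id.
  rewrite mulrC a0P -rmorphM; apply: (normalisation_reduced normA).
  by have [m em] := nil2 j; exists m; rewrite -rmorphXn em rmorph0.
rewrite ew big1 // => j _.
suff -> : e j = 0 by rewrite scale0r.
apply: (mulr_can (invX N.+1 gv)).
by rewrite mulr0 exprS -mulrA yP -rmorphM y0 rmorph0.
Qed.

Lemma theta_inj (W : opens Xt) : injective (@omod_fun _ _ _ theta W).
Proof.
move=> u v uv; apply/eqP; rewrite -subr_eq0; apply/eqP; apply: theta_ker.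
by rewrite omod_morB uv subrr.
Qed.

(** * The image of the pulled back foliation is closed under the bracket *)

Let image (W : opens Xt) (D : derivation cT W) := exists w : msect piF W, theta W w = D.

Lemma imageD W (D E : derivation cT W) : image D -> image E -> image (D + E).
Proof. by move=> [u <-] [v <-]; exists (u + v); rewrite omod_morD. Qed.

Lemma imageZ W (r : sect W) (D : derivation cT W) : image D -> image (r *: D).
Proof. by move=> [u <-]; exists (r *: u); rewrite omod_morZ. Qed.

Lemma image0 W : image (0 : derivation cT W).
Proof. by exists 0; rewrite omod_mor0. Qed.

Lemma bracketDl W (D D' E : derivation cT W) : bracket (D + D') E = bracket D E + bracket D' E.
Proof.
apply: derivation_eq => V h s.
transitivity (der D h (der E h s) + der D' h (der E h s) -
  der E h (der D h s + der D' h s)); first by [].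
by rewrite derD opprD addrACA.
Qed.

Lemma bracketC W (D E : derivation cT W) : bracket D E = - bracket E D.
Proof.
apply: derivation_eq => V h s.
transitivity (- (der E h (der D h s) - der D h (der E h s))); last by [].
by rewrite opprB.
Qed.

Lemma bracketZl W (r : sect W) (D E : derivation cT W) :
  bracket (r *: D) E = r *: bracket D E - der E (@subset_refl _ (oset W)) r *: D.
Proof.
apply: derivation_eq => V h s.
transitivity (res h r * der D h (der E h s) - der E h (res h r * der D h s)); first by [].
transitivity (res h r * (der D h (der E h s) - der E h (der D h s)) -
  res h (der E (@subset_refl _ (oset W)) r) * der D h s); last by [].
by rewrite derM (der_res E _ h); ring.
Qed.

Lemma image_bracketZl W (r : sect W) (D E : derivation cT W) :
  image D -> image (bracket D E) -> image (bracket (r *: D) E).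
Proof.
move=> iD iDE; rewrite bracketZl; apply: imageD; first exact: imageZ.
by rewrite -scaleNr; exact: imageZ.
Qed.

Lemma image_bracket_suml W (I : finType) (r : I -> sect W) (D : I -> derivation cT W)
    (E : derivation cT W) :
  (forall j, image (D j)) -> (forall j, image (bracket (D j) E)) ->
  image (bracket (\sum_j r j *: D j) E).
Proof.
move=> iD iDE; elim/big_ind: _ => [|D1 D2 i1 i2|j _].
- rewrite (_ : bracket 0 E = 0); first exact: image0.
  apply: derivation_eq => V h s; transitivity (0 - der E h 0); first by [].
  by rewrite der0 subr0.
- by rewrite bracketDl; exact: imageD.
- exact: image_bracketZl.
Qed.

(** Membership in the image is local, because [theta] is injective and preimages therefore glue.
    Locally the image is spanned by the lifts of a basis, and the Leibniz rule reduces the bracket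
    to brackets of these lifts. *)
Lemma image_bracket (W : opens Xt) (u v : msect piF W) :
  image (bracket (theta W u : derivation cT W) (theta W v)).
Proof.
pose P (W1 : opens Xt) (l : W1 <=o W) (w : msect piF W1) :=
  theta W1 w = der_restrict l (bracket (theta W u : derivation cT W) (theta W v)).
have loc t : oset W t -> exists (W1 : opens Xt) (l : W1 <=o W) (w : msect piF W1),
    oset W1 t /\ P W1 l w.
  move=> Wt; have [_ _ a_bracket] := hF.
  have [V [n [bs [Vt basis]]]] := hFfree (p t).
  pose W1 := omeet W (preim p V); have l1 : W1 <=o W := omeetl W (preim p V).
  have l2 : W1 <=o preim p V := omeetr W (preim p V).
  have hW1 : oset W1 `<=` p @^-1` oset V := l2.
  pose D j : derivation cT W1 := theta W1 (mres l2 (mo_fun eta (@preim_sub _ _ p V) (bs j))).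
  have DP j : lifts p (a V (bs j)) (D j).
    by rewrite /D -omod_mor_res; apply: lifts_resr; exact: thetaP.
  have iD j : image (D j) by eexists.
  have DD j l : image (bracket (D j) (D l)).
    have [w aw] := a_bracket V (bs j) (bs l).
    (* The bracket of two lifts lifts the bracket on [X], which the foliation contains; uniqueness
       of lifts identifies it with the image of [w]. *)
    exists (mo_fun eta hW1 w); apply: (lift_unique hX hi hb hnu hW1 (thetaP hW1 w)).
    rewrite aw => V1 W2 k1 k2 h s.
    transitivity (der (D j) k2 (der (D l) k2 (pull p h s)) - der (D l) k2 (der (D j) k2 (pull p h s))).
      by [].
    rewrite (DP j _ _ k1) (DP l _ _ k1) (DP j _ _ k1) (DP l _ _ k1) -rmorphB.
    by [].
  have span (w : msect piF W) : exists e : 'I_n -> sect W1,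
      theta W1 (mres l1 w) = \sum_j e j *: D j.
    have [e [-> _]] := pullback_basis heta basis (@preim_sub _ _ p V) l2 (mres l1 w).
    by exists e; rewrite omod_mor_sum; apply: eq_bigr => j _; rewrite omod_morZ.
  have [e eu] := span u; have [e' ev] := span v.
  have : image (bracket (\sum_j e j *: D j) (\sum_j e' j *: D j)).
    apply: image_bracket_suml => // j; rewrite bracketC -scaleN1r; apply: imageZ.
    apply: image_bracket_suml => // l.
  move=> [w wP]; exists W1, l1, w; split=> //.
  rewrite /P wP -eu -ev -!omod_mor_res; apply: derivation_eq => V1 h s.
  by rewrite /=; congr (_ - _).
have [|w wP] := sheaf_glue (mres_sheaf piF) (U := W) (P := P) _ loc.
  move=> W1 W2 l1 l2 w1 w2 W' k1 k2 e1 e2; apply: theta_inj.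
  rewrite -!omod_mor_res e1 e2; apply: derivation_eq => V h s.
  exact: (der_irr (bracket (theta W u : derivation cT W) (theta W v))
    (subset_trans (subset_trans h k1) l1) (subset_trans (subset_trans h k2) l2)).
exists w; apply: (sheaf_sep (der_restrict_sheaf cT)) => t /loc [W1 [l1 [w1 [W1t Pw1]]]].
exists W1, l1; split=> //; rewrite -Pw1 -(wP _ _ _ Pw1); exact: (omod_mor_res theta l1 w).
Qed.

End PullbackFoliation.

Local Close Scope ring_scope.
Local Close Scope classical_set_scope.
Unset Implicit Arguments.

Theorem lemma5p16 (k : fieldType) (hk : [pchar k]%R =i pred0)
  (X : scheme) (c : {rmorphism k -> sect (otop X)}) (hX : locally_noetherian X)
  (F : omodule X) (a : omod_mor F (tangent_sheaf c))
  (hF : foliation a) (hFfree : locally_free F)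
  (Z : scheme) (i : morphism Z X) (hi : closed_immersion i) (hZ : foliation_invariant a i)
  (B : scheme) (b : morphism B X) (hb : is_blowup i b)
  (Xt : scheme) (nu : morphism Xt B) (hnu : is_normalisation nu)
  (hfin : finite_morphism nu)
  (piF : omodule Xt) (eta : mod_over (comp_mor b nu) F piF) (heta : is_pullback eta) :
  locally_free piF /\
  exists theta : omod_mor piF (tangent_sheaf (induced_base (comp_mor b nu) c)),
    (forall (V : opens X) (W : opens Xt)
       (h : forall x, oset W x -> oset V (comp_mor b nu x)) (u : msect F V),
       lifts (comp_mor b nu) (a V u) (theta W (mo_fun eta h u))) /\
    foliation theta.
Proof.
split; first exact: (pullback_locally_free hFfree heta).
have [gamma gammaP] := foliation_lift hk hX hi hZ hb hnu.
have [theta [thetaE _]] := heta _ gamma.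
have thetaP (V : opens X) (W : opens Xt) (h : forall x, oset W x -> oset V (comp_mor b nu x))
    (u : msect F V) : lifts (comp_mor b nu) (a V u) (theta W (mo_fun eta h u)).
  by rewrite thetaE; exact: gammaP.
exists theta; split=> //; split.
- exact: (locally_free_coherent hFfree heta).
- exact: (theta_inj hX hF hFfree hi hb hnu heta thetaP).
- exact: (image_bracket hX hF hFfree hi hb hnu heta thetaP).
Qed.
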